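(* Let $\{Y_x\}_{x\in\mathbb{Z}^d}$ be i.i.d. $\mathbb{R}^d$-valued random variables with density $g$ with respect to Lebesgue measure, let $\Pi=\{x+Y_x:x\in\mathbb{Z}^d\}$, and for $S\subset\mathbb{Z}^d$ let $\Pi_S=\{x+Y_x:x\in\mathbb{Z}^d\setminus S\}$. (i) If $\alpha<2d$ and $$\inf_{x\in\mathbb{R}^d}\frac{g(x)}{1\wedge|x|^{-\alpha}}>0,$$ then $\Pi$ is $k$-deletion tolerant and $k$-insertion tolerant for all $k\ge1$, and the laws of $\Pi$ and $\Pi_S$ are mutually absolutely continuous for every finite set $S\subset\mathbb{Z}^d$. (ii) If $\alpha>2d$ and $$\sup_{x\in\mathbb{R}^d}\frac{g(x)}{1\wedge|x|^{-\alpha}}<\infty,$$ then there exists $\epsilon>0$ such that for all $0<\epsilon'<\epsilon$ and all $k\ge 1$ the perturbed lattice $\{x+\epsilon'Y_x:x\in\mathbb{Z}^d\}$ is $k$-deletion singular. The same conclusion also holds if $\alpha>2d$ and the supremum condition is replaced by $\mathbb{E}|Y_x|^{\alpha-d}<\infty$.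
   Context: Notation: $a\wedge b=\min(a,b)$. Absolute continuity and mutual singularity of two random objects always refer to their laws. For a point process $\Pi$ in $\mathbb{R}^d$, a $\Pi$-point is an $\mathbb{R}^d$-valued random variable $Z$ with $Z\in\Pi$ almost surely. $\Pi$ is $k$-deletion tolerant if for all (almost surely) distinct $\Pi$-points $Z_1,\dots,Z_k$, the law of $\Pi\setminus\{Z_1,\dots,Z_k\}$ is absolutely continuous with respect to the law of $\Pi$; it is $k$-deletion singular if for all such $Z_1,\dots,Z_k$ the laws of $\Pi$ and $\Pi\setminus\{Z_1,\dots,Z_k\}$ are mutually singular. $\Pi$ is $k$-insertion tolerant if for every Borel set $V\subset\mathbb{R}^d$ with Lebesgue measure in $(0,\infty)$, when $U_1,\dots,U_k$ are independent uniform points in $V$, independent of $\Pi$, the law of $\Pi\cup\{U_1,\dots,U_k\}$ is absolutely continuous with respect to the law of $\Pi$. *)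

(* Defs.v *)
From HB Require Import structures.
From mathcomp Require Import all_boot all_order all_algebra.
From mathcomp Require Import all_classical all_reals all_analysis.

Set Implicit Arguments.
Unset Strict Implicit.
Unset Printing Implicit Defensive.

Import Order.TTheory GRing.Theory Num.Theory.
Import numFieldNormedType.Exports.

Local Open Scope classical_set_scope.
Local Open Scope ring_scope.

(* R^d is d.-tuple R and Z^d is d.-tuple int. The sigma-algebra that the
   library puts on d.-tuple R is generated by the coordinates, so its
   measurable sets are the Borel sets of R^d. *)

Section lebesgue_tuple.
Context {R : realType}.

Definition cons_pair n (p : measurableTypeR R * n.-tuple R) : n.+1.-tuple R :=
  [tuple of (p.1 : R) :: p.2].

Lemma measurable_cons_pair n :
  measurable_fun [set: measurableTypeR R * n.-tuple R] (@cons_pair n).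
Proof.
apply: (@measurable_cons _ _ _ R (fun p : measurableTypeR R * n.-tuple R => p.1 : R)).
  exact: measurable_fst.
exact: measurable_snd.
Qed.

Section step.
Variables (n : nat) (mu : {sigma_finite_measure set (n.-tuple R) -> \bar R}).

Definition lebesgue_cons : set (n.+1.-tuple R) -> \bar R :=
  pushforward (@lebesgue_measure R \x mu)%E (@cons_pair n).

Let mpre A : measurable A -> measurable (@cons_pair n @^-1` A).
Proof.
by move=> mA; rewrite -[X in measurable X]setTI; exact: measurable_cons_pair.
Qed.

Let lebesgue_cons0 : lebesgue_cons set0 = 0%E.
Proof. by rewrite /lebesgue_cons /pushforward preimage_set0; exact: (measure0 (@lebesgue_measure R \x mu)%E). Qed.

Let lebesgue_cons_ge0 A : (0 <= lebesgue_cons A)%E.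
Proof. exact: (measure_ge0 (@lebesgue_measure R \x mu)%E). Qed.

Let lebesgue_cons_sigma_additive : semi_sigma_additive lebesgue_cons.
Proof.
move=> F mF tF mUF; rewrite /lebesgue_cons /pushforward preimage_bigcup.
apply: (@measure_semi_sigma_additive _ _ _ (@lebesgue_measure R \x mu)%E).
- by move=> k; exact: mpre.
- apply/trivIsetP => /= i j _ _ ij; rewrite -preimage_setI.
  by move/trivIsetP : tF => /(_ _ _ _ _ ij) ->//; rewrite preimage_set0.
- by rewrite -preimage_bigcup; exact: mpre.
Qed.

HB.instance Definition _ := isMeasure.Build _ _ _ lebesgue_cons
  lebesgue_cons0 lebesgue_cons_ge0 lebesgue_cons_sigma_additive.

Let lebesgue_cons_sigma_finite : sigma_finite setT lebesgue_cons.
Proof.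
have /sigma_finiteP[F [FT ndF Foo]] := sigma_finiteT (@lebesgue_measure R).
have /sigma_finiteP[G [GT ndG Goo]] := sigma_finiteT mu.
pose split (t : n.+1.-tuple R) : measurableTypeR R * n.-tuple R :=
  (thead t, [tuple of behead t]).
have msplit : measurable_fun setT split.
  apply/measurable_fun_pairP; split; first exact: measurable_tnth.
  exact: measurable_behead.
have splitK p : split (cons_pair p) = p.
  by case: p => a b; rewrite /split theadE; congr pair; apply: val_inj.
exists (fun k => split @^-1` (F k `*` G k)).
  apply/seteqP; split => // t _.
  have : [set: measurableTypeR R] (split t).1 by [].
  have : [set: n.-tuple R] (split t).2 by [].
  rewrite FT GT => -[j _ Gj] [i _ Fi]; exists (maxn i j) => //; split => /=.
    by move: Fi; exact/subsetPset/ndF/leq_maxl.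
  by move: Gj; exact/subsetPset/ndG/leq_maxr.
move=> k; have [mF ltF] := Foo k; have [mG ltG] := Goo k.
have mFG : measurable (F k `*` G k) by exact: measurableX.
split; first by rewrite -[X in measurable X]setTI; exact: msplit.
rewrite /lebesgue_cons /pushforward -comp_preimage.
rewrite (_ : split \o _ = id) ?preimage_id; last by apply/funext => p; exact: splitK.
by rewrite product_measure1E// lte_mul_pinfty// ge0_fin_numE.
Qed.

HB.instance Definition _ :=
  Measure_isSigmaFinite.Build _ _ _ lebesgue_cons lebesgue_cons_sigma_finite.

End step.

(* d-dimensional Lebesgue measure, as a d-fold product of the one-dimensional
   one; see lebesgue_tuple_box *)
Fixpoint lebesgue_tuple n : {sigma_finite_measure set (n.-tuple R) -> \bar R} :=
  if n is m.+1 then lebesgue_cons (lebesgue_tuple m)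
  else \d_([tuple] : 0.-tuple R).

Lemma lebesgue_tuple_box n (A : 'I_n -> set R) :
  (forall i, measurable (A i)) ->
  (lebesgue_tuple n [set x | forall i, A i (tnth x i)] =
   \prod_(i < n) lebesgue_measure (A i))%E.
Proof.
elim: n A => [|n IH] A mA.
  by rewrite big_ord0 /= diracE mem_set//; case.
have mT : measurable [set x : n.-tuple R | forall i, A (lift ord0 i) (tnth x i)].
  rewrite (_ : [set _ | _] = \bigcap_(i in [set: 'I_n])
      ((fun x : n.-tuple R => tnth x i) @^-1` A (lift ord0 i))); last first.
    by apply/seteqP; split=> x /= h i; [move=> _|]; apply: h.
  apply: fin_bigcap_measurable => // i _.
  by rewrite -[X in measurable X]setTI; apply: measurable_tnth.
rewrite big_ord_recl -IH // -product_measure1E //; last exact: (mA ord0).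
rewrite /= /lebesgue_cons /pushforward; congr (product_measure1 _ _ _).
apply/seteqP; split => -[a t] /=.
  move=> h; split; first exact: (h ord0).
  by move=> i; have := h (lift ord0 i); rewrite tnthS.
by move=> [h0 h] i; case: (unliftP ord0 i) => [j ->|->] //; rewrite tnthS.
Qed.

End lebesgue_tuple.

Section euclidean.
Context {R : realType} {d : nat}.
Implicit Types (x : d.-tuple int) (y : d.-tuple R).

Definition euclidean_norm y : R := Num.sqrt (\sum_(i < d) tnth y i ^+ 2).

Definition scale_point (eps : R) y : d.-tuple R :=
  [tuple eps * tnth y i | i < d].

Definition lattice_shift x y : d.-tuple R :=
  [tuple (tnth x i)%:~R + tnth y i | i < d].

(* 1 /\ |y|^(-alpha), with value 1 at the origin: 0^(-alpha) is +oo when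
   alpha > 0, whereas powR returns 0 there. *)
Definition power_tail (alpha : R) y : R :=
  if euclidean_norm y == 0 then 1
  else Num.min 1 (euclidean_norm y `^ (- alpha)).

End euclidean.

Section random_elements.
Context {R : realType} {disp : measure_display} {Omega : measurableType disp}.
Variable P : probability Omega R.

Definition mutually_independent {I : eqType} {d'} {T : measurableType d'}
    (X : I -> {RV P >-> T}) : Prop :=
  forall (s : seq I) (B : I -> set T), uniq s ->
    (forall i, measurable (B i)) ->
    (P (\bigcap_(i in [set` s]) (X i @^-1` B i)) =
     \prod_(i <- s) P (X i @^-1` B i))%E.

Definition has_density {d : nat} (X : {RV P >-> d.-tuple R})
    (g : d.-tuple R -> R) : Prop :=
  [/\ measurable_fun setT g, (forall y, 0 <= g y) &
   forall B, measurable B ->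
     (distribution P X B = \int[lebesgue_tuple d]_(y in B) (g y)%:E)%E].

Definition uniform_on {d : nat} (V : set (d.-tuple R))
    (X : {RV P >-> d.-tuple R}) : Prop :=
  forall B, measurable B ->
    distribution P X B =
    (fine (lebesgue_tuple d (B `&` V)) / fine (lebesgue_tuple d V))%:E.

(* X, U_0, ..., U_(k-1) are mutually independent (product rule for the whole
   family; taking some of the sets to be setT gives every subfamily). *)
Definition independent_with {d1 d2} {T1 : measurableType d1}
    {T2 : measurableType d2} {k : nat} (X : {RV P >-> T1})
    (U : 'I_k -> {RV P >-> T2}) : Prop :=
  forall (A : set T1) (B : 'I_k -> set T2), measurable A ->
    (forall i, measurable (B i)) ->
    (P (X @^-1` A `&` \bigcap_(i in [set: 'I_k]) (U i @^-1` B i)) =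
     P (X @^-1` A) * \prod_(i < k) P (U i @^-1` B i))%E.

End random_elements.

Section laws.
Context {R : realType} {dT : measure_display} {T : measurableType dT}.
Context {d1 d2 : measure_display}.
Context {Omega1 : measurableType d1} {Omega2 : measurableType d2}.
Variables (P1 : probability Omega1 R) (X1 : Omega1 -> T).
Variables (P2 : probability Omega2 R) (X2 : Omega2 -> T).

Definition same_law : Prop := forall A, measurable A ->
  pushforward P1 X1 A = pushforward P2 X2 A.

(* For measurable X1 and X2 this is the library's `<< between the laws, see
   law_dominatedP. Negligible preimages are used so that it is also meaningful
   for maps that are measurable only after modification on a null event, such
   as the removal from a point process of points that belong to it almost
   surely. *)
Definition law_dominated : Prop := forall A, measurable A ->
  P2.-negligible (X2 @^-1` A) -> P1.-negligible (X1 @^-1` A).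

Definition law_singular : Prop := exists A, [/\ measurable A,
  P1.-negligible (X1 @^-1` A) & P2.-negligible (X2 @^-1` (~` A))].

End laws.

Lemma law_dominatedP {R : realType} {dT d1 d2 : measure_display}
    {T : measurableType dT} {Omega1 : measurableType d1}
    {Omega2 : measurableType d2}
    (P1 : probability Omega1 R) (X1 : {RV P1 >-> T})
    (P2 : probability Omega2 R) (X2 : {RV P2 >-> T}) :
  law_dominated P1 X1 P2 X2 <-> distribution P1 X1 `<< distribution P2 X2.
Proof.
have mX d (O : measurableType d) (X : {mfun O >-> T}) A :
  measurable A -> measurable (X @^-1` A).
  by move=> mA; rewrite -[X in measurable X]setTI; exact: measurable_funPT.
rewrite null_content_dominatesP; split => h A mA.
  move=> /(negligibleP _ (mX _ _ X2 _ mA)) /(h _ mA).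
  by move/(negligibleP _ (mX _ _ X1 _ mA)).
move=> /(negligibleP _ (mX _ _ X2 _ mA)) /(h _ mA).
by move/(negligibleP _ (mX _ _ X1 _ mA)).
Qed.

Section point_processes.
Context {R : realType} {d : nat}.

Definition count_events : set (set (set (d.-tuple R))) :=
  [set E | exists (B : set (d.-tuple R)) (n : nat),
     measurable B /\ E = [set S | (S `&` B #= `I_n)%card]].

(* Point configurations in R^d, with the sigma-algebra generated by the numbers
   of points in Borel sets. Configurations are not required to be locally
   finite: the point processes below are so only almost surely. *)
Definition configuration := g_sigma_algebraType count_events.

Definition delete_points {k : nat} (S : configuration) (z : 'I_k -> d.-tuple R)
  : configuration := (S : set _) `\` range z.

Definition insert_points {k : nat} (S : configuration) (u : 'I_k -> d.-tuple R)
  : configuration := (S : set _) `|` range u.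

Definition distinct_points_of {disp : measure_display}
    {Omega : measurableType disp} {P : probability Omega R} {k : nat}
    (Pi : Omega -> configuration) (Z : 'I_k -> {RV P >-> d.-tuple R}) : Prop :=
  (forall i, {ae P, forall w, (Pi w : set _) (Z i w)}) /\
  (forall i j, i != j -> {ae P, forall w, Z i w <> Z j w}).

Section tolerance.
Context {disp : measure_display} {Omega : measurableType disp}.
Variable P : probability Omega R.

(* The next three notions depend only on the law of Pi: the Pi-points and the
   independent uniform points are those of an arbitrary copy Pi' of Pi, so that
   they may use randomness that is not present on Omega. *)

Definition deletion_tolerant (k : nat) (Pi : Omega -> configuration) : Prop :=
  forall (disp' : measure_display) (Omega' : measurableType disp')
    (P' : probability Omega' R) (Pi' : {RV P' >-> configuration})
    (Z : 'I_k -> {RV P' >-> d.-tuple R}),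
  same_law P' Pi' P Pi -> distinct_points_of Pi' Z ->
  law_dominated P' (fun w => delete_points (Pi' w) (Z ^~ w)) P Pi.

Definition deletion_singular (k : nat) (Pi : Omega -> configuration) : Prop :=
  forall (disp' : measure_display) (Omega' : measurableType disp')
    (P' : probability Omega' R) (Pi' : {RV P' >-> configuration})
    (Z : 'I_k -> {RV P' >-> d.-tuple R}),
  same_law P' Pi' P Pi -> distinct_points_of Pi' Z ->
  law_singular P Pi P' (fun w => delete_points (Pi' w) (Z ^~ w)).

Definition insertion_tolerant (k : nat) (Pi : Omega -> configuration) : Prop :=
  forall V : set (d.-tuple R), measurable V ->
    (0 < lebesgue_tuple d V < +oo)%E ->
  forall (disp' : measure_display) (Omega' : measurableType disp')
    (P' : probability Omega' R) (Pi' : {RV P' >-> configuration})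
    (U : 'I_k -> {RV P' >-> d.-tuple R}),
  same_law P' Pi' P Pi -> (forall i, uniform_on V (U i)) ->
  independent_with Pi' U ->
  law_dominated P' (fun w => insert_points (Pi' w) (U ^~ w)) P Pi.

End tolerance.

(* {x + Y_x : x in Z^d \ S} *)
Definition perturbed_lattice_off {Omega : Type} (S : set (d.-tuple int))
    (Y : d.-tuple int -> Omega -> d.-tuple R) (w : Omega) : configuration :=
  [set lattice_shift x (Y x w) | x in ~` S].

Definition perturbed_lattice {Omega : Type}
    (Y : d.-tuple int -> Omega -> d.-tuple R) (w : Omega) : configuration :=
  [set lattice_shift x (Y x w) | x in [set: d.-tuple int]].

End point_processes.

(* Main.v *)
Require Import Defs.
From HB Require Import structures.
From mathcomp Require Import all_boot all_order all_algebra.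
From mathcomp Require Import all_classical all_reals all_analysis.
From mathcomp Require Import measurable_realfun ring lra zify.

Set Implicit Arguments.
Unset Strict Implicit.
Unset Printing Implicit Defensive.

Import Order.TTheory GRing.Theory Num.Theory.
Import numFieldNormedType.Exports.

Local Open Scope classical_set_scope.
Local Open Scope ring_scope.

(** Write [X v = v + Y v] for the point of the site [v]. The two parts rest on
    different ideas.

    Heavy tails. The heart of the matter is that the configurations
    [{X v : v not in S}] and [{X v : v not in S, v <> a}] have laws with the
    same null events ([deletion_null], [insertion_null]). The set of points
    does not change when two sites exchange their points. Under the weight
    [phi (X a) / g_a (X a)], where [g_a] is the density of [X a], the point of
    [a] has density [phi] and is independent of the others; a product of two
    such weights at two sites has the same integral, against a function that
    is invariant under the exchange of the two points, after the two [phi]s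
    have been swapped ([integral_exchange]). Averaging over the sites of a
    dyadic block at distance about [2 ^ k], and doing so for [n] consecutive
    values of [k], turns a weight that puts the point of [a] in a bounded
    region into one that spreads it uniformly over a cube at distance about
    [2 ^ n] ([integral_path]). A local event, which depends on the points in a
    bounded window only, cannot see a point so far away, so it cannot tell the
    two configurations apart. The price is a product of averages as an
    additional weight. The average over the block at scale [k] has mean one
    and a variance of order [2 ^ (k * (alpha - 2 * d))]: a density [g] of
    order at least [|x| ^ (- alpha)] contributes [2 ^ (k * alpha)], the
    uniform density over a cube contributes [2 ^ (- k * d)], and so does the
    number of sites of the block. As [alpha < 2 * d], the variances are
    summable, so the product is close to one in mean square if it starts at a
    large scale. This bounds the probability of a local event for one
    configuration by [e] plus a constant times that for the other one, in both
    directions. Local events form an algebra that generates all events, so the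
    bounds extend to all events, and null events correspond.

    For deletion tolerance, a locally finite configuration loses the points
    [Z_1, ..., Z_k] when all its points in suitable dyadic cells are removed;
    these cells range over a countable set, and for the perturbed lattice
    itself the removal of the points in a bounded set is the removal of
    finitely many sites, again with countably many possibilities. Insertion
    tolerance follows by Fubini's theorem, because the point of a single site
    has a positive density. Negative exponents do not occur
    ([heavy_tail_exponent_ge0]).

    Light tails. Both conditions give
    [P (|Y v| > 2 ^ j) <= kappa * 2 ^ (- p * j)] with [p = alpha - d > d]. A
    union bound over lattice paths, as in the theory of greedy lattice
    animals, gives one constant [K] such that almost surely, for some random
    [C] and all finite sequences [s] of distinct sites, the sum of [|Y v|]
    over [s] is at most [K] times the length of the path from the origin
    through [s], plus [C] ([ae_sum_along_paths]). If [eps'] is small, the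
    points [v + eps' * Y v] are therefore displaced from their sites, in total
    along any path, by at most a quarter of its length plus a constant. Call a
    configuration matchable if its points can be assigned injectively to the
    sites of any finite set so that this holds. The perturbed lattice is
    matchable, but no longer so after the loss of a point: jumping from the
    site of the lost point to the site of the point that replaces it, and so
    on, one never returns, yet the path has a bounded length
    ([no_matching_after_deletion]). Supersets of matchable configurations are
    matchable, so the loss of more points cannot help, and the event of being
    matchable separates the two laws. *)

(** * Families of independent points and their joint law *)

Lemma preimage_measurable {d1 d2 : measure_display} {T1 : measurableType d1}
    {T2 : measurableType d2} (f : T1 -> T2) (A : set T2) :
  measurable_fun setT f -> measurable A -> measurable (f @^-1` A).
Proof. by move=> mf mA; rewrite -[X in measurable X]setTI; exact: mf. Qed.

Definition image_measure {d1 d2 : measure_display} {T1 : measurableType d1}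
    {T2 : measurableType d2} {R : realType} (m : {measure set T1 -> \bar R})
    (f : T1 -> T2) (mf : measurable_fun setT f) :
    {measure set T2 -> \bar R} :=
  measure_function_pushforward__canonical__measure_function_Measure m mf.

Section integral_density.
Context {d1 : measure_display} {T : measurableType d1} {R : realType}.
Variables (lam G : {measure set T -> \bar R}) (g : T -> R).
Hypothesis mg : measurable_fun setT g.
Hypothesis g0 : forall x, 0 <= g x.
Hypothesis Gg : forall B, measurable B -> (G B = \int[lam]_(x in B) (g x)%:E)%E.
Local Open Scope ereal_scope.
Import HBNNSimple.

Lemma integral_density (f : T -> \bar R) :
  measurable_fun setT f -> (forall x, 0 <= f x) ->
  \int[G]_x f x = \int[lam]_x (f x * (g x)%:E).
Proof.
move=> mf f0; pose h := nnsfun_approx measurableT mf.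
have hf x : EFin \o (h ^~ x) @ \oo --> f x by apply: cvg_nnsfun_approx.
have ndh x m n : (m <= n)%N -> (h m x <= h n x)%R.
  by move=> mn; apply/lefP/nd_nnsfun_approx.
have mh n : measurable_fun setT (EFin \o h n) by exact/measurable_EFinP.
transitivity (limn (fun n => \int[G]_x (h n x)%:E)).
  rewrite -monotone_convergence//=.
  - by apply: eq_integral => x _; apply/esym/cvg_lim => //; exact: hf.
  - by move=> n x _; rewrite lee_fin.
  - by move=> x _ m n mn; rewrite lee_fin; exact: ndh.
have mhg n : measurable_fun setT (fun x => (h n x)%:E * (g x)%:E).
  by apply: emeasurable_funM => //; exact/measurable_EFinP.
transitivity (limn (fun n => \int[lam]_x ((h n x)%:E * (g x)%:E))); last first.
  rewrite -monotone_convergence//=.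
  - apply: eq_integral => x _; apply/cvg_lim => //.
    by apply: cvgeZr => //; exact: hf.
  - by move=> n x _; rewrite mule_ge0 ?lee_fin.
  - move=> x _ m n mn; rewrite lee_wpmul2r ?lee_fin//; exact: ndh.
congr (limn _); apply/funext => n.
rewrite integralT_nnsfun sintegralE.
under [RHS]eq_integral => x _.
  rewrite (fimfunE (h n) x) -fsumEFin// ge0_mule_fsuml; last first.
    by move=> r; rewrite EFinM; exact: nnfun_muleindic_ge0.
  over.
rewrite ge0_integral_fsum//; last 2 first.
- move=> r; apply: emeasurable_funM; last exact/measurable_EFinP.
  by apply/measurable_EFinP; apply: measurable_funM => //.
- move=> r x _; apply: mule_ge0; last by rewrite lee_fin.
  by rewrite EFinM; exact: nnfun_muleindic_ge0.
apply: eq_fsbigr => r _.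
have mr : measurable (h n @^-1` [set r]) by [].
rewrite Gg//.
have [r0|r0] := leP 0%R r; last first.
  rewrite preimage_nnfun0// integral_set0 mule0 integral0_eq//.
  by move=> x _; rewrite indic0 mulr0 mul0e.
rewrite integral_mkcond -ge0_integralZl//; last 2 first.
- apply/(measurable_restrictT _ mr).
  by apply: measurable_funTS; exact/measurable_EFinP.
- by move=> x _; rewrite patchE; case: ifP => // _; rewrite lee_fin.
apply: eq_integral => x _; rewrite patchE indicE; case: ifP => _ /=.
  by rewrite mulr1.
by rewrite mulr0 mule0 mul0e.
Qed.

End integral_density.

Section labelled.
Context {V : choiceType} {dE : measure_display} {E : measurableType dE}.

(** A finite sequence [s] without repetition stands for the finite set of
    labels that are constrained. *)
Definition cylinder (s : seq V) (B : V -> set E) : set (V -> E) :=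
  [set y | forall v, v \in s -> B v (y v)].

Definition labelled_cylinders : set (set (V -> E)) :=
  [set A | exists (s : seq V) (B : V -> set E),
     uniq s /\ (forall v, measurable (B v)) /\ A = cylinder s B].

(** Configurations forget which site a point comes from; the labels make it
    possible to move a single point or to exchange two of them. *)
Definition labelled := g_sigma_algebraType labelled_cylinders.

Definition update (a : V) (z : E) (y : labelled) : labelled :=
  fun v => if v == a then z else y v.

Lemma labelled_cylindersI : setI_closed labelled_cylinders.
Proof.
move=> _ _ [s [B [us [mB ->]]]] [t [C [ut [mC ->]]]].
exists (undup (s ++ t)), (fun v => (if v \in s then B v else setT) `&`
  (if v \in t then C v else setT)); split; first exact: undup_uniq.
split=> [v|].
  by apply: measurableI; case: ifP.
apply/seteqP; split=> y /=.
  move=> [yB yC] v; rewrite mem_undup mem_cat => vst; split.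
    by case: ifP => // vs; exact: yB.
  by case: ifP => // vt; exact: yC.
move=> h; split=> v vs; have := h v; rewrite mem_undup mem_cat vs ?orbT => /(_ isT).
  by case.
by case.
Qed.

Lemma measurable_coordinate v : measurable_fun setT (fun y : labelled => y v).
Proof.
move=> _ B mB; rewrite setTI; apply: sub_sigma_algebra.
exists [:: v], (fun=> B); split => //; split => //.
apply/seteqP; split => y /=; first by move=> yB w; rewrite inE => /eqP ->.
by apply; rewrite inE.
Qed.

Lemma measurable_cylinder (s : seq V) (B : V -> set E) :
  (forall v, measurable (B v)) -> measurable (cylinder s B : set labelled).
Proof.
move=> mB.
rewrite (_ : cylinder s B = \big[setI/setT]_(v <- s) ((fun y => y v) @^-1` B v)).
  apply: bigsetI_measurable => v _; apply: preimage_measurable => //.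
  exact: measurable_coordinate.
by rewrite -bigcap_seq; apply/seteqP; split=> y h v vs; exact: h.
Qed.

Lemma measurable_to_labelled {d1 : measure_display} {T : measurableType d1}
    (f : T -> labelled) :
  (forall v, measurable_fun setT (fun t => f t v)) -> measurable_fun setT f.
Proof.
move=> mf; apply: (@measurability _ _ T labelled setT f labelled_cylinders) => //.
move=> _ [_ [s [B [us [mB ->]]] <-]]; rewrite setTI.
rewrite (_ : _ @^-1` _ = \big[setI/setT]_(v <- s) ((fun t => f t v) @^-1` B v)).
  by apply: bigsetI_measurable => v _; exact: preimage_measurable.
apply/seteqP; split=> t /=; rewrite -bigcap_seq => h v /=; exact: h.
Qed.

Lemma measurable_update a :
  measurable_fun setT (fun p : labelled * E => update a p.2 p.1).
Proof.
apply: measurable_to_labelled => v; rewrite /update; case: (v == a).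
  exact: measurable_snd.
exact: (measurableT_comp (measurable_coordinate v) measurable_fst).
Qed.

Lemma labelled_measure_unique {R : realType} (m1 m2 : {measure set labelled -> \bar R}) :
  (m1 setT < +oo)%E ->
  (forall A, labelled_cylinders A -> m1 A = m2 A) ->
  forall A, measurable A -> m1 A = m2 A.
Proof.
move=> m1oo m12.
have cT : labelled_cylinders setT.
  exists [::], (fun=> setT); split => //; split => //.
  by apply/seteqP; split.
apply: (@measure_unique _ R labelled labelled_cylinders (fun=> [set: labelled])) => //.
- exact: labelled_cylindersI.
- by rewrite bigcup_const.
Qed.

End labelled.
Arguments labelled : clear implicits.
Arguments labelled V {dE} E.

Section product_law.
Context {R : realType} {V : choiceType} {dE : measure_display} {E : measurableType dE}.
Local Open Scope ereal_scope.

Definition product_law (mu : probability (labelled V E) R)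
    (G : V -> probability E R) : Prop :=
  forall s B, uniq s -> (forall v, measurable (B v)) ->
    mu (cylinder s B) = \prod_(v <- s) G v (B v).

Variables (mu : probability (labelled V E) R) (G : V -> probability E R).
Hypothesis muG : product_law mu G.

(** A product law does not change when one coordinate is resampled; by
    uniqueness it is enough to check this on cylinders. *)
Lemma law_update a A : measurable A ->
  mu A = (mu \x G a) ((fun p => update a p.2 p.1) @^-1` A).
Proof.
move=> mA; apply: (labelled_measure_unique (m2 :=
  image_measure (mu \x G a) (measurable_update a))) => //.
  by rewrite (le_lt_trans (probability_le1 _ _))// ltry.
move=> _ [s [B [us [mB ->]]]] /=; rewrite /pushforward.
rewrite (_ : _ @^-1` _ = cylinder (rem a s) B `*`
    (if a \in s then B a else setT)); last first.
  apply/seteqP; split => -[y z]; rewrite /update /cylinder /=.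
    move=> h; split.
      by move=> v; rewrite mem_rem_uniq// inE => /andP[/negbTE va /h]; rewrite va.
    by case: ifPn => // /h; rewrite eqxx.
  move=> [h1 h2] v vs; case: ifPn => va; last by apply: h1; rewrite mem_rem_uniq// inE va.
  by move: h2; rewrite -(eqP va) vs.
have mC t := measurable_cylinder t mB.
rewrite product_measure1E//; last by case: ifP.
rewrite (muG us mB).
transitivity ((\prod_(v <- rem a s) G v (B v)) *
    G a (if a \in s then B a else setT)); last first.
  by congr (_ * _); apply/esym; apply: muG => //; exact: rem_uniq.
case: ifPn => [as_|nas].
  by rewrite (perm_big _ (perm_to_rem as_))/= big_cons muleC.
by rewrite rem_id// probability_setT mule1.
Qed.

Lemma integral_update a (f : labelled V E -> \bar R) :
  measurable_fun setT f -> (forall y, 0 <= f y) ->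
  \int[mu]_y f y = \int[mu]_y \int[G a]_z f (update a z y).
Proof.
move=> mf f0.
transitivity (\int[image_measure (mu \x G a) (measurable_update a)]_y f y).
  by apply: eq_measure_integral => A mA _; exact: law_update.
rewrite /= ge0_integral_pushforward//; last exact: measurable_update.
rewrite preimage_setT fubini_tonelli1//=.
exact: (measurableT_comp mf (measurable_update a)).
Qed.

Lemma integral_coordinateM a (F : labelled V E -> \bar R) (f : E -> \bar R) :
  measurable_fun setT F -> (forall y, 0 <= F y) ->
  measurable_fun setT f -> (forall z, 0 <= f z) ->
  (forall y z, F (update a z y) = F y) ->
  \int[mu]_y (F y * f (y a)) = (\int[mu]_y F y) * \int[G a]_z f z.
Proof.
move=> mF F0 mf f0 Fa.
have mfa : measurable_fun setT (fun y : labelled V E => f (y a)).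
  exact: (measurableT_comp mf (measurable_coordinate a)).
rewrite (integral_update a)//; last 2 first.
- exact: emeasurable_funM.
- by move=> y; exact: mule_ge0.
transitivity (\int[mu]_y (F y * \int[G a]_z f z)).
  apply: eq_integral => y _; rewrite -ge0_integralZl//.
  by apply: eq_integral => z _; rewrite Fa /update eqxx.
by rewrite ge0_integralZr// integral_ge0.
Qed.

End product_law.

(** * Exchanging the points of two sites *)

Section exchange.
Context {R : realType} {V : choiceType} {dE : measure_display} {E : measurableType dE}.
Local Open Scope ereal_scope.
Variables (mu : probability (labelled V E) R) (G : V -> probability E R).
Hypothesis muG : product_law mu G.
Variables (lam : {sigma_finite_measure set E -> \bar R}) (g : V -> E -> R).
Hypothesis mg : forall v, measurable_fun setT (g v).
Hypothesis g_gt0 : forall v z, (0 < g v z)%R.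
Hypothesis Gg : forall v B, measurable B -> G v B = \int[lam]_(z in B) (g v z)%:E.

Let g_ge0 v z : (0 <= g v z)%R. Proof. exact: ltW. Qed.

Definition exchange (a b : V) (y : labelled V E) : labelled V E :=
  fun v => if v == a then y b else if v == b then y a else y v.

(** Against the product law, this weight replaces the density [g v] of the
    coordinate [v] by [phi]; see [integral_ratio]. *)
Definition ratio v (phi : E -> R) (y : labelled V E) : R :=
  (phi (y v) / g v (y v))%R.

Definition average (s : seq V) phi (y : labelled V E) : R :=
  ((\sum_(v <- s) ratio v phi y) / (size s)%:R)%R.

Definition nonneg_measurable phi := measurable_fun setT phi /\ forall z : E, (0 <= phi z :> R)%R.

Lemma measurable_quotient v (phi : E -> R) :
  measurable_fun setT phi -> measurable_fun setT (fun z => phi z / g v z)%R.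
Proof.
move=> mphi; apply: measurable_funM => //.
rewrite (_ : (fun z => (g v z)^-1)%R = expR \o (fun z => - ln (g v z))%R).
  apply: measurableT_comp => //; apply: measurableT_comp => //.
  by apply: measurableT_comp => //; exact: measurable_ln.
by apply/funext => z /=; rewrite expRN lnK// posrE.
Qed.

Lemma measurable_ratio v phi : nonneg_measurable phi -> measurable_fun setT (ratio v phi).
Proof.
move=> [mphi _].
have mv := measurable_quotient v mphi.
exact: (measurableT_comp mv (measurable_coordinate v)).
Qed.

Lemma ratio_ge0 v phi y : nonneg_measurable phi -> (0 <= ratio v phi y)%R.
Proof. by move=> [_ p0]; rewrite /ratio divr_ge0. Qed.

Lemma measurable_average s phi :
  nonneg_measurable phi -> measurable_fun setT (average s phi).
Proof.
move=> dphi; apply: measurable_funM => //.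
by apply: measurable_sum => v; exact: measurable_ratio.
Qed.

Lemma average_ge0 s phi y : nonneg_measurable phi -> (0 <= average s phi y)%R.
Proof.
move=> dphi; rewrite /average divr_ge0// sumr_ge0// => v _.
exact: ratio_ge0.
Qed.

Definition free_of v (T : Type) (F : labelled V E -> T) :=
  forall y z, F (update v z y) = F y.

Lemma ratio_free v w phi : v != w -> free_of v (ratio w phi).
Proof. by move=> vw y z; rewrite /ratio /update eq_sym (negbTE vw). Qed.

Lemma average_free v s phi : v \notin s -> free_of v (average s phi).
Proof.
move=> vs y z; rewrite /average; congr (_ / _)%R; apply: eq_big_seq => w ws.
by apply: ratio_free; apply: contraNneq vs => ->.
Qed.

Lemma integral_density_ratio v phi (h : R -> R) :
  measurable_fun setT h -> (forall x, 0 <= x -> 0 <= h x)%R -> nonneg_measurable phi ->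
  \int[G v]_z (h (phi z / g v z))%:E =
  \int[lam]_z (h (phi z / g v z) * g v z)%:E.
Proof.
move=> mh h0 [mphi phi0].
rewrite (integral_density (mg v) (g_ge0 v) (@Gg v)).
- by apply: eq_integral => z _; rewrite EFinM.
- apply/measurable_EFinP; apply: (measurableT_comp mh).
  exact: measurable_quotient.
- by move=> z; rewrite lee_fin h0// divr_ge0.
Qed.

Lemma integral_ratio v phi F : nonneg_measurable phi ->
  measurable_fun setT F -> (forall y, 0 <= F y) -> free_of v F ->
  \int[mu]_y (F y * (ratio v phi y)%:E) =
  (\int[mu]_y F y) * \int[lam]_z (phi z)%:E.
Proof.
move=> dphi mF F0 Fv.
have mr := measurable_ratio v dphi.
pose f z := (phi z / g v z)%:E.
rewrite (integral_coordinateM muG (f := f))//; last 2 first.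
- by rewrite /f; apply/measurable_EFinP; apply: measurable_quotient; case: dphi.
- by move=> z; rewrite lee_fin divr_ge0//; case: dphi.
congr (_ * _); rewrite (integral_density_ratio v (h := id))//.
by apply: eq_integral => z _; rewrite divfK// gt_eqF.
Qed.

Lemma integral_two_sites a b (f : labelled V E -> \bar R) :
  measurable_fun setT f -> (forall y, 0 <= f y) ->
  \int[mu]_y f y = \int[mu]_y \int[lam]_z \int[lam]_z'
     (f (update b z' (update a z y)) * (g b z')%:E * (g a z)%:E).
Proof.
move=> mf f0.
have mfb : measurable_fun setT (fun y => \int[G b]_z f (update b z y)).
  apply: (@measurable_fun_fubini_tonelli_F _ _ _ _ _ _
    (fun p => f (update b p.2 p.1))) => //.
  exact: (measurableT_comp mf (measurable_update b)).
have mup (c : V) (y : labelled V E) : measurable_fun setT (fun z => update c z y).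
  exact: (measurableT_comp (measurable_update c) (pair1_measurable y)).
rewrite (integral_update muG b)// (integral_update muG a)//; last first.
  by move=> y; apply: integral_ge0.
apply: eq_integral => y _.
rewrite (integral_density (mg a) (g_ge0 a) (@Gg a)); last 2 first.
- by have := measurableT_comp mfb (mup a y).
- by move=> z; apply: integral_ge0.
apply: eq_integral => z _.
rewrite (integral_density (mg b) (g_ge0 b) (@Gg b))//; last first.
  exact: (measurableT_comp mf (mup b _)).
rewrite -ge0_integralZr//.
- by apply: emeasurable_funM; [exact: (measurableT_comp mf (mup b _))|exact/measurable_EFinP].
- by move=> z' _; rewrite mule_ge0 ?lee_fin.
- by rewrite lee_fin.
Qed.

Lemma exchange_update a b z z' y : a != b ->
  exchange a b (update b z' (update a z y)) = update b z (update a z' y).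
Proof.
move=> ab; apply/funext => v; rewrite /exchange /update !eqxx.
rewrite (negbTE ab).
have [->|va] := eqVneq v a; first by rewrite (negbTE ab).
by case: eqVneq.
Qed.

(** Resample both coordinates. The weights cancel the densities [g a] and
    [g b], so the positions [z] and [z'] of the two points are integrated
    against [phi z * psi z'], and the invariance of [K] allows [z] and [z'] to
    be renamed. *)
Lemma integral_exchange a b (K : labelled V E -> \bar R) phi psi :
  a != b -> measurable_fun setT K -> (forall y, 0 <= K y) ->
  (forall y, K (exchange a b y) = K y) -> nonneg_measurable phi -> nonneg_measurable psi ->
  \int[mu]_y (K y * (ratio a phi y * ratio b psi y)%:E) =
  \int[mu]_y (K y * (ratio a psi y * ratio b phi y)%:E).
Proof.
move=> ab mK K0 Kab dphi dpsi.
have mup (c : V) (y : labelled V E) : measurable_fun setT (fun z => update c z y).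
  exact: (measurableT_comp (measurable_update c) (pair1_measurable y)).
have E1 p q : nonneg_measurable p -> nonneg_measurable q ->
  \int[mu]_y (K y * (ratio a p y * ratio b q y)%:E) =
  \int[mu]_y \int[lam]_z \int[lam]_z'
    (K (update b z' (update a z y)) * (p z * q z')%:E).
  move=> dp dq; rewrite [LHS](integral_two_sites a b).
  - apply: eq_integral => y _; apply: eq_integral => z _.
    apply: eq_integral => z' _; rewrite -!muleA; congr (_ * _).
    rewrite -!EFinM /ratio /update !eqxx (negbTE ab); congr (_%:E).
    by field; rewrite !gt_eqF.
  - apply: emeasurable_funM => //; apply/measurable_EFinP.
    by apply: measurable_funM; exact: measurable_ratio.
  - by move=> y; rewrite mule_ge0// lee_fin mulr_ge0// ratio_ge0.
rewrite (E1 _ _ dphi dpsi) (E1 _ _ dpsi dphi); apply: eq_integral => y _.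
pose h (p : E * E) := K (update b p.2 (update a p.1 y)) * (phi p.1 * psi p.2)%:E.
transitivity (\int[lam]_z' \int[lam]_z h (z, z')); last first.
  apply: eq_integral => z _; apply: eq_integral => z' _; rewrite /h /=.
  by rewrite -Kab exchange_update// [(phi _ * _)%R]mulrC.
apply: (@fubini_tonelli _ _ _ _ _ lam lam h) => [|p].
  apply: emeasurable_funM.
    apply: (measurableT_comp mK).
    have mp : measurable_fun setT (fun p : E * E => (update a p.1 y, p.2)).
      apply: measurable_fun_pair; last exact: measurable_snd.
      exact: (measurableT_comp (mup a y) measurable_fst).
    exact: (measurableT_comp (measurable_update b) mp).
  apply/measurable_EFinP; apply: measurable_funM.
    exact: (measurableT_comp dphi.1 measurable_fst).
  exact: (measurableT_comp dpsi.1 measurable_snd).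
by rewrite mule_ge0// lee_fin mulr_ge0//; [case: dphi|case: dpsi].
Qed.

Lemma averageE s phi y :
  average s phi y = (\sum_(v <- s) (size s)%:R^-1 * ratio v phi y)%R.
Proof. by rewrite /average mulr_suml; apply: eq_bigr => v _; rewrite mulrC. Qed.

Lemma integral_average_sum (s : seq V) (F : labelled V E -> \bar R)
    (h : V -> labelled V E -> R) :
  measurable_fun setT F -> (forall y, 0 <= F y) ->
  (forall v, measurable_fun setT (h v)) -> (forall v y, (0 <= h v y)%R) ->
  \int[mu]_y (F y * (\sum_(v <- s) h v y)%:E) =
  \sum_(v <- s) \int[mu]_y (F y * (h v y)%:E).
Proof.
move=> mF F0 mh h0; rewrite -ge0_integral_sum//; last 2 first.
- by move=> v; apply: emeasurable_funM => //; exact/measurable_EFinP.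
- by move=> v y _; rewrite mule_ge0// lee_fin.
apply: eq_integral => y _; rewrite -sumEFin ge0_sume_distrr// => v _.
by rewrite lee_fin.
Qed.

Lemma integral_exchange_average a s (K : labelled V E -> \bar R) phi psi :
  a \notin s -> measurable_fun setT K -> (forall y, 0 <= K y) ->
  (forall v y, v \in s -> K (exchange a v y) = K y) ->
  nonneg_measurable phi -> nonneg_measurable psi ->
  \int[mu]_y (K y * (ratio a phi y * average s psi y)%:E) =
  \int[mu]_y (K y * (ratio a psi y * average s phi y)%:E).
Proof.
move=> as_ mK K0 Kas dphi dpsi.
have E1 p q : nonneg_measurable p -> nonneg_measurable q ->
    \int[mu]_y (K y * (ratio a p y * average s q y)%:E) =
    (size s)%:R^-1%:E * \sum_(v <- s)
       \int[mu]_y (K y * (ratio a p y * ratio v q y)%:E).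
  move=> dp dq; rewrite -(integral_average_sum s mK K0).
  - rewrite -ge0_integralZl//.
    + apply: eq_integral => y _; rewrite muleCA -EFinM; congr (_ * _%:E).
      by rewrite /average [in RHS]mulrC -mulr_sumr mulrA.
    + apply: emeasurable_funM => //; apply/measurable_EFinP.
      apply: measurable_sum => v; apply: measurable_funM => //; exact: measurable_ratio.
    + move=> y _; rewrite mule_ge0// lee_fin sumr_ge0// => v _.
      by rewrite mulr_ge0// ratio_ge0.
  - by move=> v; apply: measurable_funM => //; exact: measurable_ratio.
  - by move=> v y; rewrite mulr_ge0// ratio_ge0.
rewrite (E1 _ _ dphi dpsi) (E1 _ _ dpsi dphi); congr (_ * _).
apply: eq_big_seq => v vs; apply: integral_exchange => //.
  by apply: contraNneq as_ => ->.
by move=> y; exact: Kas.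
Qed.

Lemma ratio_exchange a b v phi y : v != a -> v != b ->
  ratio v phi (exchange a b y) = ratio v phi y.
Proof. by move=> va vb; rewrite /ratio /exchange (negbTE va) (negbTE vb). Qed.

Lemma average_exchange a b s phi y : a \notin s -> b \notin s ->
  average s phi (exchange a b y) = average s phi y.
Proof.
move=> as_ bs; rewrite /average; congr (_ / _)%R; apply: eq_big_seq => v vs.
by rewrite ratio_exchange//; [apply: contraNneq as_|apply: contraNneq bs] => <-.
Qed.

Section paths.
Variables (a : V) (A : nat -> seq V) (phi : nat -> E -> R).
Hypothesis aA : forall i, a \notin A i.
Hypothesis AA : forall i j v, i != j -> v \in A i -> v \notin A j.
Hypothesis dphi : forall i, nonneg_measurable (phi i).

(** One exchange per step: the density [phi i] of the point of [a] is traded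
    for the density [phi i.+1] used by the average over the block [A i], which
    receives [phi i]. The other averages and [K] do not change, as the blocks
    are disjoint. *)
Lemma integral_path (K : labelled V E -> \bar R) n :
  measurable_fun setT K -> (forall y, 0 <= K y) ->
  (forall i v y, v \in A i -> K (exchange a v y) = K y) ->
  \int[mu]_y (K y * (ratio a (phi 0%N) y *
      \prod_(i < n) average (A i) (phi i.+1) y)%:E) =
  \int[mu]_y (K y * (ratio a (phi n) y *
      \prod_(i < n) average (A i) (phi i) y)%:E).
Proof.
move=> mK K0 KA.
(* after [m] exchanges, the blocks before [m] have received their densities *)
suff H m : (m <= n)%N -> \int[mu]_y (K y * (ratio a (phi 0%N) y *
      \prod_(i < n) average (A i) (phi i.+1) y)%:E) =
  \int[mu]_y (K y * (ratio a (phi m) y *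
      \prod_(i < n) average (A i) (phi (if (i < m)%N then i : nat else i.+1)) y)%:E).
  rewrite (H n (leqnn n)); apply: eq_integral => y _; congr (_ * (_ * _)%:E).
  by apply: eq_bigr => i _; rewrite ltn_ord.
elim: m => [_|m IH mn]; first exact: eq_integral.
rewrite (IH (ltnW mn)).
pose Q y := (\prod_(i < n | i != m :> nat)
  average (A i) (phi (if (i < m)%N then i : nat else i.+1)) y)%R.
have splitQ k p y :
    (ratio a p y * \prod_(i < n) average (A i)
       (phi (if (i < k)%N then i : nat else i.+1)) y =
    (\prod_(i < n | i != m :> nat)
      average (A i) (phi (if (i < k)%N then i : nat else i.+1)) y) *
    (ratio a p y * average (A m) (phi (if (m < k)%N then m else m.+1)) y))%R.
  by rewrite (bigD1 (Ordinal mn))//= [RHS]mulrC -[RHS]mulrA.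
have E1 p : \int[mu]_y (K y * (ratio a p y *
      \prod_(i < n) average (A i) (phi (if (i < m)%N then i : nat else i.+1)) y)%:E)
   = \int[mu]_y ((K y * (Q y)%:E) * (ratio a p y * average (A m) (phi m.+1) y)%:E).
  by apply: eq_integral => y _; rewrite splitQ ltnn EFinM muleA.
rewrite E1 integral_exchange_average//.
- apply: eq_integral => y _; rewrite splitQ ltnSn [in RHS]EFinM muleA.
  congr (_ * _%:E * _); apply: eq_bigr => i im.
  by rewrite ltnS [(i <= m)%N]leq_eqVlt (negbTE im).
- apply: emeasurable_funM => //; apply/measurable_EFinP; rewrite /Q.
  under [X in measurable_fun _ X]eq_fun do rewrite -big_filter.
  by apply: measurable_prod => i _; exact: measurable_average.
- by move=> y; rewrite mule_ge0// lee_fin prodr_ge0// => i _; exact: average_ge0.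
- move=> v y vm; rewrite (KA m)//; congr (_ * _%:E); apply: eq_bigr => i im.
  by rewrite average_exchange//; apply: AA vm; rewrite eq_sym.
Qed.

End paths.

Lemma integral_average s phi F : nonneg_measurable phi -> (0 < size s)%N ->
  measurable_fun setT F -> (forall y, 0 <= F y) ->
  (forall v, v \in s -> free_of v F) ->
  \int[mu]_y (F y * (average s phi y)%:E) =
  (\int[mu]_y F y) * \int[lam]_z (phi z)%:E.
Proof.
move=> dp s0 mF F0 Fs.
under eq_integral do rewrite averageE.
have mr v : measurable_fun setT
    (fun y => ((size s)%:R^-1 * ratio v phi y)%R : R).
  by apply: measurable_funM => //; exact: measurable_ratio.
have r0 v y : (0 <= (size s)%:R^-1 * ratio v phi y)%R by rewrite mulr_ge0// ratio_ge0.
rewrite integral_average_sum//.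
transitivity (\sum_(v <- s) (size s)%:R^-1%:E *
   ((\int[mu]_y F y) * \int[lam]_z (phi z)%:E)).
  apply: eq_big_seq => v vs; rewrite -(integral_ratio dp mF F0 (Fs v vs)).
  rewrite -ge0_integralZl//.
  - by apply: eq_integral => y _; rewrite EFinM muleCA.
  - apply: emeasurable_funM => //; apply/measurable_EFinP; exact: measurable_ratio.
  - by move=> y _; rewrite mule_ge0// lee_fin ratio_ge0.
rewrite -ge0_sume_distrl; last by move=> *; rewrite lee_fin.
rewrite sumEFin big_const_seq count_predT iter_addr_0.
by rewrite -[(_ *+ _)%R]mulr_natl divff ?mul1e// pnatr_eq0 -lt0n.
Qed.

(** The diagonal terms give [c / size s]; for two distinct sites the weights
    are independent and contribute at most [m ^ 2]. *)
Lemma integral_average_sqr s phi F (c m : R) :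
  nonneg_measurable phi -> (0 < size s)%N -> uniq s ->
  measurable_fun setT F -> (forall y, 0 <= F y) ->
  (forall v, v \in s -> free_of v F) ->
  \int[lam]_z (phi z)%:E <= m%:E ->
  (forall v, v \in s -> \int[lam]_z (phi z ^+ 2 / g v z)%:E <= c%:E) ->
  \int[mu]_y (F y * (average s phi y ^+ 2)%:E) <=
  (m ^+ 2 + c / (size s)%:R)%:E * \int[mu]_y F y.
Proof.
move=> dp s0 us mF F0 Fs pm pc.
set N : R := (size s)%:R.
have N0 : (0 < N)%R by rewrite ltr0n.
have IF0 : 0 <= \int[mu]_y F y by apply: integral_ge0.
have I0 : 0 <= \int[lam]_z (phi z)%:E.
  by apply: integral_ge0 => z _; rewrite lee_fin; case: dp.
have m0 : (0 <= m)%R by rewrite -lee_fin (le_trans I0).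
have c0 : (0 <= c)%R.
  case: (s) s0 pc => // v t _ pc.
  rewrite -lee_fin (le_trans _ (pc v _)) ?mem_head//.
  by apply: integral_ge0 => z _; rewrite lee_fin divr_ge0 ?sqr_ge0.
have mrr v w : measurable_fun setT (fun y => ratio v phi y * ratio w phi y)%R.
  by apply: measurable_funM; exact: measurable_ratio.
have rr0 v w y : (0 <= ratio v phi y * ratio w phi y)%R.
  by rewrite mulr_ge0// ratio_ge0.
have pair_le v w : v \in s -> w \in s ->
    \int[mu]_y (F y * (ratio v phi y * ratio w phi y)%:E) <=
    (m ^+ 2 + (w == v)%:R * c)%:E * \int[mu]_y F y.
  move=> vs ws; have [->|wv] := eqVneq w v.
    rewrite mul1r; pose h z := ((phi z / g v z) ^+ 2)%:E.
    have hE y : F y * (ratio v phi y * ratio v phi y)%:E = F y * h (y v).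
      by rewrite /h expr2.
    under eq_integral do rewrite hE.
    rewrite (integral_coordinateM muG)//; last 3 first.
    - apply/measurable_EFinP; apply: measurable_funX; apply: measurable_quotient.
      by case: dp.
    - by move=> z; rewrite lee_fin sqr_ge0.
    - exact: Fs.
    rewrite muleC lee_wpmul2r//.
    rewrite (integral_density_ratio v (h := fun x => x ^+ 2)%R)//; last first.
      by move=> x _; exact: sqr_ge0.
    apply: (@le_trans _ _ c%:E); last by rewrite lee_fin lerDr sqr_ge0.
    rewrite (le_trans _ (pc v vs))// le_eqVlt; apply/orP; left; apply/eqP.
    apply: eq_integral => z _; congr (_%:E).
    by field; rewrite gt_eqF.
  rewrite mul0r addr0.
  under eq_integral do rewrite EFinM muleA.
  rewrite integral_ratio//; last 3 first.
  - apply: emeasurable_funM => //; apply/measurable_EFinP; exact: measurable_ratio.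
  - by move=> y; rewrite mule_ge0// lee_fin ratio_ge0.
  - by move=> y z; rewrite (Fs w)// ratio_free.
  rewrite integral_ratio//; last exact: Fs.
  rewrite -muleA muleC lee_wpmul2r// expr2 EFinM; exact: lee_pmul.
have -> : \int[mu]_y (F y * (average s phi y ^+ 2)%:E) =
    (N ^- 2)%:E * \sum_(v <- s) \sum_(w <- s)
      \int[mu]_y (F y * (ratio v phi y * ratio w phi y)%:E).
  under eq_bigr do rewrite -integral_average_sum//.
  rewrite -integral_average_sum//; last 2 first.
  - by move=> v; apply: measurable_sum => w.
  - by move=> v y; rewrite sumr_ge0.
  rewrite -ge0_integralZl//; last 3 first.
  - apply: emeasurable_funM => //; apply/measurable_EFinP.
    by apply: measurable_sum => v; apply: measurable_sum => w.
  - by move=> y _; rewrite mule_ge0// lee_fin sumr_ge0// => v _; rewrite sumr_ge0.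
  - by rewrite lee_fin invr_ge0 exprn_ge0// ltW.
  apply: eq_integral => y _; rewrite muleCA -EFinM; congr (_ * _%:E).
  rewrite /average expr_div_n mulrC; congr (_ * _)%R.
  by rewrite expr2 mulr_suml; apply: eq_bigr => v _; rewrite mulr_sumr.
apply: (@le_trans _ _ ((N ^- 2)%:E * \sum_(v <- s) \sum_(w <- s)
    ((m ^+ 2 + (w == v)%:R * c)%:E * \int[mu]_y F y))).
  have N20 : 0 <= (N ^- 2)%:E by rewrite lee_fin invr_ge0 exprn_ge0// ltW.
  apply: lee_wpmul2l => //; rewrite big_seq [X in _ <= X]big_seq.
  apply: lee_sum => v vs; rewrite big_seq [X in _ <= X]big_seq.
  by apply: lee_sum => w ws; exact: pair_le.
under eq_bigr => v _.
  rewrite -ge0_sume_distrl; last first.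
    by move=> w _; rewrite lee_fin addr_ge0// ?sqr_ge0// mulr_ge0.
  rewrite sumEFin big_split/= big_const_seq count_predT iter_addr_0 -mulr_suml.
  over.
rewrite /= -ge0_sume_distrl; last first.
  by move=> v _; rewrite lee_fin addr_ge0 ?mulrn_wge0 ?sqr_ge0// mulr_ge0// sumr_ge0.
rewrite sumEFin muleA -EFinM lee_wpmul2r// lee_fin.
rewrite big_split/= big_const_seq count_predT iter_addr_0 -mulr_suml.
have -> : (\sum_(v <- s) \sum_(w <- s) (w == v)%:R = N)%R.
  rewrite (eq_big_seq (fun=> 1%R)).
    by rewrite big_const_seq count_predT iter_addr_0.
  move=> v vs; rewrite (bigD1_seq v)//= eqxx big1 ?addr0// => w wv.
  by rewrite (negbTE wv).
rewrite -[((_ *+ _) *+ _)%R]mulr_natl -[(_ ^+ 2 *+ _)%R]mulr_natl -/N.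
rewrite le_eqVlt; apply/orP; left; apply/eqP.
by field; rewrite gt_eqF.
Qed.

Section products.
Variables (A : nat -> seq V) (phi : nat -> E -> R).
Hypothesis AA : forall i j v, i != j -> v \in A i -> v \notin A j.
Hypothesis A0 : forall i, (0 < size (A i))%N.
Hypothesis uA : forall i, uniq (A i).
Hypothesis dphi : forall i, nonneg_measurable (phi i).

Lemma measurable_prod_average n :
  measurable_fun setT (fun y => \prod_(i < n) average (A i) (phi i) y)%R.
Proof. by apply: measurable_prod => i _; exact: measurable_average. Qed.

Lemma prod_average_ge0 n y : (0 <= \prod_(i < n) average (A i) (phi i) y)%R.
Proof. by apply: prodr_ge0 => i _; exact: average_ge0. Qed.

Lemma prod_average_free n v : (forall i, (i < n)%N -> v \notin A i) ->
  free_of v (fun y => \prod_(i < n) average (A i) (phi i) y)%R.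
Proof.
by move=> vA y z; apply: eq_bigr => i _; apply: average_free; exact: vA.
Qed.

Lemma integral_prod_average n F :
  (forall i, (i < n)%N -> \int[lam]_z (phi i z)%:E = 1) ->
  measurable_fun setT F -> (forall y, 0 <= F y) ->
  (forall i v, v \in A i -> free_of v F) ->
  \int[mu]_y (F y * (\prod_(i < n) average (A i) (phi i) y)%:E) =
  \int[mu]_y F y.
Proof.
move=> phi1 mF F0 FA; elim: n phi1 => [_|n IH phi1].
  by apply: eq_integral => y _; rewrite big_ord0 mule1.
under eq_integral do rewrite big_ord_recr/= EFinM muleA.
rewrite integral_average//.
- by rewrite phi1// mule1 IH// => i ni; apply: phi1; exact: leqW.
- apply: emeasurable_funM => //; apply/measurable_EFinP.
  exact: measurable_prod_average.
- by move=> y; rewrite mule_ge0// lee_fin prod_average_ge0.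
- move=> v vn y z; rewrite (FA n v vn) prod_average_free// => i ni.
  by apply: AA vn; rewrite gtn_eqF.
Qed.

Lemma integral_prod_average_sqr n F (m c : nat -> R) :
  (forall i, (i < n)%N -> \int[lam]_z (phi i z)%:E <= (m i)%:E) ->
  (forall i v, (i < n)%N -> v \in A i ->
    \int[lam]_z (phi i z ^+ 2 / g v z)%:E <= (c i)%:E) ->
  measurable_fun setT F -> (forall y, 0 <= F y) ->
  (forall i v, v \in A i -> free_of v F) ->
  \int[mu]_y (F y * ((\prod_(i < n) average (A i) (phi i) y) ^+ 2)%:E) <=
  (\prod_(i < n) (m i ^+ 2 + c i / (size (A i))%:R))%:E * \int[mu]_y F y.
Proof.
move=> phim phic mF F0 FA; elim: n phim phic => [_ _|n IH phim phic].
  rewrite big_ord0 mul1e; apply: ge0_le_integral => //.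
  - by move=> y _; rewrite mule_ge0// lee_fin sqr_ge0.
  - apply: emeasurable_funM => //; apply/measurable_EFinP; apply: measurable_funX.
    exact: (measurable_prod_average 0).
  - by move=> y _; rewrite big_ord0 expr1n mule1.
have c0 i : (i < n.+1)%N -> (0 <= c i)%R.
  move=> ni; case EA : (A i) (A0 i) => [//|v t] _.
  rewrite -lee_fin (le_trans _ (phic i v ni _))//; last by rewrite EA mem_head.
  by apply: integral_ge0 => z _; rewrite lee_fin divr_ge0 ?sqr_ge0.
under eq_integral do rewrite big_ord_recr/= exprMn EFinM muleA.
apply: (le_trans (integral_average_sqr (c := c n) (m := m n) _ _ _ _ _ _ _ _)) => //.
- apply: emeasurable_funM => //; apply/measurable_EFinP; apply: measurable_funX.
  exact: measurable_prod_average.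
- by move=> y; rewrite mule_ge0// lee_fin sqr_ge0.
- move=> v vn y z; rewrite (FA n v vn) prod_average_free// => i ni.
  by apply: AA vn; rewrite gtn_eqF.
- exact: phim.
- by move=> v vn; exact: phic.
rewrite big_ord_recr/= [X in _ <= X%:E * _]mulrC EFinM -muleA.
apply: lee_wpmul2l.
  by rewrite lee_fin addr_ge0 ?sqr_ge0// divr_ge0// c0.
by apply: IH => [i ni|i v ni]; [apply: phim|apply: phic]; exact: leqW.
Qed.

End products.

(** A weight [W] with mean one and variance at most [delta ^ 2] with respect
    to [Fb] lowers the integral of [F <= Fb] by at most [delta * M]. The
    inequality [1 - W <= delta / 2 + (1 - W) ^ 2 / (2 * delta)] replaces the
    Cauchy-Schwarz inequality. *)
Lemma integral_near_one (F Fb W : labelled V E -> R) (delta M : R) :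
  (0 < delta)%R ->
  measurable_fun setT F -> measurable_fun setT Fb -> measurable_fun setT W ->
  (forall y, 0 <= F y)%R -> (forall y, F y <= Fb y)%R -> (forall y, 0 <= W y)%R ->
  \int[mu]_y (Fb y)%:E = M%:E ->
  \int[mu]_y (Fb y * W y)%:E = M%:E ->
  \int[mu]_y (Fb y * W y ^+ 2)%:E <= ((1 + delta ^+ 2) * M)%:E ->
  \int[mu]_y (F y)%:E <= \int[mu]_y (F y * W y)%:E + (delta * M)%:E.
Proof.
move=> d0 mF mFb mW F0 FFb W0 IM IW IW2.
have Fb0 y : (0 <= Fb y)%R by exact: le_trans (F0 y) (FFb y).
have mV : measurable_fun setT (fun y => Fb y * (1 - W y) ^+ 2)%R.
  apply: measurable_funM => //; apply: measurable_funX.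
  exact: measurable_funB.
have V0 y : (0 <= Fb y * (1 - W y) ^+ 2)%R by rewrite mulr_ge0 ?sqr_ge0.
have mFbW : measurable_fun setT (fun y => Fb y * W y)%R by exact: measurable_funM.
have mFbW2 : measurable_fun setT (fun y => Fb y * W y ^+ 2)%R.
  by apply: measurable_funM => //; exact: measurable_funX.
have IV : \int[mu]_y (Fb y * (1 - W y) ^+ 2)%:E <= (delta ^+ 2 * M)%:E.
  have E1 : \int[mu]_y (Fb y * (1 - W y) ^+ 2)%:E + (M + M)%:E =
      M%:E + \int[mu]_y (Fb y * W y ^+ 2)%:E.
    { have -> : (M + M)%:E = \int[mu]_y (2 * (Fb y * W y))%:E.
      under eq_integral do rewrite EFinM.
      rewrite ge0_integralZl//.
      - by rewrite IW -EFinM; congr (_%:E); ring.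
      - exact/measurable_EFinP.
      - by move=> y _; rewrite lee_fin mulr_ge0.
    have m2 : measurable_fun setT (fun y => 2 * (Fb y * W y))%R.
      exact: measurable_funM.
    rewrite -IM -!ge0_integralD//.
    - by apply: eq_integral => y _; rewrite -!EFinD; congr (_%:E); ring.
    all: try exact/measurable_EFinP.
    all: move=> y _; rewrite lee_fin.
    all: first [exact: V0 | by rewrite mulr_ge0// sqr_ge0 | by do ?apply: mulr_ge0].
    }
  have : \int[mu]_y (Fb y * (1 - W y) ^+ 2)%:E + (M + M)%:E <=
      (delta ^+ 2 * M)%:E + (M + M)%:E.
    rewrite E1 (le_trans (leeD2l _ IW2))// -!EFinD lee_fin le_eqVlt; apply/orP.
    by left; apply/eqP; ring.
  by rewrite leeD2rE.
have mFW : measurable_fun setT (fun y => F y * W y)%R by exact: measurable_funM.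
have FW0 y : (0 <= F y * W y)%R by rewrite mulr_ge0.
pose H y := (delta / 2 * Fb y + (2 * delta)^-1 * (Fb y * (1 - W y) ^+ 2))%R.
have mH : measurable_fun setT H.
  by apply: measurable_funD; exact: measurable_funM.
have d2 : (0 <= delta / 2)%R by rewrite divr_ge0// ltW.
have d3 : (0 <= (2 * delta)^-1)%R by rewrite invr_ge0 mulr_ge0// ltW.
have H0 y : (0 <= H y)%R.
  by rewrite /H addr_ge0//; apply: mulr_ge0.
apply: (@le_trans _ _ (\int[mu]_y ((F y * W y)%:E + (H y)%:E))).
  apply: ge0_le_integral => //.
  - by move=> y _; rewrite lee_fin.
  - exact/measurable_EFinP.
  - by apply: emeasurable_funD; exact/measurable_EFinP.
  - move=> y _; rewrite -EFinD lee_fin.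
    have amgm : (1 - W y <= delta / 2 + (2 * delta)^-1 * (1 - W y) ^+ 2)%R.
      rewrite -subr_ge0.
      have -> : (delta / 2 + (2 * delta)^-1 * (1 - W y) ^+ 2 - (1 - W y) =
        (2 * delta)^-1 * (delta - (1 - W y)) ^+ 2)%R by field; rewrite gt_eqF.
      by apply: mulr_ge0 => //; exact: sqr_ge0.
    have hF : (F y * (1 - W y) <= H y)%R.
      have -> : H y = (Fb y * (delta / 2 + (2 * delta)^-1 * (1 - W y) ^+ 2))%R.
        by rewrite /H; ring.
      have p0 : (0 <= delta / 2 + (2 * delta)^-1 * (1 - W y) ^+ 2)%R.
        by apply: addr_ge0 => //; apply: mulr_ge0 => //; exact: sqr_ge0.
      by rewrite (le_trans (ler_wpM2l (F0 y) amgm))// ler_wpM2r.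
    by move: hF; rewrite mulrBr mulr1 lerBlDr addrC.
rewrite ge0_integralD//; last 4 first.
- by move=> y _; rewrite lee_fin.
- exact/measurable_EFinP.
- by move=> y _; rewrite lee_fin.
- exact/measurable_EFinP.
rewrite leeD2l// /H.
under eq_integral do rewrite EFinD !EFinM -!EFinM EFinM [X in _ + X]EFinM.
rewrite ge0_integralD//; last 4 first.
- by move=> y _; rewrite -EFinM lee_fin; exact: mulr_ge0.
- by apply: emeasurable_funM => //; exact/measurable_EFinP.
- by move=> y _; rewrite -EFinM lee_fin; exact: mulr_ge0.
- by apply: emeasurable_funM => //; exact/measurable_EFinP.
rewrite !ge0_integralZl//.
- rewrite IM (le_trans (leeD2l _ (lee_wpmul2l _ IV)))//.
  rewrite -!EFinM -EFinD lee_fin le_eqVlt; apply/orP; left; apply/eqP.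
  by field; rewrite gt_eqF.
all: try by (move=> y _; rewrite lee_fin).
all: try exact/measurable_EFinP.
Qed.

(** The inequality [Q <= tau * Q ^ 2 + 1 / tau], on [D], stands in for the
    Cauchy-Schwarz inequality; it keeps the bound affine in [mu D]. *)
Lemma integral_indic_amgm (D : set (labelled V E)) (Q : labelled V E -> R) (tau C : R) :
  (0 < tau)%R -> measurable D -> measurable_fun setT Q -> (forall y, 0 <= Q y)%R ->
  \int[mu]_y (Q y ^+ 2)%:E <= C%:E ->
  \int[mu]_y (\1_D y * Q y)%:E <= (tau * C)%:E + (tau^-1)%:E * mu D.
Proof.
move=> t0 mD mQ Q0 IQ.
have mQ2 : measurable_fun setT (fun y => (Q y ^+ 2)%:E).
  by apply/measurable_EFinP; exact: measurable_funX.
have m1 : measurable_fun setT (fun y : labelled V E => (\1_D y : R)%:E).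
  by apply/measurable_EFinP.
apply: (@le_trans _ _ (\int[mu]_y (tau%:E * (Q y ^+ 2)%:E + (tau^-1)%:E * (\1_D y)%:E))).
  apply: ge0_le_integral => //.
  - by move=> y _; rewrite lee_fin mulr_ge0.
  - by apply/measurable_EFinP; apply: measurable_funM.
  - by apply: emeasurable_funD; apply: emeasurable_funM.
  - move=> y _; rewrite -!EFinM -EFinD lee_fin indicE; case: (y \in D).
      rewrite !mulr1 mul1r /=.
      rewrite -subr_ge0.
      have -> : (tau * Q y ^+ 2 + tau^-1 - Q y =
        tau^-1 * ((tau * Q y - 2^-1) ^+ 2 + 3 / 4))%R by field; rewrite gt_eqF.
      apply: mulr_ge0; first by rewrite invr_ge0 ltW.
      by apply: addr_ge0; rewrite ?sqr_ge0 ?divr_ge0.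
    by rewrite mul0r mulr0 addr0; apply: mulr_ge0; rewrite ?sqr_ge0 ?ltW.
rewrite ge0_integralD//; last 4 first.
- by move=> y _; rewrite -EFinM lee_fin; apply: mulr_ge0; rewrite ?sqr_ge0 ?ltW.
- by apply: emeasurable_funM.
- move=> y _; rewrite -EFinM lee_fin; apply: mulr_ge0 => //.
  by rewrite invr_ge0 ltW.
- by apply: emeasurable_funM.
rewrite !ge0_integralZl//.
- rewrite integral_indic// setIT leeD2r// EFinM lee_wpmul2l// lee_fin ltW//.
all: try by (move=> y _; rewrite lee_fin ?sqr_ge0).
all: by rewrite lee_fin ?invr_ge0 ltW.
Qed.

(** [D] and [D'] are the same event for the configurations with and without the
    point of [a]. They agree when the point of [a] is in the support of [phi n],
    which will lie outside of the window on which the event depends. *)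
Section comparison.
Variables (a : V) (A : nat -> seq V) (phi : nat -> E -> R).
Hypothesis aA : forall i, a \notin A i.
Hypothesis AA : forall i j v, i != j -> v \in A i -> v \notin A j.
Hypothesis A0 : forall i, (0 < size (A i))%N.
Hypothesis uA : forall i, uniq (A i).
Hypothesis dphi : forall i, nonneg_measurable (phi i).
Hypothesis phi1 : forall i, \int[lam]_z (phi i.+1 z)%:E = 1.
Variables (D D' : set (labelled V E)) (n : nat).
Hypotheses (mD : measurable D) (mD' : measurable D').
Hypothesis Dexchange : forall i v y, v \in A i -> D (exchange a v y) = D y.
Hypothesis D'free : free_of a D'.
Hypothesis DD' : forall y, phi n (y a) != 0%R -> D y = D' y.

Let W y : R := (\prod_(i < n) average (A i) (phi i.+1) y)%R.
Let Q y : R := (\prod_(i < n) average (A i) (phi i) y)%R.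

Let mW : measurable_fun setT W.
Proof. exact: (@measurable_prod_average A (fun i => phi i.+1)). Qed.

Let mQ : measurable_fun setT Q.
Proof. exact: measurable_prod_average. Qed.

Let W0 y : (0 <= W y)%R.
Proof. exact: (@prod_average_ge0 A (fun i => phi i.+1)). Qed.

Let Q0 y : (0 <= Q y)%R.
Proof. exact: prod_average_ge0. Qed.

Let mratio i : measurable_fun setT (ratio a (phi i)).
Proof. exact: measurable_ratio. Qed.

Let ratio0 i y : (0 <= ratio a (phi i) y)%R.
Proof. exact: ratio_ge0. Qed.

Let m1 (B : set (labelled V E)) : measurable B ->
  measurable_fun setT (\1_B : _ -> R).
Proof. by move=> mB. Qed.

Let indic_eq (B B' : set (labelled V E)) y y' :
  B y = B' y' -> \1_B y = \1_B' y' :> R.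
Proof.
by move=> h; rewrite !indicE; congr ((nat_of_bool _)%:R); apply/idP/idP; rewrite !inE h.
Qed.

Let integral_one : \int[mu]_y (cst 1 y) = 1.
Proof. by rewrite integral_cst// mul1e; exact: probability_setT. Qed.

(** [integral_path] from [phi 0] to [phi n], where [D] may be replaced by
    [D'], which does not depend on the point of [a]. *)
Let Ifree : (0 < n)%N ->
  \int[mu]_y (\1_D' y * Q y)%:E = \int[mu]_y (\1_D y * (ratio a (phi 0%N) y * W y))%:E.
Proof.
move=> n0.
have E1 := integral_path aA AA dphi (K := fun y => (\1_D y)%:E) n _ _ _.
under [RHS]eq_integral do rewrite EFinM.
rewrite E1; last 3 first.
- by apply/measurable_EFinP; exact: m1.
- by move=> y; rewrite lee_fin.
- move=> i v y vi; congr (_%:E); apply: indic_eq; exact: Dexchange vi.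
transitivity (\int[mu]_y ((\1_D' y * Q y)%:E * (ratio a (phi n) y)%:E)); last first.
  apply: eq_integral => y _; rewrite -!EFinM; congr (_%:E).
  have [p0|p0] := eqVneq (phi n (y a)) 0%R.
    by rewrite /ratio p0 mul0r mulr0 mul0r mulr0.
  rewrite -/(Q y) -mulrA [(Q y * _)%R]mulrC; congr (_ * _)%R.
  by apply/esym/indic_eq; exact: DD'.
rewrite integral_ratio//.
- by case: (n) n0 => // m _; rewrite phi1 mule1.
- by apply/measurable_EFinP; apply: measurable_funM => //; exact: m1.
- by move=> y; rewrite lee_fin mulr_ge0.
- move=> y z; congr (_%:E); rewrite /Q prod_average_free//; congr (_ * _)%R.
  by apply: indic_eq; exact: D'free.
Qed.

(** Here [phi 0] need not be a probability density: it will be the density of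
    [X a] on a bounded set, so that the left-hand side is a probability. [W]
    is removed with [integral_near_one] and [Q] with [integral_indic_amgm]. *)
Lemma insertion_bound (delta tau M C : R) (m c c' : nat -> R) :
  (0 < n)%N -> (0 < delta)%R -> (0 < tau)%R ->
  \int[lam]_z (phi 0%N z)%:E = M%:E ->
  (forall i, (i < n)%N -> \int[lam]_z (phi i z)%:E <= (m i)%:E) ->
  (forall i v, (i < n)%N -> v \in A i ->
    \int[lam]_z (phi i.+1 z ^+ 2 / g v z)%:E <= (c i)%:E) ->
  (forall i v, (i < n)%N -> v \in A i ->
    \int[lam]_z (phi i z ^+ 2 / g v z)%:E <= (c' i)%:E) ->
  (\prod_(i < n) (1 + c i / (size (A i))%:R) <= 1 + delta ^+ 2)%R ->
  (\prod_(i < n) (m i ^+ 2 + c' i / (size (A i))%:R) <= C)%R ->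
  \int[mu]_y (\1_D y * ratio a (phi 0%N) y)%:E <=
  (tau * C)%:E + (tau^-1)%:E * mu D' + (delta * M)%:E.
Proof.
move=> n0 d0 t0 IM phim phic phic' hW hQ.
have M0 : (0 <= M)%R.
  by rewrite -lee_fin -IM; apply: integral_ge0 => z _; rewrite lee_fin; case: (dphi 0%N).
have IF : \int[mu]_y (ratio a (phi 0%N) y)%:E = M%:E.
  transitivity (\int[mu]_y (1 * (ratio a (phi 0%N) y)%:E)).
    by apply: eq_integral => y _; rewrite mul1e.
  rewrite (@integral_ratio a (phi 0%N) (cst 1))//.
  by rewrite integral_one mul1e.
have fA i v : v \in A i -> free_of v (fun y => (ratio a (phi 0%N) y)%:E).
  move=> vi y z; rewrite ratio_free//; apply: contraTneq vi => ->; exact: aA.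
apply: (le_trans (@integral_near_one (fun y => \1_D y * ratio a (phi 0%N) y)%R
  (ratio a (phi 0%N)) W delta M _ _ _ _ _ _ _ _ _ _)) => //.
- by apply: measurable_funM => //; exact: m1.
- by move=> y; exact: mulr_ge0.
- by move=> y; rewrite ler_piMl// indicE; case: (_ \in _).
- under eq_integral do rewrite EFinM.
  rewrite (@integral_prod_average A (fun i => phi i.+1))//.
  + exact/measurable_EFinP.
  + by move=> y; rewrite lee_fin.
- under eq_integral do rewrite EFinM.
  apply: (le_trans (@integral_prod_average_sqr A (fun i => phi i.+1) AA A0 uA _ n
    _ (fun=> 1%R) c _ _ _ _ fA)) => //.
  + by move=> i _; rewrite phi1.
  + exact/measurable_EFinP.
  + by move=> y; rewrite lee_fin.
  rewrite IF -EFinM lee_fin ler_wpM2r// (le_trans _ hW)//.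
  by under eq_bigr do rewrite expr1n.
rewrite leeD2r//.
under eq_integral do rewrite -mulrA.
rewrite -Ifree//; apply: integral_indic_amgm => //.
under eq_integral do rewrite -[X in X%:E]mul1r EFinM.
apply: (le_trans (@integral_prod_average_sqr A phi AA A0 uA dphi n
  (cst 1) m c' phim phic' _ _ _)) => //.
by rewrite integral_one mule1 lee_fin.
Qed.

(** The roles of [W] and [Q] are swapped: [Q] is close to one, and the weight
    [ratio a (phi 0) * W] is bounded in mean square. *)
Lemma deletion_bound (delta tau c0 C : R) (c c' : nat -> R) :
  (0 < n)%N -> (0 < delta)%R -> (0 < tau)%R ->
  \int[lam]_z (phi 0%N z)%:E = 1 ->
  \int[lam]_z (phi 0%N z ^+ 2 / g a z)%:E <= c0%:E ->
  (forall i v, (i < n)%N -> v \in A i ->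
    \int[lam]_z (phi i.+1 z ^+ 2 / g v z)%:E <= (c i)%:E) ->
  (forall i v, (i < n)%N -> v \in A i ->
    \int[lam]_z (phi i z ^+ 2 / g v z)%:E <= (c' i)%:E) ->
  (\prod_(i < n) (1 + c i / (size (A i))%:R) <= C)%R ->
  (\prod_(i < n) (1 + c' i / (size (A i))%:R) <= 1 + delta ^+ 2)%R ->
  mu D' <= (tau * (C * c0))%:E + (tau^-1)%:E * mu D + delta%:E.
Proof.
move=> n0 d0 t0 IM phic0 phic phic' hW hQ.
have phi_1 i : \int[lam]_z (phi i z)%:E = 1 by case: i => [|i].
have C0 : (0 <= C)%R.
  apply: le_trans hW; apply: prodr_ge0 => i _; rewrite addr_ge0// divr_ge0//.
  case EA : (A i) (A0 i) => [//|v t] _.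
  rewrite -lee_fin (le_trans _ (phic i v _ _))//; last by rewrite EA mem_head.
  by apply: integral_ge0 => z _; rewrite lee_fin divr_ge0 ?sqr_ge0.
have -> : mu D' = \int[mu]_y (\1_D' y)%:E by rewrite integral_indic// setIT.
apply: (le_trans (@integral_near_one (\1_D') (cst 1%R) Q delta 1%R
   _ _ _ _ _ _ _ _ _ _)) => //.
- by move=> y; rewrite indicE /=; case: (_ \in _).
- have E2 y : (cst 1 y * Q y)%:E = cst 1 y * (Q y)%:E by rewrite EFinM.
  by under eq_integral do rewrite E2; rewrite (@integral_prod_average A phi).
- have E2 y : (cst 1 y * Q y ^+ 2)%:E = cst 1 y * (Q y ^+ 2)%:E by rewrite EFinM.
  under eq_integral do rewrite E2.
  apply: (le_trans (@integral_prod_average_sqr A phi AA A0 uA dphi n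
    (cst 1) (fun=> 1%R) c' _ _ _ _ _)) => //.
  + by move=> i _; rewrite phi_1.
  rewrite integral_one mule1 mulr1 lee_fin (le_trans _ hQ)//.
  by under eq_bigr do rewrite expr1n.
rewrite mulr1 leeD2r// Ifree//.
apply: (@integral_indic_amgm D (fun y => ratio a (phi 0%N) y * W y)%R) => //.
- exact: measurable_funM.
- by move=> y; exact: mulr_ge0.
have fA i v : v \in A i -> free_of v (fun y => (ratio a (phi 0%N) y ^+ 2)%:E).
  move=> vi y z; rewrite ratio_free//; apply: contraTneq vi => ->; exact: aA.
under eq_integral do rewrite exprMn EFinM.
have mr2 : measurable_fun setT (fun y => (ratio a (phi 0%N) y ^+ 2)%:E).
  by apply/measurable_EFinP; exact: measurable_funX.
apply: (le_trans (@integral_prod_average_sqr A (fun i => phi i.+1) AA A0 uA _ n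
  _ (fun=> 1%R) c _ _ mr2 _ fA)) => //.
- by move=> i _; rewrite phi1.
- by move=> y; rewrite lee_fin sqr_ge0.
rewrite EFinM; apply: lee_pmul => //.
- rewrite lee_fin; apply: prodr_ge0 => i _; rewrite addr_ge0 ?sqr_ge0// divr_ge0//.
  case EA : (A i) (A0 i) => [//|v t] _.
  rewrite -lee_fin (le_trans _ (phic i v _ _))//; last by rewrite EA mem_head.
  by apply: integral_ge0 => z _; rewrite lee_fin divr_ge0 ?sqr_ge0.
- by apply: integral_ge0 => y _; rewrite lee_fin sqr_ge0.
- rewrite lee_fin (le_trans _ hW)//.
  by under eq_bigr do rewrite expr1n.
apply: le_trans phic0.
pose h z := ((phi 0%N z / g a z) ^+ 2)%:E.
have hE y : (ratio a (phi 0%N) y ^+ 2)%:E = cst 1 y * h (y a) by rewrite mul1e.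
under eq_integral do rewrite hE.
rewrite (integral_coordinateM muG)//; last 2 first.
- apply/measurable_EFinP; apply: measurable_funX; apply: measurable_quotient.
  by case: (dphi 0%N).
- by move=> z; rewrite lee_fin sqr_ge0.
rewrite integral_one mul1e.
rewrite (integral_density_ratio a (h := fun x => x ^+ 2)%R)//; last first.
  by move=> x _; exact: sqr_ge0.
rewrite le_eqVlt; apply/orP; left; apply/eqP.
apply: eq_integral => z _; congr (_%:E).
by field; rewrite gt_eqF.
Qed.

End comparison.

End exchange.

(** * Point configurations and dyadic cells *)

Section at_least.
Context {T : choiceType}.
Implicit Types (S : set T) (n : nat).

(** Unlike the equality of cardinals, this is monotone in [S] and is not
    affected by infinite sets. *)
Definition at_least n S := exists s : seq T,
  [/\ uniq s, size s = n & forall x, x \in s -> S x].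

Lemma card_eq_seq S n : (S #= `I_n)%card ->
  exists t, [/\ uniq t, size t = n & forall x, x \in t <-> S x].
Proof.
elim: n S => [|n IH] S.
  rewrite II0 card_eq0 => /eqP ->; exists [::]; split => // x; split.
move=> /eq_cardSP[x Sx /IH[t [ut tn tS]]]; exists (x :: t); split => /=.
- by rewrite ut andbT; apply/negP => /tS[_ /(_ erefl)].
- by rewrite tn.
- move=> y; rewrite inE; split; first by case/orP => [/eqP ->//|/tS[]].
  move=> Sy; case: (eqVneq y x) => //= yx; apply/tS; split => //.
  exact/eqP.
Qed.

Lemma card_at_least S n : (S #= `I_n)%card <-> at_least n S /\ ~ at_least n.+1 S.
Proof.
have fin_eq (s : seq T) k : (S #= `I_k)%card -> uniq s -> (forall x, x \in s -> S x) ->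
    (size s <= k)%N /\ exists t, [/\ uniq t, size t = k & forall x, x \in t <-> S x].
  move=> /card_eq_seq[t [ut tk tS]] us sS; split; last by exists t.
  by rewrite -tk uniq_leq_size// => x /sS /tS.
split.
  move=> Sn; have [_ [t [ut tn tS]]] := fin_eq [::] n Sn isT (fun _ h => match notF h with end).
  split; first by exists t; split => // x /tS.
  by case=> s [us sn sS]; have [] := fin_eq s n Sn us sS; rewrite sn ltnn.
move=> [[s [us sn sS]] nS].
have Ss : S = [set` s].
  apply/seteqP; split => x /= => [Sx|/sS//].
  apply: contrapT => /negP xs; apply: nS; exists (x :: s); split => //=.
  - by rewrite xs.
  - by rewrite sn.
  - by move=> y; rewrite inE => /orP[/eqP ->|/sS].
have : finite_set S by rewrite Ss; apply/finite_seqP; exists s.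
case/finite_setP => k Sk.
have [sk [t [ut tk tS]]] := fin_eq s k Sk us sS.
suff -> : n = k by [].
apply/eqP; rewrite eqn_leq -sn sk -tk uniq_leq_size// => x /tS.
by rewrite Ss.
Qed.

Lemma at_least_sub n S S' : S `<=` S' -> at_least n S -> at_least n S'.
Proof. by move=> SS' [s [us sn sS]]; exists s; split => // x /sS /SS'. Qed.

Lemma at_least_leq m n S : (m <= n)%N -> at_least n S -> at_least m S.
Proof.
move=> mn [s [us sn sS]]; exists (take m s); split; first exact: take_uniq.
  by rewrite size_takel// sn.
by move=> x /mem_take /sS.
Qed.

Lemma at_least_card n S : ~ at_least n.+1 S ->
  exists k, (k <= n)%N /\ (S #= `I_k)%card.
Proof.
elim: n => [|n IH] h.
  by exists 0%N; split => //; apply/card_at_least; split => //; exists [::].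
have [h'|h'] := pselect (at_least n.+1 S).
  by exists n.+1; split => //; apply/card_at_least.
by have [k [kn Sk]] := IH h'; exists k; split => //; exact: leqW.
Qed.

Lemma finite_at_least S : finite_set S <-> exists n, ~ at_least n S.
Proof.
split; first by case/finite_setP => n /card_at_least[_ h]; exists n.+1.
case=> -[|n] h; first by case: h; exists [::].
by have [k [_ Sk]] := at_least_card h; apply/finite_setP; exists k.
Qed.

End at_least.

Section grid.
Context {R : realType} {d : nat}.
Implicit Types (z p : d.-tuple R) (c : d.-tuple int).

Definition dyadic_index (m : nat) z : d.-tuple int :=
  [tuple Num.floor (2 ^+ m * tnth z i) | i < d].

Definition dyadic_cell m c : set (d.-tuple R) := [set z | dyadic_index m z = c].

Lemma measurable_dyadic_cell m c : measurable (dyadic_cell m c).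
Proof.
rewrite (_ : dyadic_cell m c = \bigcap_(i in [set: 'I_d])
   ((fun z : d.-tuple R => tnth z i) @^-1`
     [set x : R | Num.floor (2 ^+ m * x) = tnth c i])); last first.
  apply/seteqP; split => [z <- i _|z h]; first by rewrite /= tnth_mktuple.
  by apply: eq_from_tnth => i; rewrite tnth_mktuple; exact: h.
apply: fin_bigcap_measurable => // i _; apply: preimage_measurable.
  exact: measurable_tnth.
rewrite (_ : [set _ | _] = `[(tnth c i)%:~R / 2 ^+ m, ((tnth c i)%:~R + 1) / 2 ^+ m[%classic).
  exact: measurable_itv.
apply/seteqP; split => x /=; rewrite in_itv/= ler_pdivrMr ?exprn_gt0// ltr_pdivlMr ?exprn_gt0// [x * _]mulrC.
  by move=> <-; rewrite -intrD1; exact: floor_itv.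
by move=> h; apply: floor_def; rewrite intrD1.
Qed.

Lemma dyadic_index_close m z p i : dyadic_index m z = dyadic_index m p ->
  2 ^+ m * `|tnth z i - tnth p i| < 1.
Proof.
move=> /(congr1 (fun t => tnth t i)); rewrite !tnth_mktuple => fE.
rewrite -[X in X * _](@ger0_norm _ (2 ^+ m)) ?exprn_ge0// -normrM mulrBr.
have /andP[] := floor_itv (2 ^+ m * tnth z i).
have /andP[] := floor_itv (2 ^+ m * tnth p i).
by rewrite fE !intrD => ? ? ? ?; rewrite ltr_norml; apply/andP; split; lra.
Qed.

Lemma dyadic_index_separates z p : z <> p ->
  exists m0, forall m, (m0 <= m)%N -> dyadic_index m z <> dyadic_index m p.
Proof.
move=> zp.
have [i zpi] : exists i, tnth z i != tnth p i.
  apply: contrapT => h; apply: zp; apply: eq_from_tnth => i.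
  by apply: contrapT => /eqP hi; apply: h; exists i.
have e0 : 0 < `|tnth z i - tnth p i| by rewrite normr_gt0 subr_eq0.
pose m0 := Num.truncn (`|tnth z i - tnth p i|^-1).
exists m0.+1 => m m0m /(@dyadic_index_close m z p i); apply/negP; rewrite -leNgt.
rewrite -ler_pdivrMr// mul1r.
apply: (@le_trans _ _ m%:R); last first.
  by rewrite -natrX ler_nat ltnW// ltn_expl.
by rewrite ltW// (lt_le_trans (truncnS_gt _))// ler_nat.
Qed.

End grid.

Lemma bigcup_measurable_countable {d1 : measure_display} {T : measurableType d1}
    {I : countType} (P : set I) (F : I -> set T) :
  (forall i, P i -> measurable (F i)) -> measurable (\bigcup_(i in P) F i).
Proof.
move=> mF; rewrite bigcup_mkcond; apply: countable_bigcupT_measurable => // i.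
by case: ifPn => // /set_mem/mF.
Qed.

Section configurations.
Context {R : realType} {d : nat}.
Local Notation E := (d.-tuple R).
Local Notation config := (@configuration R d).

Lemma count_eqE (S : set E) n :
  is_true (S #= `I_n)%card = (at_least n S /\ ~ at_least n.+1 S).
Proof. by apply/propext; exact: card_at_least. Qed.

Lemma measurable_at_least n (B : set E) : measurable B ->
  measurable [set S : config | at_least n ((S : set E) `&` B)].
Proof.
move=> mB; elim: n => [|n IH].
  rewrite (_ : [set _ | _] = setT)//; apply/seteqP; split => // S _.
  by exists [::].
rewrite (_ : [set _ | _] = [set S : config | at_least n ((S : set E) `&` B)] `\`
    [set S : config | ((S : set E) `&` B #= `I_n)%card]).
  apply: measurableD => //; apply: sub_sigma_algebra.
  by exists B, n.
apply/seteqP; split => S /=; rewrite count_eqE.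
  by move=> h; split; [exact: at_least_leq h|case].
by move=> [h1 h2]; apply: contrapT => h3; apply: h2.
Qed.

(** Events of the form [at_least n] generate the sigma-algebra, since exactly
    [n] points means at least [n] but not at least [n + 1]. *)
Lemma measurable_to_configuration {d1 : measure_display}
    {T : measurableType d1} (f : T -> config) :
  (forall n B, measurable B ->
    measurable [set t | at_least n ((f t : set E) `&` B)]) ->
  measurable_fun setT f.
Proof.
move=> mf; apply: (@measurability _ _ T config setT f count_events) => //.
move=> _ [_ [B [n [mB ->]]] <-]; rewrite setTI.
rewrite (_ : _ @^-1` _ = [set t | at_least n ((f t : set E) `&` B)] `\`
   [set t | at_least n.+1 ((f t : set E) `&` B)]).
  by apply: measurableD; exact: mf.
by apply/seteqP; split => t /=; rewrite count_eqE.
Qed.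

Lemma measurable_restriction (B : set E) : measurable B ->
  measurable_fun setT (fun S : config => ((S : set E) `&` B : config)).
Proof.
move=> mB; apply: measurable_to_configuration => n C mC.
rewrite (_ : [set _ | _] = [set S : config | at_least n ((S : set E) `&` (B `&` C))]).
  by apply: measurable_at_least; exact: measurableI.
by apply/funext => S; rewrite /mkset -setIA.
Qed.

Definition window (M : nat) : set E := [set z | forall i, `|tnth z i| <= M%:R].

Lemma windowS m n : (m <= n)%N -> window m `<=` window n.
Proof. by move=> mn z h i; rewrite (le_trans (h i))// ler_nat. Qed.

Lemma window_cover z : exists M, window M z.
Proof.
exists (Num.truncn (\sum_(j < d) `|tnth z j|)).+1 => i.
apply: (le_trans _ (ltW (truncnS_gt _))).
by rewrite (bigD1 i)//= lerDl sumr_ge0.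
Qed.

Lemma measurable_window M : measurable (window M).
Proof.
rewrite (_ : window M = \bigcap_(i in [set: 'I_d])
   ((fun z : E => tnth z i) @^-1` [set x : R | `|x| <= M%:R])); last first.
  by apply/seteqP; split => [z h i _|z h i]; [exact: h|exact: (h i)].
apply: fin_bigcap_measurable => // i _; apply: preimage_measurable.
  exact: measurable_tnth.
rewrite (_ : [set _ | _] = `[- M%:R, M%:R]%classic); first exact: measurable_itv.
by apply/seteqP; split => x /=; rewrite in_itv/= ler_norml.
Qed.

Definition locally_finite (S : set E) := forall n, finite_set (S `&` window n).

Lemma measurable_locally_finite : measurable [set S : config | locally_finite S].
Proof.
rewrite (_ : [set _ | _] = \bigcap_n \bigcup_k ~` [set S : config |
  at_least k ((S : set E) `&` window n)]).
  apply: bigcapT_measurable => n; apply: bigcupT_measurable => k.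
  by apply: measurableC; apply: measurable_at_least; exact: measurable_window.
apply/seteqP; split => S h n; first by move=> _; have /finite_at_least[k] := h n; exists k.
by apply/finite_at_least; have [k _ hk] := h n I; exists k.
Qed.

Definition points_off {V : choiceType} (S : set V) (y : labelled V E) : config :=
  [set y v | v in ~` S].

Lemma measurable_distinct (V : choiceType) (v w : V) :
  measurable [set y : labelled V E | y v != y w].
Proof.
rewrite (_ : [set _ | _] = \bigcup_(i in [set: 'I_d])
    [set y : labelled V E | tnth (y v) i != tnth (y w) i]).
  apply: fin_bigcup_measurable => // i _.
  have mv u : measurable_fun setT (fun y : labelled V E => tnth (y u) i).
    exact: (measurableT_comp (measurable_tnth i) (measurable_coordinate u)).
  have := measurable_fun_eqr (mv v) (mv w).
  move=> /(_ measurableT [set false]) /(_ I); rewrite setTI.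
  congr (measurable _); apply/seteqP; split => y /=.
    by move=> /negbT.
  by move=> /negbTE.
apply/seteqP; split => y /=.
  move=> yvw; apply: contrapT => h; move/negP: yvw; apply; apply/eqP.
  apply: eq_from_tnth => i; apply: contrapT => /eqP hi; apply: h.
  by exists i.
by move=> [i _]; apply: contraNneq => ->.
Qed.

(** At least [n] points in [B] means that some [n] labels have distinct points
    in [B]; there are countably many choices of labels. *)
Lemma measurable_points_off (V : countType) (S : set V) :
  measurable_fun setT (@points_off V S).
Proof.
apply: measurable_to_configuration => n B mB.
rewrite (_ : [set _ | _] = \bigcup_(s in [set s : seq V |
      size s = n /\ forall v, v \in s -> ~ S v])
    [set y : labelled V E | pairwise (fun v w => y v != y w) s /\
       forall v, v \in s -> B (y v)]).
  apply: bigcup_measurable_countable => s [sn sS].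
  rewrite (_ : [set _ | _] =
    [set y : labelled V E | pairwise (fun v w => y v != y w) s] `&`
    cylinder s (fun=> B)); last by apply/seteqP; split.
  apply: measurableI; last exact: measurable_cylinder.
  elim: s {sn sS} => [|v s IH] /=.
    by rewrite (_ : [set _ | _] = setT)//; apply/seteqP; split.
  rewrite (_ : [set _ | _] = (\big[setI/setT]_(w <- s) [set y : labelled V E | y v != y w])
     `&` [set y : labelled V E | pairwise (fun v w => y v != y w) s]).
    apply: measurableI => //; apply: bigsetI_measurable => w _.
    exact: measurable_distinct.
  rewrite -bigcap_seq; apply/seteqP; split => y /=.
    by move=> /andP[/allP h ->]; split => // w /h.
  by move=> [h ->]; rewrite andbT; apply/allP => w /h.
have pairE (y : labelled V E) s :
    pairwise (fun v w => y v != y w) s = uniq (map y s).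
  by rewrite uniq_pairwise pairwise_map.
apply/seteqP; split => y /=.
  move=> [t [ut tn tB]].
  have [s [sE sS]] : exists s, map y s = t /\ forall v, v \in s -> ~ S v.
    have : forall z, z \in t -> exists2 v, ~ S v & y v = z.
      by move=> z /tB[].
    elim: (t) => [|z r IH] h; first by exists [::].
    have [s [sE sS]] := IH (fun w wr => h w (@mem_behead _ (z :: r) w wr)).
    have [v Sv vz] := h z (mem_head _ _).
    exists (v :: s); split => /=; first by rewrite vz sE.
    by move=> w; rewrite inE => /orP[/eqP ->|/sS].
  exists s; first by split => //; rewrite -(size_map y) sE.
  split; first by rewrite pairE sE.
  by move=> v vs; have [_] := tB (y v) (eq_ind _ (fun r => y v \in r) (map_f y vs) _ sE).
move=> [s [sn sS] [sy sB]]; exists (map y s); split.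
- by rewrite -pairE.
- by rewrite size_map.
- move=> z /mapP[v vs ->]; split; last exact: sB.
  by exists v => //; exact: sS.
Qed.

End configurations.

Section isolating_cells.
Context {R : realType} {d : nat}.
Local Notation E := (d.-tuple R).
Local Notation config := (@configuration R d).

Definition insert_point (p : config * E) : config := (p.1 : set E) `|` [set p.2].

Lemma separated_cells (s : seq E) (u : E) : u \notin s ->
  exists m0, forall m, (m0 <= m)%N -> forall x, x \in s ->
    ~ dyadic_cell m (dyadic_index m u) x.
Proof.
elim: s => [|x s IH]; first by exists 0%N.
rewrite inE negb_or => /andP[/eqP ux /IH[m1 hm1]].
have [m2 hm2] := dyadic_index_separates (fun e => ux e).
exists (maxn m1 m2) => m; rewrite geq_max => /andP[hm1' hm2'] y.
rewrite inE => /orP[/eqP ->|]; last exact: hm1.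
by move=> /esym; exact: hm2.
Qed.

(** A new point [u] changes the count only if it is not yet there; then some
    dyadic cell contains [u] but none of the [n] other points that are
    counted. The cells turn this into a countable union of products of
    events. *)
Lemma measurable_insert_point : measurable_fun setT insert_point.
Proof.
apply: measurable_to_configuration => -[|n] B mB.
  rewrite (_ : [set _ | _] = setT)//; apply/seteqP; split => // S _.
  by exists [::].
rewrite (_ : [set _ | _] =
   [set S : config | at_least n.+1 ((S : set E) `&` B)] `*` setT `|`
   \bigcup_(mc in [set: nat * d.-tuple int])
     ([set S : config | at_least n ((S : set E) `&` (B `\` dyadic_cell mc.1 mc.2))]
      `*` (B `&` dyadic_cell mc.1 mc.2))).
  apply: measurableU.
    by apply: measurableX => //; exact: measurable_at_least.
  apply: bigcup_measurable_countable => -[m c] _; apply: measurableX.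
    by apply: measurable_at_least; apply: measurableD => //; exact: measurable_dyadic_cell.
  by apply: measurableI => //; exact: measurable_dyadic_cell.
apply/seteqP; split => -[S u] /=; rewrite /insert_point /=.
  move=> [s [us sn sSB]].
  have [us'|us'] := boolP (u \in s); last first.
    left; split => //; exists s; split => // x xs.
    have [[Sx|xu] Bx] := sSB x xs; first by split.
    by move: us'; rewrite -[u]xu xs.
  right; have [_ Bu] := sSB u us'.
  have ur : u \notin rem u s by rewrite mem_rem_uniqF.
  have [m hm] := separated_cells ur.
  exists (m, dyadic_index m u) => //=; split => //; exists (rem u s).
  split; [exact: rem_uniq|by rewrite size_rem// sn|move=> x xr].
  have [[Sx|/= xu] Bx] := sSB x (mem_rem xr); last first.
    by rewrite (_ : x = u)// (negbTE ur) in xr.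
  by split => //; split => //; exact: (hm m (leqnn m)).
move=> [[h _]|[[m c] _ /= [[s [us sn sS]] [Bu cu]]]].
  by apply: at_least_sub h => x [Sx Bx]; split => //; left.
exists (u :: s); split => /=; [|by rewrite sn|].
  by rewrite us andbT; apply/negP => /sS[_ [_]].
move=> x; rewrite inE => /orP[/eqP ->|/sS[Sx [Bx _]]]; first by split => //; right.
by split => //; left.
Qed.

(** At a fine scale, the dyadic cell of [z i] contains no point of [S] other
    than [z i]. Removing the cells instead of the points leaves only countably
    many operations to consider. *)
Lemma locally_finite_deletion k (S : config) (z : 'I_k -> E) :
  locally_finite S -> exists m, delete_points S z =
    (S : set E) `\` \bigcup_(i in [set: 'I_k]) dyadic_cell m (dyadic_index m (z i)).
Proof.
move=> lfS.
have sep i : exists m0, forall m, (m0 <= m)%N -> forall x, S x -> x <> z i ->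
    ~ dyadic_cell m (dyadic_index m (z i)) x.
  pose N := (Num.truncn (\sum_(j < d) `|tnth (z i) j|)).+2.
  have /finite_seqP[s sE] := lfS N.
  have [m0 hm0] := @separated_cells [seq x <- s | x != z i] (z i)
    ltac:(by rewrite mem_filter eqxx).
  exists m0 => m m0m x Sx xz xc; apply: (hm0 m m0m x) => //.
  rewrite mem_filter (introN eqP xz)/=.
  suff : [set` s] x by [].
  rewrite -sE; split => // j.
  have zj : `|tnth (z i) j| < N.-1%:R.
    apply: (le_lt_trans _ (truncnS_gt _)).
    by rewrite (bigD1 j)//= lerDl sumr_ge0.
  have h2 : `|tnth x j - tnth (z i) j| <= 1.
    apply/ltW/(le_lt_trans _ (dyadic_index_close j xc)).
    by rewrite ler_peMl// exprn_ege1// ler1n.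
  rewrite -(subrK (tnth (z i) j) (tnth x j)) (le_trans (ler_normD _ _))//.
  by move: zj; rewrite /N /= => /ltW zj; rewrite -natr1 addrC lerD.
have /choice[f fP] := sep.
exists (\max_(i < k) f i)%N; apply/seteqP; split => x [Sx h]; split => //.
  move=> [i _]; apply: (fP i) => //; first exact: leq_bigmax.
  by move=> xz; apply: h; exists i.
by move=> [i _ xz]; apply: h; exists i => //; rewrite -xz.
Qed.

End isolating_cells.

(** * Approximation of events by an algebra *)

Section approximation.
Context {d1 : measure_display} {T : measurableType d1} {R : realType}.
Local Open Scope ereal_scope.
Variable L : set (set T).
Hypothesis mL : L `<=` measurable.
Hypothesis L0 : L set0.
Hypothesis LC : forall A, L A -> L (~` A).
Hypothesis LU : forall A B, L A -> L B -> L (A `|` B).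

Definition set_distance (rho : set T -> \bar R) A B :=
  rho ((A `\` B) `|` (B `\` A)).

(** The sets that can be approximated form a sigma-algebra that contains the
    algebra. *)
Lemma algebra_approximation (rho : {measure set T -> \bar R}) :
  rho setT < +oo -> forall A, <<s L >> A -> forall e : R, (0 < e)%R ->
  exists2 B, L B & set_distance rho A B <= e%:E.
Proof.
move=> rhoT.
have mono A B : measurable A -> measurable B -> A `<=` B -> rho A <= rho B.
  by move=> mA mB AB; apply: le_measure; rewrite ?inE.
pose approx A := measurable A /\ forall e : R, (0 < e)%R ->
  exists2 B, L B & set_distance rho A B <= e%:E.
suff H : <<s L >> `<=` approx by move=> A /H[].
have LmD A B : measurable A -> L B -> measurable ((A `\` B) `|` (B `\` A)).
  by move=> mA LB; apply: measurableU; apply: measurableD => //; exact: mL.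
have approx0 : approx set0.
  split => // e e0; exists set0 => //.
  by rewrite /set_distance !setD0 setU0 measure0 lee_fin ltW.
have approxU A A' : approx A -> approx A' -> approx (A `|` A').
  move=> [mA hA] [mA' hA']; split; first exact: measurableU.
  move=> e e0; have e20 : (0 < e / 2)%R by rewrite divr_gt0.
  have [B LB dB] := hA _ e20; have [B' LB' dB'] := hA' _ e20.
  exists (B `|` B'); first exact: LU.
  rewrite (splitr e) EFinD (le_trans _ (leeD dB dB'))//.
  rewrite (le_trans _ (measureU2 _ _ _))//; try exact: LmD.
  apply: mono; [by apply: LmD; [exact: measurableU|exact: LU]| |].
    by apply: measurableU; exact: LmD.
  move=> x [[[Ax|Ax] nB]|[[Bx|Bx] nA]].
  - by left; left; split => // Bx; apply: nB; left.
  - by right; left; split => // Bx; apply: nB; right.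
  - by left; right; split => // Ax; apply: nA; left.
  - by right; right; split => // Ax; apply: nA; right.
apply: smallest_sub; last first.
  move=> A LA; split; first exact: mL.
  move=> e e0; exists A => //.
  by rewrite /set_distance !setDv setU0 measure0 lee_fin ltW.
split => //.
  move=> A [mA hA]; rewrite setTD; split; first exact: measurableC.
  move=> e e0; have [B LB dB] := hA e e0; exists (~` B); first exact: LC.
  rewrite /set_distance (_ : _ `|` _ = (A `\` B) `|` (B `\` A))//.
  apply/seteqP; split => x [[h1 h2]|[h1 h2]].
  - by right; split => //; exact: contrapT.
  - by left; split => //; exact: contrapT.
  - by right; split => //; exact/not_notP.
  - by left; split => //; exact/not_notP.
move=> F hF; have mF k : measurable (F k) by have [] := hF k.
have mU : measurable (\bigcup_k F k) by exact: bigcupT_measurable.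
split => // e e0; have e20 : (0 < e / 2)%R by rewrite divr_gt0.
pose U n := \big[setU/set0]_(k < n) F k.
have aU n : approx (U n).
  by rewrite /U; elim: n => [|n IH]; rewrite ?big_ord0 ?big_ord_recr//=; exact: approxU.
pose D n := (\bigcup_k F k) `\` U n.
have mUn n : measurable (U n) by have [] := aU n.
have mD n : measurable (D n) by exact: measurableD.
have D0 : \bigcap_n D n = set0.
  rewrite -subset0 => x h; have [[k _ Fk] _] := h 0%N I.
  have [_] := h k.+1 I; apply; rewrite /U -bigcup_mkord; exists k => //=.
have cD : (rho \o D) x @[x --> \oo] --> 0.
  rewrite -(measure0 rho) -D0; apply: nonincreasing_cvg_mu => //.
  - by rewrite (le_lt_trans _ rhoT)// mono.
  - by rewrite D0.
  - move=> n m nm; apply/subsetPset => x [Ux nU]; split => // Um; apply: nU.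
    move: Um; rewrite /U -!bigcup_mkord => -[k /= kn Fk]; exists k => //=.
    exact: leq_trans nm.
have [n Dn] : exists n, rho (D n) <= (e / 2)%:E.
  have : \forall n \near \oo, rho (D n) < (e / 2)%:E.
    have /fine_cvgP[_ /cvgr_lt] := cD.
    move=> /(_ _ e20); apply: filterS => n /=; rewrite -lte_fin fineK//.
    by rewrite ge0_fin_numE// (le_lt_trans _ rhoT)// mono.
  by case=> n _ /(_ n (leqnn n)) /ltW; exists n.
have [B LB dB] := (aU n).2 _ e20.
exists B => //; rewrite (splitr e) EFinD (le_trans _ (leeD Dn dB))//.
rewrite (le_trans _ (measureU2 _ _ _))//; try exact: LmD.
apply: mono; [exact: LmD|by apply: measurableU => //; exact: LmD|].
move=> x [[Ux nB]|[Bx nU]].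
  have [Unx|nUn] := pselect (U n x); first by right; left.
  by left; split.
right; right; split => // Unx; apply: nU.
by move: Unx; rewrite /U -bigcup_mkord => -[k _ ?]; exists k.
Qed.

(** Approximate with respect to the sum of the two measures. *)
Lemma le_measure_approximation (r1 r2 : {measure set T -> \bar R}) (a c : R) :
  r1 setT < +oo -> r2 setT < +oo -> (0 <= c)%R ->
  (forall A, L A -> r1 A <= a%:E + c%:E * r2 A) ->
  forall A, <<s L >> A -> r1 A <= a%:E + c%:E * r2 A.
Proof.
move=> r1T r2T c0 h A sA.
pose rho := measure_add r1 r2.
have rhoT : rho setT < +oo by rewrite /rho measure_addE lte_add_pinfty.
have mA : measurable A.
  by move: A sA; apply: smallest_sub => //; exact: sigma_algebra_measurable.
apply/lee_addgt0Pr => e e0.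
have e10 : (0 < e / (1 + c))%R by rewrite divr_gt0// ltr_wpDr.
have [B LB dB0] := algebra_approximation rhoT sA e10.
have mB := mL LB.
have mAB : measurable (A `\` B) by exact: measurableD.
have mBA : measurable (B `\` A) by exact: measurableD.
have dB : r1 ((A `\` B) `|` (B `\` A)) + r2 ((A `\` B) `|` (B `\` A)) <=
    (e / (1 + c))%:E by rewrite -measure_addE.
have dAB : r1 (A `\` B) <= (e / (1 + c))%:E.
  apply: le_trans dB; rewrite (le_trans _ (leeDl _ _))//.
  by apply: le_measure; rewrite ?inE//; exact: measurableU.
have dBA : r2 (B `\` A) <= (e / (1 + c))%:E.
  apply: le_trans dB; rewrite (le_trans _ (leeDr _ _))//.
  by apply: le_measure; rewrite ?inE//; exact: measurableU.
have A1 : r1 A <= r1 B + r1 (A `\` B).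
  rewrite (le_trans _ (measureU2 _ mB mAB))//.
  apply: le_measure; rewrite ?inE//; first exact: measurableU.
  by move=> x Ax; have [Bx|nBx] := pselect (B x); [left|right].
have B2 : r2 B <= r2 A + r2 (B `\` A).
  rewrite (le_trans _ (measureU2 _ mA mBA))//.
  apply: le_measure; rewrite ?inE//; first exact: measurableU.
  by move=> x Bx; have [Ax|nAx] := pselect (A x); [left|right].
apply: (le_trans A1); apply: (le_trans (leeD (h _ LB) dAB)).
rewrite -addeA; rewrite -!addeA leeD2l//.
apply: (@le_trans _ _ (c%:E * (r2 A + (e / (1 + c))%:E) + (e / (1 + c))%:E)).
  by rewrite leeD2r// lee_wpmul2l// (le_trans B2)// leeD2l.
rewrite ge0_muleDr//; last by rewrite lee_fin ltW.
rewrite -addeA leeD2l// -EFinM -EFinD lee_fin le_eqVlt; apply/orP; left; apply/eqP.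
by field; rewrite gt_eqF// ltr_wpDr.
Qed.

End approximation.

(** * Local events *)

Section local_sets.
Context {R : realType} {d : nat}.
Local Notation E := (d.-tuple R).
Local Notation config := (@configuration R d).

Definition local_sets : set (set config) := [set A | measurable A /\
  exists M, forall S : config, A S <-> A ((S : set E) `&` window M)].

Lemma local_setsP A : local_sets A -> measurable A /\
  exists M, forall N, (M <= N)%N -> forall S, A S <-> A ((S : set E) `&` window N).
Proof.
move=> [mA [M h]]; split => //; exists M => N MN S.
rewrite h [X in _ <-> X]h -setIA (_ : window N `&` window M = window M)//.
exact/setIidPr/windowS.
Qed.

Lemma local_sets0 : local_sets set0. Proof. by split => //; exists 0%N. Qed.

Lemma local_setsC A : local_sets A -> local_sets (~` A).
Proof.
move=> [mA [M h]]; split; first exact: measurableC.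
exists M => S /=; have [h1 h2] := h S.
by split => nA Ax; apply: nA; [exact: h2|exact: h1].
Qed.

Lemma local_setsU A B : local_sets A -> local_sets B -> local_sets (A `|` B).
Proof.
move=> /local_setsP[mA [M hA]] /local_setsP[mB [N hB]].
split; first exact: measurableU.
exists (maxn M N) => S.
have hA' := hA _ (leq_maxl M N) S; have hB' := hB _ (leq_maxr M N) S.
by split => -[/hA'|/hB'] ?; by [left|right].
Qed.

(** A count in [B] is the increasing limit of the counts in [B] restricted to
    windows, which are local. *)
Lemma measurable_local_sets (A : set config) : measurable A -> <<s local_sets >> A.
Proof.
have sL : sigma_algebra setT <<s local_sets >> := smallest_sigma_algebra _ _.
have at_leastL n (B : set E) : measurable B ->
    <<s local_sets >> [set S : config | at_least n ((S : set E) `&` B)].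
  move=> mB.
  rewrite (_ : [set _ | _] = \bigcup_m
    [set S : config | at_least n ((S : set E) `&` (B `&` window m))]).
    apply: sigma_algebra_bigcup => m; apply: sub_sigma_algebra; split.
      by apply: measurable_at_least; apply: measurableI => //; exact: measurable_window.
    by exists m => S /=; rewrite setIACA setIid setIA.
  apply/seteqP; split => S /=.
    move=> [s [us sn sS]].
    have [M sM] : exists M, forall x, x \in s -> window M x.
      elim: (s) => [|x r [M hM]]; first by exists 0%N.
      have [N hN] := window_cover x; exists (maxn M N) => z.
      rewrite inE => /orP[/eqP ->|/hM]; last exact/windowS/leq_maxl.
      by move: hN; exact/windowS/leq_maxr.
    exists M => //; exists s; split => // x xs.
    by have [Sx Bx] := sS x xs; split => //; split => //; exact: sM.
  by move=> [M _]; apply: at_least_sub => x [Sx [Bx _]].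
move: A; apply: smallest_sub => // A [B [n [mB ->]]].
rewrite (_ : [set _ | _] = [set S : config | at_least n ((S : set E) `&` B)] `\`
   [set S : config | at_least n.+1 ((S : set E) `&` B)]); last first.
  by apply/seteqP; split => S /=; rewrite count_eqE.
rewrite setDE -[X in X `&` _]setCK -setCU.
have [_ hC hU] := sL.
rewrite -setTD; apply: (hC).
rewrite -bigcup2E; apply: hU => -[|[|k]] /=.
- by rewrite -setTD; apply: hC; exact: at_leastL.
- exact: at_leastL.
- by case: sL.
Qed.

End local_sets.

(** * Lebesgue measure of boxes and of translates *)

Section lebesgue.
Context {R : realType}.

Definition translate {d} (t z : d.-tuple R) : d.-tuple R :=
  [tuple tnth t i + tnth z i | i < d].

Definition tuple_box d (B : 'I_d -> set R) : set (d.-tuple R) :=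
  [set z | forall i, B i (tnth z i)].

Lemma lebesgue_tuple_boxE d (B : 'I_d -> set R) :
  (forall i, measurable (B i)) ->
  (lebesgue_tuple d (tuple_box B) = \prod_(i < d) lebesgue_measure (B i))%E.
Proof. exact: lebesgue_tuple_box. Qed.

Definition tuple_boxes d : set (set (d.-tuple R)) :=
  [set A | exists B, (forall i, measurable (B i)) /\ A = tuple_box B].

Lemma measurable_tuple_box d (B : 'I_d -> set R) :
  (forall i, measurable (B i)) -> measurable (tuple_box B).
Proof.
move=> mB; rewrite (_ : tuple_box B = \bigcap_(i in [set: 'I_d])
   ((fun z : d.-tuple R => tnth z i) @^-1` B i)); last first.
  by apply/seteqP; split => [z h i _|z h i]; [exact: h|exact: (h i)].
apply: fin_bigcap_measurable => // i _; apply: preimage_measurable => //.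
exact: measurable_tnth.
Qed.

Lemma measurable_tuple_boxes d :
  @measurable _ (d.-tuple R) = <<s @tuple_boxes d >>.
Proof.
apply/seteqP; split.
  apply: smallest_sub; first exact: smallest_sigma_algebra.
  move=> A; rewrite -bigcup_seq => -[i _ [B mB <-]]; rewrite setTI.
  apply: sub_sigma_algebra; exists (fun j => if j == i then B else setT).
  split; first by move=> j; case: ifP.
  apply/seteqP; split => z /=; first by move=> h j; case: eqVneq => // ->.
  by move=> /(_ i); rewrite eqxx.
apply: smallest_sub; first exact: sigma_algebra_measurable.
by move=> A [B [mB ->]]; exact: measurable_tuple_box.
Qed.

(** The shifted measure agrees with the lengths of half-open intervals, which
    determine Lebesgue measure. *)
Lemma lebesgue_measure_shift (t : R) (A : set R) : measurable A ->
  pushforward lebesgue_measure ((fun x => t + x) : _ -> measurableTypeR R) A =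
  lebesgue_measure A.
Proof.
move=> mA; have mt : measurable_fun setT
    ((fun x => t + x) : R -> measurableTypeR R).
  have mt : measurable_fun [set: R] (fun x : R => t + x) by exact: measurable_funD.
  exact: mt.
apply/esym/(lebesgue_measure_unique (mu :=
  image_measure lebesgue_measure mt)) => // _ [[a b] _ <-] /=.
rewrite /pushforward (_ : _ @^-1` _ = `]a - t, b - t]%classic); last first.
  by apply/seteqP; split => x /=; rewrite !in_itv/= ltrBlDl lerBrDl.
rewrite !lebesgue_measure_itv/= !lte_fin ltrD2r; case: ifP => // _.
by rewrite -!EFinB; congr (_%:E); ring.
Qed.

Lemma measurable_translate d (t : d.-tuple R) : measurable_fun setT (translate t).
Proof.
apply/measurable_fun_tnthP => i; rewrite /comp.
have -> : (fun z => tnth (translate t z) i) =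
    (fun z : d.-tuple R => tnth t i + tnth z i).
  by apply/funext => z; rewrite tnth_mktuple.
exact: (measurable_funD (measurable_cst (tnth t i)) (measurable_tnth i)).
Qed.

Lemma lebesgue_tuple_translate d (t : d.-tuple R) (A : set (d.-tuple R)) :
  measurable A -> lebesgue_tuple d (translate t @^-1` A) = lebesgue_tuple d A.
Proof.
move=> mA; apply/esym.
apply: (@measure_unique _ R _ (@tuple_boxes d)
  (fun k => tuple_box (fun=> `[- k%:R, k%:R]%classic))
  (measurable_tuple_boxes d) _ _ _ (lebesgue_tuple d)
  (image_measure (lebesgue_tuple d) (measurable_translate t))) => //.
- move=> _ _ [B [mB ->]] [C [mC ->]]; exists (fun i => B i `&` C i); split.
    by move=> i; exact: measurableI.
  apply/seteqP; split => z /=; first by move=> [h1 h2] i; split.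
  by move=> h; split => i; have [] := h i.
- by move=> k; exists (fun=> `[- k%:R, k%:R]%classic); split.
- rewrite -subTset => z _; have [M hM] := window_cover z; exists M => // i /=.
  by rewrite in_itv/= -ler_norml; exact: hM.
- move=> _ [B [mB ->]] /=; rewrite /pushforward lebesgue_tuple_boxE//.
  rewrite (_ : _ @^-1` _ = tuple_box (fun i => (fun x => tnth t i + x) @^-1` B i)).
    rewrite lebesgue_tuple_boxE; last first.
      by move=> i; apply: preimage_measurable => //; exact: measurable_funD.
    apply: eq_bigr => i _; apply/esym; exact: lebesgue_measure_shift.
  by apply/seteqP; split => z h i; have := h i; rewrite /= tnth_mktuple.
move=> k; apply: (eq_ind_r (fun x => x < +oo)%E _ (lebesgue_tuple_boxE _)) => //.
under eq_bigr do rewrite (@lebesgue_measure_itv R)/= lte_fin.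
by case: ifP => _; rewrite -?EFinB prodEFin ltry.
Qed.

Lemma integral_translate d (t : d.-tuple R) (g : d.-tuple R -> \bar R) B :
  measurable_fun setT g -> (forall z, (0 <= g z)%E) -> measurable B ->
  (\int[lebesgue_tuple d]_(y in translate t @^-1` B) g (translate t y) =
   \int[lebesgue_tuple d]_(z in B) g z)%E.
Proof.
move=> mg g0 mB.
transitivity (\int[image_measure (lebesgue_tuple d) (measurable_translate t)]_(z in B) g z)%E.
  rewrite /= ge0_integral_pushforward//; first exact: measurable_translate.
  exact: measurable_funTS.
apply: eq_measure_integral => A mA AB; exact: lebesgue_tuple_translate.
Qed.

Lemma lebesgue_tuple_cube d (a b : R) : a <= b ->
  lebesgue_tuple d (tuple_box (fun=> `[a, b[%classic)) = ((b - a) ^+ d)%:E.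
Proof.
move=> ab; rewrite lebesgue_tuple_boxE//.
under eq_bigr do rewrite (@lebesgue_measure_itv R)/= lte_fin.
case: ltgtP ab => // [ab _|-> _].
  by rewrite -EFinB prodEFin prodr_const card_ord.
by rewrite subrr prodEFin prodr_const card_ord.
Qed.

End lebesgue.

(** * Boxes and dyadic blocks of the lattice *)

Lemma prodr_add1_le {R : realFieldType} n (a : nat -> R) (s : R) :
  (forall i, 0 <= a i) -> \sum_(i < n) a i <= s -> s < 1 ->
  \prod_(i < n) (1 + a i) <= (1 - s)^-1.
Proof.
move=> a0 sn s1.
suff H : \prod_(i < n) (1 + a i) * (1 - \sum_(i < n) a i) <= 1.
  have s0 : 0 < 1 - \sum_(i < n) a i by rewrite subr_gt0 (le_lt_trans sn).
  rewrite -(ler_pdivlMr _ _ s0) in H; apply: (le_trans H).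
  by rewrite mul1r lef_pV2 ?posrE// ?subr_gt0//; lra.
elim: n {sn} => [|n IH]; first by rewrite !big_ord0 subr0 mulr1.
apply: le_trans IH; rewrite !big_ord_recr/= -mulrA ler_wpM2l//.
  by apply: prodr_ge0 => i _; rewrite addr_ge0.
have : 0 <= \sum_(i < n) a i by apply: sumr_ge0.
set S := (\sum_(i < n) a i) => S0; have an := a0 n; nra.
Qed.

Lemma geometric_sum_le {R : realFieldType} n m (K r : R) :
  0 <= K -> 0 <= r < 1 -> \sum_(i < n) K * r ^+ (m + i) <= K * r ^+ m / (1 - r).
Proof.
move=> K0 /andP[r0 r1].
have -> : \sum_(i < n) K * r ^+ (m + i) = K * r ^+ m * \sum_(i < n) r ^+ i.
  by rewrite mulr_sumr; apply: eq_bigr => i _; rewrite exprD mulrA.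
apply: ler_wpM2l; first by rewrite mulr_ge0// exprn_ge0.
rewrite -[leRHS]mul1r ler_pdivlMr ?subr_gt0//.
have := subrX1 r n; have := exprn_ge0 n r0.
set S := \sum_(i < n) _ => rn0 E; nra.
Qed.

Section blocks.
Context {d : nat}.
Local Notation V := (d.-tuple int).

Definition box_site L (k : {ffun 'I_d -> 'I_L.*2.+1}) : V :=
  [tuple (k i)%:Z - L%:Z | i < d].

Definition box L : seq V := map (@box_site L) (enum {ffun 'I_d -> 'I_L.*2.+1}).

Lemma mem_box L v : (forall i, `|tnth v i| <= L)%N -> v \in box L.
Proof.
move=> vL; pose k := [ffun i => inord (absz (tnth v i + L%:Z)) : 'I_L.*2.+1].
apply/mapP; exists k; first by rewrite mem_enum.
apply: eq_from_tnth => i; rewrite tnth_mktuple ffunE.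
by have := vL i; case: (tnth v i) => n nL; rewrite inordK; lia.
Qed.

Hypothesis d_gt0 : (0 < d)%N.

Definition dyadic_site k (f : {ffun 'I_d -> 'I_(2 ^ k)}) : V :=
  [tuple (2 ^ k + f i)%N%:Z | i < d].

(** One sector of an annulus suffices, as only the order [2 ^ (k * d)] of the
    number of sites at distance about [2 ^ k] matters. *)
Definition dyadic_block k : seq V := [seq dyadic_site f | f : {ffun 'I_d -> 'I_(2 ^ k)}].

Lemma size_dyadic_block k : size (dyadic_block k) = ((2 ^ k) ^ d)%N.
Proof. by rewrite size_map -cardE card_ffun !card_ord. Qed.

Lemma dyadic_block_uniq k : uniq (dyadic_block k).
Proof.
rewrite map_inj_uniq ?enum_uniq// => f f' /(congr1 (fun t => tnth t _)) fE.
apply/ffunP => i; have := fE i; rewrite !tnth_mktuple => -[] /addnI.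
exact: val_inj.
Qed.

Lemma dyadic_blockP k (v : V) : v \in dyadic_block k ->
  forall i, exists m : nat, tnth v i = m%:Z /\ (2 ^ k <= m < 2 ^ k.+1)%N.
Proof.
move=> /mapP[f _ ->] i; rewrite tnth_mktuple; exists (2 ^ k + f i)%N; split => //.
by rewrite leq_addr expnS mul2n -addnn ltn_add2l/=.
Qed.

Lemma dyadic_block_disjoint j k (v : V) : j != k ->
  v \in dyadic_block j -> v \notin dyadic_block k.
Proof.
move=> jk vj; apply/negP => vk.
have [m [vm /andP[m1 m2]]] := dyadic_blockP vj (Ordinal d_gt0).
have [m' [vm' /andP[m1' m2']]] := dyadic_blockP vk (Ordinal d_gt0).
have mm' : m = m' by move: vm'; rewrite vm => -[].
subst m'; case: (ltngtP j k) jk => // jk _.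
  by move: m2; rewrite ltnNge (leq_trans _ m1')// leq_pexp2l.
by move: m2'; rewrite ltnNge (leq_trans _ m1)// leq_pexp2l.
Qed.

Lemma dyadic_block_avoids (s : seq V) : exists k0, forall k, (k0 <= k)%N ->
  forall v, v \in s -> v \notin dyadic_block k.
Proof.
elim: s => [|w s [k0 IH]]; first by exists 0%N.
exists (maxn k0 `|tnth w (Ordinal d_gt0)|%N) => k; rewrite geq_max => /andP[k0k wk] v.
rewrite inE => /orP[/eqP ->|]; last exact: IH.
apply/negP => /dyadic_blockP /(_ (Ordinal d_gt0)) [m [wm /andP[km _]]].
move: wk; rewrite wm absz_nat leqNgt => /negP; apply.
by rewrite (leq_trans _ km)// ltn_expl.
Qed.

End blocks.

(** * Null events after the removal of one site *)

Section geometry.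
Context {R : realType} {d : nat}.
Local Notation E := (d.-tuple R).
Local Notation V := (d.-tuple int).

Definition displacement (v : V) (z : E) : E :=
  [tuple tnth z i - (tnth v i)%:~R | i < d].

Lemma euclidean_norm_le (y : E) (r : R) : 0 <= r ->
  (forall i, `|tnth y i| <= r) -> euclidean_norm y <= d%:R * r.
Proof.
move=> r0 yr; have [d0|d0] := posnP d.
  rewrite /euclidean_norm big1 ?sqrtr0 ?mulr_ge0// => i _.
  by have := ltn_ord i; rewrite [X in (_ < X)%N]d0.
rewrite -[leRHS]ger0_norm ?mulr_ge0// -sqrtr_sqr ler_wsqrtr//.
apply: (@le_trans _ _ (\sum_(i < d) r ^+ 2)).
  by apply: ler_sum => i _; rewrite -ler_sqrt ?sqr_ge0// !sqrtr_sqr [leRHS]ger0_norm.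
rewrite sumr_const card_ord -[leLHS]mulr_natl exprMn ler_wpM2r ?sqr_ge0//.
by rewrite -natrX ler_nat -[leqLHS]expn1 leq_pexp2l.
Qed.

Lemma coordinate_le_euclidean_norm (y : E) i : `|tnth y i| <= euclidean_norm y.
Proof.
rewrite -sqrtr_sqr ler_wsqrtr// (bigD1 i)//= lerDl.
by apply: sumr_ge0 => j _; exact: sqr_ge0.
Qed.

Lemma power_tail_gt0 (alpha : R) (y : E) : 0 < power_tail alpha y.
Proof.
rewrite /power_tail; case: eqP => // /eqP y0.
by rewrite lt_min ltr01/= powR_gt0// lt_def y0 sqrtr_ge0.
Qed.

(** This also covers the points near the origin, where the tail is [1]. *)
Lemma power_tail_ge (alpha r : R) (y : E) : 0 <= alpha -> 1 <= r ->
  euclidean_norm y <= r -> r `^ (- alpha) <= power_tail alpha y.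
Proof.
move=> a0 r1 yr; have r0 : 0 < r by rewrite (lt_le_trans ltr01).
have ra : r `^ (- alpha) <= 1.
  by rewrite powRN invf_le1 ?powR_gt0// -(powRr0 r) ler_powR.
rewrite /power_tail; case: eqP => // /eqP y0.
have n0 : 0 < euclidean_norm y by rewrite lt_def y0 sqrtr_ge0.
rewrite le_min ra/= !powRN lef_pV2 ?posrE ?powR_gt0//.
by rewrite ge0_ler_powR// ?nnegrE ltW.
Qed.

Lemma powR_expn (a b : R) j : 0 <= a -> (a ^+ j) `^ b = (a `^ b) ^+ j.
Proof.
move=> a0; rewrite -(powR_mulrn j a0) -(powR_mulrn j (powR_ge0 a b)).
by rewrite -!powRrM mulrC.
Qed.

End geometry.

Section core.
Context {R : realType} {d : nat}.
Hypothesis d_gt0 : (0 < d)%N.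
Local Notation E := (d.-tuple R).
Local Notation V := (d.-tuple int).
Local Notation lam := (@lebesgue_tuple R d).
Variables (mu : probability (labelled V E) R) (G : V -> probability E R).
Hypothesis muG : product_law mu G.
Variables (g0 : E -> R) (alpha c : R).
Hypothesis mg0 : measurable_fun setT g0.
Hypothesis c_gt0 : 0 < c.
Hypothesis alpha_ge0 : 0 <= alpha.
Hypothesis alpha_lt : alpha < 2 * d%:R.
Hypothesis g0_ge : forall y, c * power_tail alpha y <= g0 y.
Let g v z := g0 (displacement v z).
Hypothesis Gg : forall v B, measurable B ->
  (G v B = \int[lam]_(z in B) (g v z)%:E)%E.

Lemma measurable_displacement (v : V) :
  measurable_fun setT (@displacement R d v).
Proof.
rewrite (_ : displacement v = translate [tuple - (tnth v i)%:~R | i < d]).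
  exact: measurable_translate.
apply/funext => z; apply: eq_from_tnth => i; rewrite !tnth_mktuple.
by rewrite addrC.
Qed.

Let mg v : measurable_fun setT (g v).
Proof. exact: (measurableT_comp mg0 (measurable_displacement v)). Qed.

Let g_gt0 v z : 0 < g v z.
Proof. by rewrite (lt_le_trans _ (g0_ge _))// mulr_gt0// power_tail_gt0. Qed.

(** The lower bound on the density, in the form in which it enters the second
    moments. *)
Lemma inverse_density_le v z (r : R) : 1 <= r ->
  (forall i, `|tnth z i - (tnth v i)%:~R| <= r) ->
  (g v z)^-1 <= c^-1 * (d%:R * r) `^ alpha.
Proof.
move=> r1 zv; have r0 : 0 < r by rewrite (lt_le_trans ltr01).
have d1 : (1 : R) <= d%:R by rewrite ler1n.
have dr1 : 1 <= d%:R * r by rewrite -[leLHS]mulr1 ler_pM.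
have dr0 : 0 < d%:R * r by rewrite (lt_le_trans ltr01).
rewrite -[_ `^ alpha]invrK -powRN -invfM lef_pV2 ?posrE ?mulr_gt0 ?powR_gt0//.
apply: le_trans (g0_ge _); rewrite ler_pM2l//; apply: power_tail_ge => //.
apply: euclidean_norm_le; first exact: ltW.
by move=> i; rewrite tnth_mktuple.
Qed.

Lemma second_moment_le v (phi : E -> R) B (H Q L : R) :
  nonneg_measurable phi -> measurable B -> (forall z, phi z <= H * \1_B z) ->
  (lam B <= L%:E)%E -> 0 <= Q -> (forall z, B z -> (g v z)^-1 <= Q) ->
  (\int[lam]_z (phi z ^+ 2 / g v z)%:E <= (H ^+ 2 * Q * L)%:E)%E.
Proof.
move=> [mphi phi0] mB phiB LB Q0 gQ.
have HQ0 : 0 <= H ^+ 2 * Q by rewrite mulr_ge0// sqr_ge0.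
apply: (@le_trans _ _ (\int[lam]_z ((H ^+ 2 * Q)%:E * (\1_B z)%:E))%E).
  apply: ge0_le_integral => //.
  - by move=> z _; rewrite lee_fin divr_ge0 ?sqr_ge0// ltW.
  - apply/measurable_EFinP; apply: measurable_quotient => //.
    exact: measurable_funX.
  - by apply: emeasurable_funM => //; exact/measurable_EFinP.
  - move=> z _; rewrite -EFinM lee_fin.
    have [zB|zB] := pselect (B z); last first.
      have : phi z = 0.
        apply/eqP; rewrite eq_le phi0 andbT (le_trans (phiB z))//.
        by rewrite indicE memNset// mulr0.
      by move=> ->; rewrite expr0n mul0r indicE memNset// mulr0.
    rewrite indicE mem_set// mulr1; have := phiB z; rewrite indicE mem_set// mulr1 => pH.
    apply: ler_pM; rewrite ?sqr_ge0 ?invr_ge0 ?gQ//; first exact: ltW.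
    by rewrite ler_sqr ?nnegrE// (le_trans (phi0 z)).
rewrite ge0_integralZl//; last by apply/measurable_EFinP; exact: measurable_indic.
rewrite integral_indic// setIT [in leRHS]EFinM; apply: lee_wpmul2l => //.
Qed.

Definition dyadic_cube k : set E := tuple_box (fun=> `[2 ^+ k, 2 ^+ k.+1[%classic).

Lemma measurable_dyadic_cube k : measurable (dyadic_cube k).
Proof. by apply: measurable_tuple_box => i; exact: measurable_itv. Qed.

Lemma lebesgue_dyadic_cube k : lam (dyadic_cube k) = ((2 ^+ k) ^+ d)%:E.
Proof.
rewrite lebesgue_tuple_cube; last by rewrite ler_eXn2l// ltr1n.
by congr (_ ^+ _)%:E; rewrite exprS; ring.
Qed.

Definition uniform_density k (z : E) : R := ((2 ^+ k) ^+ d)^-1 * \1_(dyadic_cube k) z.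

Lemma nonneg_measurable_uniform k : nonneg_measurable (uniform_density k).
Proof.
split => [|z]; last by rewrite mulr_ge0// invr_ge0 !exprn_ge0.
apply: measurable_funM => //; apply: measurable_indic; exact: measurable_dyadic_cube.
Qed.

Lemma integral_uniform_density k : (\int[lam]_z (uniform_density k z)%:E = 1)%E.
Proof.
under eq_integral do rewrite EFinM.
rewrite ge0_integralZl//; last first.
  by apply/measurable_EFinP; apply: measurable_indic; exact: measurable_dyadic_cube.
rewrite integral_indic//; last exact: measurable_dyadic_cube.
rewrite setIT; transitivity ((((2 ^+ k) ^+ d : R)^-1)%:E * ((2 ^+ k) ^+ d)%:E)%E.
  by congr (_ * _)%E; exact: lebesgue_dyadic_cube.
by rewrite -EFinM mulVf// !expf_neq0.
Qed.

Let K : R := c^-1 * (d%:R * 4) `^ alpha.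
Let beta : R := 2 `^ alpha.

Let K_ge0 : 0 <= K. Proof. by rewrite mulr_ge0 ?invr_ge0 ?powR_ge0// ltW. Qed.

(** Sites of the block [j] and points of the cubes [j] and [j.+1] are at
    distance at most [4 * 2 ^ j] in each coordinate. Both cubes are needed, as
    a point moves from one scale to the next one. *)
Lemma uniform_second_moment j k v : v \in dyadic_block j -> (j <= k <= j.+1)%N ->
  (\int[lam]_z (uniform_density k z ^+ 2 / g v z)%:E <=
   (K * beta ^+ j / (2 ^+ j) ^+ d)%:E)%E.
Proof.
move=> vj /andP[jk kj].
pose h : R := ((2 ^+ k) ^+ d)^-1.
have p0 : 0 < (2 ^+ k) ^+ d :> R by rewrite !exprn_gt0.
apply: (le_trans (@second_moment_le v _ (dyadic_cube k) h (K * beta ^+ j)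
  ((2 ^+ k) ^+ d) (nonneg_measurable_uniform k) (measurable_dyadic_cube k) _ _ _ _)) => //.
- by rewrite lebesgue_dyadic_cube.
- by rewrite mulr_ge0// exprn_ge0// powR_ge0.
- move=> z zk.
  have -> : K * beta ^+ j = c^-1 * (d%:R * (4 * 2 ^+ j)) `^ alpha.
    rewrite /K /beta -mulrA; congr (_ * _); rewrite mulrA.
    rewrite [in RHS]powRM ?mulr_ge0 ?exprn_ge0//; congr (_ * _).
    by rewrite powR_expn.
  apply: inverse_density_le.
    by rewrite -[leLHS]mulr1 ler_pM// ?exprn_ege1 ?ler1n.
  move=> i; have [m [-> /andP[m1 m2]]] := dyadic_blockP vj i.
  have := zk i; rewrite /= in_itv/= => /andP[z1 z2].
  have M1 : 2 ^+ j <= m%:R :> R by rewrite -natrX ler_nat.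
  have M2 : m%:R <= 2 ^+ j.+1 :> R by rewrite -natrX ler_nat ltnW.
  have Z1 : 2 ^+ j <= tnth z i by rewrite (le_trans _ z1)// ler_eXn2l// ltr1n.
  have Z2 : tnth z i <= 2 ^+ j.+2.
    by rewrite (le_trans (ltW z2))// ler_eXn2l ?ltr1n// ltnS.
  have j0 : 0 < 2 ^+ j :> R by rewrite exprn_gt0.
  rewrite -pmulrn ler_norml; rewrite !exprS in M2 Z2.
  by apply/andP; split; lra.
have fieldE (p x : R) : 0 < p -> p^-1 ^+ 2 * x * p = x / p.
  by move=> p00; field; rewrite gt_eqF.
have x0 : 0 <= K * beta ^+ j by rewrite mulr_ge0// exprn_ge0// powR_ge0.
rewrite lee_fin /h fieldE//; apply: ler_wpM2l => //.
rewrite lef_pV2 ?posrE ?exprn_gt0//.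
by rewrite lerXn2r ?nnegrE ?exprn_ge0// ler_eXn2l// ltr1n.
Qed.

(** The ratio [2 ^ (alpha - 2 * d)] of the geometric series of variances; it
    is less than one exactly when [alpha < 2 * d]. *)
Let rho : R := beta / (2 ^+ d) ^+ 2.

Let rho_ge0 : 0 <= rho.
Proof. by rewrite divr_ge0 ?powR_ge0// !exprn_ge0. Qed.

Let rho_lt1 : rho < 1.
Proof.
rewrite ltr_pdivrMr ?exprn_gt0// mul1r /beta -exprM -powR_mulrn//.
rewrite /powR gt_eqF// ltr_expR ltr_pM2r ?ln_gt0 ?ltr1n//.
by rewrite mulnC natrM.
Qed.

Lemma product_near_one (delta : R) n1 : 0 < delta ->
  exists n0, (n1 <= n0)%N /\ forall n,
    \prod_(i < n) (1 + K * rho ^+ (n0 + i)) <= 1 + delta ^+ 2.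
Proof.
move=> delta0; have d2 : 0 < delta ^+ 2 by rewrite exprn_gt0.
pose t := delta ^+ 2 / (1 + delta ^+ 2).
have t0 : 0 < t by rewrite divr_gt0// addr_gt0.
have K1 : 0 < K + 1 by rewrite ltr_wpDl.
have e0 : 0 < t * (1 - rho) / (K + 1).
  by rewrite divr_gt0// mulr_gt0// subr_gt0.
have /cvgr_lt/(_ _ e0)[N _ hN] : (fun n => rho ^+ n) @ \oo --> (0 : R).
  by apply: cvg_expr; rewrite ger0_norm.
exists (maxn n1 N); split; first exact: leq_maxl.
set n0 := maxn n1 N => n.
have hn0 : K * rho ^+ n0 / (1 - rho) <= t.
  rewrite ler_pdivrMr ?subr_gt0//.
  have /= := hN n0 (leq_maxr n1 N); rewrite ltr_pdivlMr// => /ltW; apply: le_trans; rewrite mulrC; apply: ler_wpM2l.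
    by rewrite exprn_ge0.
  by rewrite lerDl.
apply: le_trans (@prodr_add1_le _ n (fun i => K * rho ^+ (n0 + i)) t _ _ _) _.
- by move=> i; rewrite mulr_ge0// exprn_ge0.
- by apply: le_trans hn0; apply: geometric_sum_le => //; rewrite rho_ge0 rho_lt1.
- by rewrite /t ltr_pdivrMr ?mul1r ?addr_gt0//; lra.
have -> : 1 - t = (1 + delta ^+ 2)^-1 by rewrite /t; field; rewrite gt_eqF// addr_gt0.
by rewrite invrK.
Qed.

Lemma size_dyadic_block_gt0 k : (0 < size (@dyadic_block d k))%N.
Proof. by rewrite size_dyadic_block !expn_gt0. Qed.

Lemma moment_over_size j : K * beta ^+ j / (2 ^+ j) ^+ d / (size (@dyadic_block d j))%:R =
  K * rho ^+ j.
Proof.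
rewrite size_dyadic_block !natrX /rho expr_div_n.
have -> : ((2 ^+ d) ^+ 2) ^+ j = (2 ^+ j) ^+ d * (2 ^+ j) ^+ d :> R.
  by rewrite -!exprM -exprD; congr (_ ^+ _); lia.
by rewrite invfM !mulrA.
Qed.

Lemma points_off_exchange (S : set V) a v (y : labelled V E) :
  ~ S a -> ~ S v -> points_off S (exchange a v y) = points_off S y.
Proof.
move=> Sa Sv; apply/seteqP; split => z [w Sw <-]; rewrite /exchange.
  case: eqVneq => _; first by exists v.
  by case: eqVneq => _; [exists a|exists w].
have [->|wa] := eqVneq w a.
  by exists v => //; rewrite eqxx; case: eqVneq => // ->.
have [->|wv] := eqVneq w v.
  by exists a => //; rewrite eqxx.
by exists w => //; rewrite (negbTE wa) (negbTE wv).
Qed.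

Lemma points_off_update (S : set V) a z (y : labelled V E) :
  S a -> points_off S (update a z y) = points_off S y.
Proof.
move=> Sa; apply/seteqP; split => _ [w Sw <-]; exists w => //; rewrite /update;
  by case: eqVneq => // wa; case: Sw; rewrite wa.
Qed.

Lemma window_outside (S : set V) a M (y : labelled V E) : ~ window M (y a) ->
  (points_off S y : set E) `&` window M = (points_off (a |` S) y : set E) `&` window M.
Proof.
move=> aM; apply/seteqP; split => z [[w Sw <-] zM]; split => //.
  by exists w => // -[wa|//]; apply: aM; rewrite -[a]wa.
by exists w => // Sw'; apply: Sw; right.
Qed.

Section one_label.
Variables (S : set V) (a : V).
Hypotheses (finS : finite_set S) (Sa : ~ S a).

Let blocks_avoid : exists k0, forall k, (k0 <= k)%N -> forall v,
  v \in dyadic_block k -> ~ (a |` S) v.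
Proof.
have /finite_seqP[s sE] := finS.
have [k0 hk] := dyadic_block_avoids d_gt0 (a :: s).
exists k0 => k k0k v vk [va|Sv].
  by have := hk k k0k a (mem_head _ _); rewrite -[a]va vk.
have vs : v \in s by move: Sv; rewrite sE.
by have := hk k k0k v; rewrite inE vs orbT vk => /(_ isT).
Qed.

Let uniform_invisible M n n0 (y : labelled V E) : (M < n)%N ->
  uniform_density (n0 + n) (y a) != 0 -> ~ window M (y a).
Proof.
move=> Mn; rewrite /uniform_density indicE; have [ya _ yM|] := boolP (y a \in _); last first.
  by rewrite mulr0 eqxx.
move: ya; rewrite inE => /(_ (Ordinal d_gt0)); rewrite /= in_itv/= => /andP[y1 _].
have := yM (Ordinal d_gt0); apply/negP; rewrite -ltNge.
rewrite (lt_le_trans _ (ler_norm _))// (lt_le_trans _ y1)// -natrX ltr_nat.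
by rewrite (ltn_trans Mn)// (leq_ltn_trans (leq_addl n0 n))// ltn_expl.
Qed.

Let events_exchange n0 i (A : set (@configuration R d)) v (y : labelled V E) :
  (forall k, (n0 <= k)%N -> forall w, w \in dyadic_block k -> ~ (a |` S) w) ->
  v \in @dyadic_block d (n0 + i) ->
  (points_off S @^-1` A) (exchange a v y) = (points_off S @^-1` A) y.
Proof.
move=> avoid vi; rewrite /preimage/= points_off_exchange// => Sv.
by apply: (avoid _ (leq_addr i n0) v vi); right.
Qed.

(** [deletion_bound] with a first step in the cube at scale [n0] and [M.+1]
    steps, where the window [M] supports the event. The constant does not
    depend on [M], because [product_near_one] holds for all numbers of
    steps. *)
Lemma deletion_comparison (e : R) : 0 < e ->
  exists c' : R, 0 <= c' /\ forall A, local_sets A ->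
    (mu (points_off (a |` S) @^-1` A) <= e%:E + c'%:E * mu (points_off S @^-1` A))%E.
Proof.
move=> e0; have delta0 : 0 < e / 2 by rewrite divr_gt0.
set delta := e / 2 in delta0 *.
have [k0 avoid0] := blocks_avoid.
have [n0 [k0n0 prod1]] := product_near_one k0 delta0.
have avoid k : (n0 <= k)%N -> forall w : V, w \in dyadic_block k -> ~ (a |` S) w.
  by move=> n0k; apply: avoid0; exact: leq_trans n0k.
pose r : R := 2 ^+ n0.+1 + \sum_(i < d) `|(tnth a i)%:~R| + 1.
pose Q := c^-1 * (d%:R * r) `^ alpha.
have Q0 : 0 <= Q by rewrite mulr_ge0 ?invr_ge0 ?powR_ge0// ltW.
pose H : R := ((2 ^+ n0) ^+ d)^-1.
pose c0 := H ^+ 2 * Q * (2 ^+ n0) ^+ d.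
have c00 : 0 <= c0.
  by apply: mulr_ge0; [apply: mulr_ge0; rewrite ?sqr_ge0|rewrite !exprn_ge0].
have hc0 : (\int[lam]_z (uniform_density n0 z ^+ 2 / g a z)%:E <= c0%:E)%E.
  apply: (@second_moment_le a _ (dyadic_cube n0)) => //.
  - exact: nonneg_measurable_uniform.
  - exact: measurable_dyadic_cube.
  - by rewrite lebesgue_dyadic_cube.
  move=> z zn; apply: inverse_density_le; first by rewrite /r lerDr addr_ge0 ?exprn_ge0 ?sumr_ge0.
  move=> i; rewrite (le_trans (ler_normB _ _))// /r -[leLHS]addr0 lerD//.
  have := zn i; rewrite /= in_itv/= => /andP[z1 z2]; apply: lerD.
    by rewrite ger0_norm ?(ltW z2)// (le_trans _ z1)// exprn_ge0.
  by rewrite (bigD1 i)//= lerDl sumr_ge0.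
pose C : R := 1 + delta ^+ 2.
have C0 : 0 <= C by rewrite addr_ge0 ?sqr_ge0.
have Cc0 : 0 <= C * c0 by rewrite mulr_ge0.
pose tau := delta / (C * c0 + 1).
have tau0 : 0 < tau by rewrite divr_gt0// ltr_wpDl.
exists tau^-1; split; first by rewrite invr_ge0 ltW.
move=> A locA; have [mA [M hM]] := local_setsP locA.
pose Ab i : seq V := dyadic_block (n0 + i); pose phi i := uniform_density (n0 + i).
have moment i j v : v \in Ab i -> (n0 + i <= j <= (n0 + i).+1)%N ->
  (\int[lam]_z (uniform_density j z ^+ 2 / g v z)%:E <=
   (K * beta ^+ (n0 + i) / (2 ^+ (n0 + i)) ^+ d)%:E)%E.
  by move=> vi; exact: uniform_second_moment.
have prodE : \prod_(i < M.+1) (1 + K * beta ^+ (n0 + i) / (2 ^+ (n0 + i)) ^+ d /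
    (size (Ab i))%:R) <= C.
  by under eq_bigr do rewrite moment_over_size; exact: prod1.
apply: (le_trans (@deletion_bound R V _ E mu G muG lam g mg g_gt0 Gg a Ab phi
  _ _ _ _ _ _ (points_off S @^-1` A) (points_off (a |` S) @^-1` A) M.+1 _ _ _ _ _
  delta tau c0 C
  (fun i => K * beta ^+ (n0 + i) / (2 ^+ (n0 + i)) ^+ d)
  (fun i => K * beta ^+ (n0 + i) / (2 ^+ (n0 + i)) ^+ d)
  _ _ _ _ _ _ _ _ _)) => //.
- by move=> i; apply/negP => /(avoid _ (leq_addr i n0)); apply; left.
- by move=> i j v ij; apply: dyadic_block_disjoint => //; rewrite eqn_add2l.
- by move=> i; exact: size_dyadic_block_gt0.
- by move=> i; exact: dyadic_block_uniq.
- by move=> i; exact: nonneg_measurable_uniform.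
- by move=> i; exact: integral_uniform_density.
- by apply: preimage_measurable => //; exact: measurable_points_off.
- by apply: preimage_measurable => //; exact: measurable_points_off.
- by move=> i v y; exact: events_exchange.
- by move=> y z; rewrite /preimage/= points_off_update//; left.
- move=> y /(uniform_invisible (leqnn _)) yM; apply/propext; rewrite /preimage/=.
  by rewrite (hM M (leqnn M)) (window_outside S yM) -(hM M (leqnn M)).
- by rewrite /phi addn0 integral_uniform_density.
- by rewrite /phi addn0.
- by move=> i v _ vi; apply: moment => //; rewrite addnS leqnSn leqnn.
- by move=> i v _ vi; apply: moment => //; rewrite leqnn leqnSn.
rewrite -addeA [X in (_ + X)%E]addeC addeA leeD2r// -EFinD lee_fin.
rewrite [leRHS](splitr e) -/delta lerD2r /tau mulrAC ler_pdivrMr ?ltr_wpDl//.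
by apply: ler_wpM2l; [exact: ltW|rewrite lerDl].
Qed.

(** On this set the density [g a] is bounded, hence square integrable against
    [1 / g v] for all [v]; the sets exhaust the space. *)
Let bounded_part (N : nat) : set E := window N `&` [set z | g a z <= N%:R].

Let measurable_bounded_part N : measurable (bounded_part N).
Proof.
apply: measurableI; first exact: measurable_window.
rewrite (_ : [set _ | _] = g a @^-1` `]-oo, N%:R]%classic).
  by apply: preimage_measurable; [exact: mg|exact: measurable_itv].
by apply/seteqP; split => z /=; rewrite in_itv.
Qed.

Let measurable_bounded_event N :
  measurable ((fun y : labelled V E => y a) @^-1` bounded_part N).
Proof.
by apply: preimage_measurable => //; exact: measurable_coordinate.
Qed.

Lemma lebesgue_window_le N : (lam (window N) <= ((2 * N%:R + 1) ^+ d)%:E)%E.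
Proof.
have -> : (2 * N%:R + 1 : R) = (N%:R + 1) - (- N%:R) by ring.
have N0 : (0 : R) <= N%:R by [].
rewrite -lebesgue_tuple_cube; last by lra.
apply: le_measure; rewrite ?inE; first exact: measurable_window.
  by apply: measurable_tuple_box => i; exact: measurable_itv.
move=> z zN i; have := zN i; rewrite /= in_itv/= ler_norml => /andP[-> h].
by rewrite (le_lt_trans h)// ltrDl.
Qed.

(** [insertion_bound] with the restriction of [g a] to [bounded_part N] as
    first density. Its ratio to [g a] is an indicator, so the weighted
    integral is the probability of an event. The first block has a different
    moment bound [c0], which costs a factor [1 + c0]. *)
Lemma insertion_comparison (N : nat) (e : R) : 0 < e ->
  exists c' : R, 0 <= c' /\ forall A, local_sets A ->
    (mu (points_off S @^-1` A `&` (fun y => y a) @^-1` bounded_part N) <=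
      e%:E + c'%:E * mu (points_off (a |` S) @^-1` A))%E.
Proof.
move=> e0; have delta0 : 0 < e / 2 by rewrite divr_gt0.
set delta := e / 2 in delta0 *.
have [k0 avoid0] := blocks_avoid.
have [n0 [k0n0 prod1]] := product_near_one k0 delta0.
have avoid k : (n0 <= k)%N -> forall w : V, w \in dyadic_block k -> ~ (a |` S) w.
  by move=> n0k; apply: avoid0; exact: leq_trans n0k.
pose r : R := 2 ^+ n0.+1 + N%:R + 1.
pose Q := c^-1 * (d%:R * r) `^ alpha.
have Q0 : 0 <= Q by rewrite mulr_ge0 ?invr_ge0 ?powR_ge0// ltW.
pose L : R := (2 * N%:R + 1) ^+ d.
pose c0 := N%:R ^+ 2 * Q * L.
have c00 : 0 <= c0.
  apply: mulr_ge0; [apply: mulr_ge0; rewrite ?sqr_ge0//|].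
  by rewrite exprn_ge0// addr_ge0// mulr_ge0.
pose phi0 z : R := g a z * \1_(bounded_part N) z.
have dphi0 : nonneg_measurable phi0.
  split => [|z]; first by apply: measurable_funM => //; exact: measurable_indic.
  by rewrite mulr_ge0// ltW.
have phi0N z : phi0 z <= N%:R * \1_(window N) z.
  rewrite /phi0 !indicE; have [|_] := boolP (z \in bounded_part N); last first.
    by rewrite mulr0 mulr_ge0.
  by rewrite inE => -[zN gz]; rewrite (mem_set zN) !mulr1.
have hc0 v : v \in @dyadic_block d n0 ->
    (\int[lam]_z (phi0 z ^+ 2 / g v z)%:E <= c0%:E)%E.
  move=> vn; apply: (@second_moment_le v _ (window N)) => //.
  - exact: measurable_window.
  - exact: lebesgue_window_le.
  move=> z zN; apply: inverse_density_le; first by rewrite /r lerDr addr_ge0 ?exprn_ge0.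
  move=> i; rewrite (le_trans (ler_normB _ _))// /r -[leLHS]addr0 lerD//.
  rewrite addrC lerD//; have [m [-> /andP[_ m2]]] := dyadic_blockP vn i.
  by rewrite -pmulrn ger0_norm// -natrX ler_nat ltnW.
have intphi0 : (\int[lam]_z (phi0 z)%:E = G a (bounded_part N))%E.
  rewrite Gg// [RHS]integral_mkcond; apply: eq_integral => z _.
  rewrite patchE /phi0 indicE; case: ifP => _; first by rewrite mulr1.
  by rewrite mulr0.
pose M0 := fine (G a (bounded_part N)).
have GM0 : G a (bounded_part N) = M0%:E by rewrite fineK// fin_num_measure.
have M01 : M0 <= 1 by rewrite -lee_fin -GM0 probability_le1.
pose ci i : R := K * beta ^+ (n0 + i) / (2 ^+ (n0 + i)) ^+ d.
have ci0 i : 0 <= ci i.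
  by rewrite /ci divr_ge0// ?exprn_ge0// mulr_ge0// exprn_ge0// powR_ge0.
pose ci' i := if i is 0%N then c0 else ci i.
pose C : R := (1 + c0) * (1 + delta ^+ 2).
have C0 : 0 <= C by rewrite mulr_ge0 ?addr_ge0// sqr_ge0.
pose tau := delta / (C + 1).
have tau0 : 0 < tau by rewrite divr_gt0// ltr_wpDl.
exists tau^-1; split; first by rewrite invr_ge0 ltW.
move=> A locA; have [mA [M hM]] := local_setsP locA.
pose Ab i : seq V := dyadic_block (n0 + i).
pose phi i := if i is 0%N then phi0 else uniform_density (n0 + i).
have moment i j v : v \in Ab i -> (n0 + i <= j <= (n0 + i).+1)%N ->
  (\int[lam]_z (uniform_density j z ^+ 2 / g v z)%:E <= (ci i)%:E)%E.
  by move=> vi; exact: uniform_second_moment.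
have prodE : \prod_(i < M.+1) (1 + ci i / (size (Ab i))%:R) <= 1 + delta ^+ 2.
  by under eq_bigr do rewrite moment_over_size; exact: prod1.
have prodC : \prod_(i < M.+1) (1 ^+ 2 + ci' i / (size (Ab i))%:R) <= C.
  have s1 i : 1 <= (size (Ab i))%:R :> R by rewrite ler1n size_dyadic_block_gt0.
  rewrite /C big_ord_recl; apply: ler_pM => //.
  - by rewrite expr1n addr_ge0// divr_ge0.
  - by apply: prodr_ge0 => i _; rewrite expr1n addr_ge0// divr_ge0//= ci0.
  - rewrite expr1n lerD2l/= ler_pdivrMr ?(lt_le_trans ltr01)//.
    by rewrite -[leLHS]mulr1 ler_wpM2l.
  apply: le_trans prodE; rewrite [leRHS]big_ord_recl/=.
  have p0 : 0 <= \prod_(i < M) (1 + ci (lift ord0 i) / (size (Ab (lift ord0 i)))%:R).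
    by apply: prodr_ge0 => i _; rewrite addr_ge0// divr_ge0.
  under eq_bigr do rewrite expr1n; rewrite -[leLHS]mul1r ler_wpM2r//.
  by rewrite lerDl divr_ge0.
have ratioE y : ratio g a phi0 y = \1_((fun y => y a) @^-1` bounded_part N) y.
  rewrite /ratio /phi0 mulrAC divff ?gt_eqF// mul1r !indicE.
  by congr ((nat_of_bool _)%:R); apply/idP/idP; rewrite !inE.
have mS X : measurable (points_off X @^-1` A : set (labelled V E)).
  by apply: preimage_measurable => //; exact: measurable_points_off.
have -> : mu (points_off S @^-1` A `&` (fun y => y a) @^-1` bounded_part N) =
    (\int[mu]_y (\1_(points_off S @^-1` A) y * ratio g a (phi 0%N) y)%:E)%E.
  have hI y : (\1_(points_off S @^-1` A) y * ratio g a (phi 0%N) y)%:E =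
      (\1_(points_off S @^-1` A `&` (fun y => y a) @^-1` bounded_part N) y)%:E.
    by rewrite /phi ratioE indicI.
  under eq_integral do rewrite hI.
  by rewrite integral_indic ?setIT//; exact: measurableI.
apply: (le_trans (@insertion_bound R V _ E mu G muG lam g mg g_gt0 Gg a Ab phi
  _ _ _ _ _ _ (points_off S @^-1` A) (points_off (a |` S) @^-1` A) M.+1 _ _ _ _ _
  delta tau M0 C (fun=> 1) ci ci' _ _ _ _ _ _ _ _ _)) => //.
- by move=> i; apply/negP => /(avoid _ (leq_addr i n0)); apply; left.
- by move=> i j v ij; apply: dyadic_block_disjoint => //; rewrite eqn_add2l.
- by move=> i; exact: size_dyadic_block_gt0.
- by move=> i; exact: dyadic_block_uniq.
- by case=> [|i] //; exact: nonneg_measurable_uniform.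
- by move=> i; exact: integral_uniform_density.
- by move=> i v y; exact: events_exchange.
- by move=> y z; rewrite /preimage/= points_off_update//; left.
- move=> y /(uniform_invisible (leqnn _)) yM; apply/propext; rewrite /preimage/=.
  by rewrite (hM M (leqnn M)) (window_outside S yM) -(hM M (leqnn M)).
- by rewrite /phi intphi0.
- by case=> [|i] _ /=; rewrite ?intphi0 ?GM0 ?lee_fin// integral_uniform_density.
- by move=> i v _ vi; apply: moment => //; rewrite addnS leqnSn leqnn.
- move=> [|i] v _ vi; first by apply: hc0; move: vi; rewrite /Ab addn0.
  by apply: moment => //; rewrite leqnn leqnSn.
rewrite -addeA [X in (_ + X)%E]addeC addeA leeD2r// -EFinD lee_fin.
rewrite [leRHS](splitr e) -/delta lerD//.
  rewrite /tau mulrAC ler_pdivrMr ?ltr_wpDl//.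
  by apply: ler_wpM2l; [exact: ltW|rewrite lerDl].
by rewrite -[leRHS]mulr1 ler_wpM2l// ltW.
Qed.

Lemma deletion_null A : measurable A ->
  mu (points_off S @^-1` A) = 0%E -> mu (points_off (a |` S) @^-1` A) = 0%E.
Proof.
move=> mA A0; apply/eqP; rewrite eq_le measure_ge0 andbT.
apply/lee_addgt0Pr => e e0; rewrite add0e.
have [c' [c'0 hc']] := deletion_comparison e0.
have := @le_measure_approximation _ _ R (@local_sets R d) _ local_sets0
  local_setsC local_setsU
  (image_measure mu (measurable_points_off (a |` S)))
  (image_measure mu (measurable_points_off S)) e c' _ _ c'0 hc' A
  (measurable_local_sets mA).
rewrite /= /pushforward A0 mule0 adde0; apply.
- by move=> B [].
- by rewrite preimage_setT (le_lt_trans (probability_le1 _ _))// ltry.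
- by rewrite preimage_setT (le_lt_trans (probability_le1 _ _))// ltry.
Qed.

Lemma insertion_null A : measurable A ->
  mu (points_off (a |` S) @^-1` A) = 0%E -> mu (points_off S @^-1` A) = 0%E.
Proof.
move=> mA A0.
have mS : measurable (points_off S @^-1` A : set (labelled V E)).
  by apply: preimage_measurable => //; exact: measurable_points_off.
have null N : mu (points_off S @^-1` A `&` (fun y => y a) @^-1` bounded_part N) = 0%E.
  apply/eqP; rewrite eq_le measure_ge0 andbT.
  apply/lee_addgt0Pr => e e0; rewrite add0e.
  have [c' [c'0 hc']] := insertion_comparison N e0.
  have := @le_measure_approximation _ _ R (@local_sets R d) _ local_sets0
    local_setsC local_setsU
    (image_measure (mrestr mu (measurable_bounded_event N)) (measurable_points_off S))
    (image_measure mu (measurable_points_off (a |` S))) e c' _ _ c'0 hc' A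
    (measurable_local_sets mA).
  rewrite /= /pushforward A0 mule0 adde0; apply.
  - by move=> B [].
  - rewrite preimage_setT /mrestr setTI.
    by rewrite (le_lt_trans (probability_le1 _ _))// ltry.
  - by rewrite preimage_setT (le_lt_trans (probability_le1 _ _))// ltry.
apply: (measure_negligible mS).
rewrite (_ : points_off S @^-1` A = \bigcup_N
  (points_off S @^-1` A `&` (fun y => y a) @^-1` bounded_part N)).
  apply: negligible_bigcup => N; apply/negligibleP => //.
    exact: measurableI.
  exact: null.
apply/seteqP; split => y; last by move=> [N _ []].
move=> yA; have [M1 hM1] := window_cover (y a).
exists (maxn M1 (Num.truncn (g a (y a))).+1) => //; split => //; split.
  by move: hM1; apply: windowS; exact: leq_maxl.
rewrite /= (le_trans (ltW (truncnS_gt _)))// ler_nat; exact: leq_maxr.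
Qed.

End one_label.

End core.

(** * Local finiteness of the perturbed lattice *)

Section joint.
Context {R : realType} {disp : measure_display} {Omega : measurableType disp}.
Variable P : probability Omega R.
Context {V : countType} {dE : measure_display} {E : measurableType dE}.
Variable Z : V -> {RV P >-> E}.

Definition joint (w : Omega) : labelled V E := fun v => Z v w.

Lemma measurable_joint : measurable_fun setT joint.
Proof. by apply: measurable_to_labelled => v; exact: measurable_funPT. Qed.

HB.instance Definition _ := isMeasurableFun.Build _ _ _ _ joint measurable_joint.

Definition joint_law : probability (labelled V E) R := distribution P joint.

Lemma joint_law_product : mutually_independent Z ->
  product_law joint_law (fun v => distribution P (Z v)).
Proof.
move=> indep s B us mB; rewrite /joint_law /distribution /pushforward.
by rewrite -(indep s B us mB).
Qed.

End joint.

Section local_finiteness.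
Context {R : realType} {d : nat} {disp : measure_display} {Omega : measurableType disp}.
Variable P : probability Omega R.
Local Notation E := (d.-tuple R).
Local Notation V := (d.-tuple int).
Variables T : V -> {RV P >-> E}.
Hypothesis identical : forall v B, measurable B ->
  distribution P (T v) B = distribution P (T [tuple 0 | i < d]) B.

Definition site_finite (y : labelled V E) :=
  forall N, finite_set [set v | window N (y v)].

Lemma finite_bounded_sites (N : nat) :
  finite_set [set c : V | forall i, (`|tnth c i| <= N)%N].
Proof.
apply: (@sub_finite_set _ _ [set` box N]) => [c cN|]; first exact: mem_box.
exact: finite_seq.
Qed.

Lemma dyadic_cell_window m (c : V) : exists N, @dyadic_cell R d m c `<=` window N.
Proof.
exists (\sum_(i < d) `|tnth c i|%N).+1 => z zc i.
have /(congr1 (fun t => tnth t i)) := zc; rewrite tnth_mktuple => fE.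
have := floor_itv (2 ^+ m * tnth z i); rewrite fE => /andP[h1 h2].
apply: (@le_trans _ _ `|2 ^+ m * tnth z i|).
  rewrite normrM ler_peMl// ger0_norm ?exprn_ge0// exprn_ege1//; lra.
apply: (@le_trans _ _ (`|tnth c i|%N%:R + 1)).
  rewrite intrD in h2; rewrite ler_norml natr_absz intr_norm.
  have := ler_norm ((tnth c i)%:~R : R); have := ler_norm (- (tnth c i)%:~R : R).
  by rewrite normrN => ? ?; apply/andP; split; lra.
by rewrite natr1 ler_nat ltnS (bigD1 i)//= leq_addr.
Qed.

Lemma window_cells N : exists s : seq V,
  @window R d N `<=` \bigcup_(c in [set` s]) dyadic_cell 0 c.
Proof.
have /finite_seqP[s sE] := finite_bounded_sites N.+1.
exists s => z zN; exists (dyadic_index 0 z) => //; rewrite -sE => i.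
rewrite tnth_mktuple expr0 mul1r.
have /andP[h1 h2] := floor_itv (tnth z i).
have := zN i; rewrite ler_norml => /andP[z1 z2].
rewrite intrD in h2.
have k1 : - (N.+1%:Z)%:~R <= (Num.floor (tnth z i))%:~R :> R.
  by rewrite -pmulrn -natr1; lra.
have k2 : (Num.floor (tnth z i))%:~R <= (N.+1%:Z)%:~R :> R.
  by rewrite -pmulrn -natr1; lra.
by move: k1 k2; rewrite -intrN !ler_int; lia.
Qed.

Lemma dyadic_index0_shift (v : V) (t : E) :
  dyadic_index 0 (lattice_shift v t) =
  [tuple tnth v i + tnth (dyadic_index 0 t) i | i < d].
Proof.
apply: eq_from_tnth => i; rewrite !tnth_mktuple !expr0 !mul1r.
by apply: floor_def; have /andP[h1 h2] := floor_itv (tnth t i);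
  rewrite !intrD in h2 *; apply/andP; split; lra.
Qed.

(** The expected number of points in a unit cell [c] is the sum over [v] of
    the probabilities that [T 0] is in the cell [c - v]. These cells are
    disjoint, so the sum is at most one, and the first Borel-Cantelli lemma
    applies. *)
Lemma ae_finite_cell (c : V) : P.-negligible (~` [set w |
  finite_set [set v | dyadic_cell 0 c (lattice_shift v (T v w))]]).
Proof.
pose shifted v : V := [tuple tnth c i - tnth v i | i < d].
have cellE v w : dyadic_cell 0 c (lattice_shift v (T v w)) <->
    dyadic_cell 0 (shifted v) (T v w).
  rewrite /dyadic_cell /= dyadic_index0_shift; split => h.
    apply: eq_from_tnth => i; have := congr1 (fun t => tnth t i) h.
    by rewrite !tnth_mktuple => <-; rewrite addrC addKr.
  by rewrite h; apply: eq_from_tnth => i; rewrite !tnth_mktuple addrC subrK.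
pose F n := if @pickle_inv V n is Some v
  then (T v) @^-1` dyadic_cell 0 (shifted v) else set0.
pose D n := if @pickle_inv V n is Some v
  then dyadic_cell 0 (shifted v) else set0 : set E.
have mD n : measurable (D n).
  by rewrite /D; case: pickle_inv => // v; exact: measurable_dyadic_cell.
have mF n : measurable (F n).
  rewrite /F; case: pickle_inv => // v.
  by apply: preimage_measurable => //; exact: measurable_dyadic_cell.
have FD n : P (F n) = distribution P (T [tuple 0 | i < d]) (D n).
  rewrite /F /D; case: pickle_inv => [v|]; last by rewrite !measure0.
  by rewrite -(identical v)//; exact: measurable_dyadic_cell.
have tD : trivIset setT D.
  apply/trivIsetP => i j _ _ ij; rewrite /D.
  case vE : (pickle_inv i) => [v|]; last by rewrite set0I.
  case wE : (pickle_inv j) => [w|]; last by rewrite setI0.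
  apply/seteqP; split => // z [zv zw]; move/eqP: ij; apply.
  have h : shifted v = shifted w := etrans (esym zv) zw.
  have vw : v = w.
    apply: eq_from_tnth => l; have := congr1 (fun t => tnth t l) h.
    by rewrite !tnth_mktuple => /addrI /oppr_inj.
  have := @pickle_invK V i; have := @pickle_invK V j.
  by rewrite /ocancel vE wE /= vw => -> ->.
have sumF : (\sum_(0 <= n <oo) P (F n) < +oo)%E.
  under eq_eseriesr do rewrite FD.
  rewrite [X in (X < _)%E](_ : _ =
      distribution P (T [tuple 0 | i < d]) (\bigcup_n D n)); last first.
    rewrite measure_bigcup//.
    by apply: eq_eseriesl => n; rewrite in_setT.
  by rewrite (le_lt_trans (probability_le1 _ _)) ?ltry//; exact: bigcupT_measurable.
have lim0 := lim_sup_set_cvg0 mF sumF.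
exists (lim_sup_set F); split => //.
  apply: bigcapT_measurable => n; apply: bigcup_measurable => k _; exact: mF.
move=> w /= nfin n _.
apply: contrapT => h; apply: nfin.
apply: (@sub_finite_set _ _ [set v | (pickle v < n)%N]).
  move=> v /cellE vc; apply: contrapT => /negP; rewrite -leqNgt => nv.
  by apply: h; exists (pickle v) => //; rewrite /F pickleK_inv.
rewrite (_ : [set v | _] = pickle @^-1` `I_n)//.
apply: finite_preimage => //; move=> v v1 _ _; exact: (pcan_inj pickleK).
Qed.

Lemma ae_site_finite : P.-negligible (~` [set w |
  site_finite (fun v => lattice_shift v (T v w))]).
Proof.
pose Fin c := [set w | finite_set [set v | dyadic_cell 0 c (lattice_shift v (T v w))]].
have neg : P.-negligible (\bigcup_n
    (if unpickle n is Some c then ~` Fin c else set0)).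
  apply: negligible_bigcup => n; case: unpickle => [c|]; first exact: ae_finite_cell.
  exact: negligible_set0.
apply: negligibleS neg => w nfin; apply: contrapT => h; apply: nfin => N.
have [s sN] := window_cells N.
apply: (@sub_finite_set _ _ (\bigcup_(c in [set` s])
  [set v | dyadic_cell 0 c (lattice_shift v (T v w))])).
  by move=> v /sN[c cs vc]; exists c.
apply: bigcup_finite; first by apply/finite_seqP; exists s.
move=> c _; apply: contrapT => nc; apply: h; exists (pickle c) => //.
by rewrite pickleK.
Qed.

Lemma points_off_locally_finite (S : set V) (y : labelled V E) :
  site_finite y -> locally_finite (points_off S y).
Proof.
move=> yfin N; apply: (@sub_finite_set _ _ (y @` [set v | window N (y v)])).
  by move=> z [[v Sv <-] vN]; exists v.
exact: finite_image.
Qed.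

(** Only finitely many sites have their point in [B], and the removal of these
    sites is the same as the removal of [B]. *)
Lemma points_off_remove_bounded (B : set E) N (y : labelled V E) :
  site_finite y -> B `<=` window N ->
  exists s : seq V, (points_off set0 y : set E) `\` B = points_off [set` s] y.
Proof.
move=> yfin BN.
have /finite_seqP[s sE] : finite_set [set v | B (y v)].
  by apply: sub_finite_set (yfin N) => v /BN.
exists s; apply/seteqP; split.
  by move=> z [[v _ <-] nB]; exists v => //; rewrite -sE.
by move=> z [v vs <-]; split; [exists v|move=> vB; apply: vs; rewrite -sE].
Qed.

End local_finiteness.

(** * Heavy tails: tolerance of deletions and insertions *)

Definition compose_RV {R : realType} {d0 d1 d2 : measure_display}
    {Omega : measurableType d0} {P : probability Omega R}
    {T1 : measurableType d1} {T2 : measurableType d2}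
    (f : T1 -> T2) (mf : measurable_fun setT f) (X : {RV P >-> T1}) :
    {RV P >-> T2} :=
  let F := f \o X in
  HB.pack F (isMeasurableFun.Build _ _ _ _ F
    (measurableT_comp mf (measurable_funPT X))).

Lemma compose_RV_independent {R : realType} {d0 d1 d2 : measure_display}
    {Omega : measurableType d0} {P : probability Omega R}
    {T1 : measurableType d1} {T2 : measurableType d2} {I : eqType}
    (f : I -> T1 -> T2) (mf : forall i, measurable_fun setT (f i))
    (X : I -> {RV P >-> T1}) :
  mutually_independent X -> mutually_independent (fun i => compose_RV (mf i) (X i)).
Proof.
move=> indep s B us mB; apply: (indep s (fun i => f i @^-1` B i)) => // i.
exact: preimage_measurable.
Qed.

Lemma eq_indic {R : pzRingType} {T1 T2 : Type} (A : set T1) (B : set T2) x y :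
  (A x <-> B y) -> \1_A x = \1_B y :> R.
Proof.
move=> AB; rewrite !indicE; have [Ax|Ax] := pselect (A x).
  by rewrite !mem_set//; exact/AB.
by rewrite !memNset// => /AB.
Qed.

Lemma integral_indicT {R : realType} {d1 : measure_display} {T : measurableType d1}
    (m : {measure set T -> \bar R}) (B : set T) :
  measurable B -> (\int[m]_x (\1_B x)%:E = m B)%E.
Proof. by move=> mB; rewrite integral_indic// setIT. Qed.

Section lattice_shift.
Context {R : realType} {d : nat}.
Local Notation E := (d.-tuple R).
Local Notation V := (d.-tuple int).

Lemma lattice_shiftE (v : V) :
  lattice_shift v = translate [tuple (tnth v i)%:~R : R | i < d].
Proof.
by apply/funext => t; apply: eq_from_tnth => i; rewrite !tnth_mktuple.
Qed.

Lemma measurable_lattice_shift (v : V) :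
  measurable_fun setT (lattice_shift v : E -> E).
Proof. by rewrite lattice_shiftE; exact: measurable_translate. Qed.

Lemma displacement_shift (v : V) (t : E) : displacement v (lattice_shift v t) = t.
Proof. by apply: eq_from_tnth => i; rewrite !tnth_mktuple addrC addKr. Qed.

End lattice_shift.

Section heavy_tail.
Context {R : realType} {d : nat}.
Hypothesis d_gt0 : (0 < d)%N.
Local Notation E := (d.-tuple R).
Local Notation V := (d.-tuple int).
Local Notation lam := (@lebesgue_tuple R d).
Local Notation config := (@configuration R d).
Context {disp : measure_display} {Omega : measurableType disp}.
Variables (P : probability Omega R) (Y : V -> {RV P >-> E}) (g : E -> R).
Hypotheses (Y_indep : mutually_independent Y).
Hypothesis Y_density : forall x, has_density (Y x) g.
Variables alpha c : R.
Hypothesis c_gt0 : 0 < c.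
Hypothesis alpha_ge0 : 0 <= alpha.
Hypothesis alpha_lt : alpha < 2 * d%:R.
Hypothesis g_ge : forall y, c * power_tail alpha y <= g y.

Let Z v : {RV P >-> E} := compose_RV (measurable_lattice_shift v) (Y v).
Let mu := joint_law Z.
Let G v : probability E R := distribution P (Z v).
Let o : V := [tuple 0 | i < d].
Let mg : measurable_fun setT g. Proof. by case: (Y_density o). Qed.
Let g0 y : 0 <= g y. Proof. by case: (Y_density o). Qed.

Let muG : product_law mu G.
Proof. exact/joint_law_product/compose_RV_independent. Qed.

Let mgd v : measurable_fun setT (fun z => g (displacement v z)).
Proof. exact: (measurableT_comp mg (measurable_displacement v)). Qed.

Let Gg v B : measurable B ->
  (G v B = \int[lam]_(z in B) (g (displacement v z))%:E)%E.
Proof.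
move=> mB; have [_ _ Yg] := Y_density v.
transitivity (distribution P (Y v) (lattice_shift v @^-1` B)) => //.
rewrite Yg; last by apply: preimage_measurable => //; exact: measurable_lattice_shift.
rewrite -(@integral_translate _ _ [tuple (tnth v i)%:~R | i < d]
  (fun z => (g (displacement v z))%:E)) => [||z|]; last 3 first.
- by apply/measurable_EFinP; exact: mgd.
- by rewrite lee_fin.
- by [].
rewrite -lattice_shiftE; apply: eq_integral => t _.
by rewrite displacement_shift.
Qed.

Let null (S : set V) A := mu (points_off S @^-1` A) = 0%E.

Let lattice_points0 w : perturbed_lattice Y w = points_off set0 (joint Z w).
Proof. by rewrite /points_off setC0. Qed.

(** Remove the sites of [S] one at a time. *)
Lemma null_points_off S A : finite_set S -> measurable A ->
  null S A <-> null set0 A.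
Proof.
move=> /finite_seqP[s ->] mA; elim: s => [|a s IH]; first by rewrite set_nil.
have -> : [set` a :: s] = a |` [set` s].
  apply/seteqP; split => v /=; rewrite inE.
    by case/orP => [/eqP ->|]; [left|right].
  by case=> [->|->]; rewrite ?eqxx ?orbT.
rewrite -IH; have [as_|as_] := boolP (a \in s).
  by rewrite setUidr// => v ->.
have nas : ~ [set` s] a by rewrite /=; exact/negP.
have fs : finite_set [set` s] by apply/finite_seqP; exists s.
split; first exact: (insertion_null d_gt0 muG mg c_gt0 alpha_ge0 alpha_lt g_ge Gg fs nas).
exact: (deletion_null d_gt0 muG mg c_gt0 alpha_ge0 alpha_lt g_ge Gg fs nas).
Qed.

Let measurable_event S (A : set config) : measurable A ->
  measurable ((fun w => points_off S (joint Z w)) @^-1` A).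
Proof.
move=> mA; apply: preimage_measurable => //.
exact: (measurableT_comp (measurable_points_off S) (measurable_joint Z)).
Qed.

Let nullE S A : measurable A ->
  P.-negligible ((fun w => points_off S (joint Z w)) @^-1` A) <-> null S A.
Proof. by move=> mA; apply: negligibleP; exact: measurable_event. Qed.

Lemma finite_deletion_equivalence S : finite_set S ->
  law_dominated P (perturbed_lattice Y) P (perturbed_lattice_off S Y) /\
  law_dominated P (perturbed_lattice_off S Y) P (perturbed_lattice Y).
Proof.
move=> fS; have -> : perturbed_lattice Y = fun w => points_off set0 (joint Z w).
  by apply/funext => w; exact: lattice_points0.
by split => A mA /(nullE _ mA) h; apply/(nullE _ mA)/(null_points_off fS mA).
Qed.

(** If the deletion of the points has an event [A], so has the removal of some
    finite union of dyadic cells. There are countably many such unions, and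
    for each one the event is null for the perturbed lattice, because there
    the removal is that of one of countably many finite sets of sites. *)
Lemma heavy_tail_deletion_tolerant k : deletion_tolerant P k (perturbed_lattice Y).
Proof.
move=> disp' Omega' P' Pi' U same _ A mA.
have -> : perturbed_lattice Y = fun w => points_off set0 (joint Z w).
  by apply/funext => w; exact: lattice_points0.
move=> /(nullE _ mA) A0.
have sameE B : measurable B -> P' (Pi' @^-1` B) = mu (points_off set0 @^-1` B).
  move=> mB; transitivity (pushforward P (perturbed_lattice Y) B).
    exact: same.
  rewrite /pushforward; congr (P _).
  by apply/seteqP; split => w /=; rewrite lattice_points0.
have sitefin : P.-negligible (~` [set w | site_finite (joint Z w)]).
  apply: ae_site_finite => v B mB.
  by have [_ _ ->] := Y_density v => //; have [_ _ ->] := Y_density o.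
pose cells m (cs : k.-tuple V) : set E :=
  \bigcup_(i in [set: 'I_k]) dyadic_cell m (tnth cs i).
have mcells m cs : measurable (cells m cs).
  by apply: fin_bigcup_measurable => // i _; exact: measurable_dyadic_cell.
have window_of m cs : exists N, cells m cs `<=` window N.
  have /choice[N hN] : forall i, exists N, @dyadic_cell R d m (tnth cs i) `<=` window N.
    by move=> i; exact: dyadic_cell_window.
  exists (\max_(i < k) N i)%N => z [i _ /hN]; apply: windowS.
  exact: leq_bigmax.
pose removed m cs : set config := (fun S : config => ((S : set E) `&` ~` cells m cs : config)) @^-1` A.
have mremoved m cs : measurable (removed m cs).
  by apply: preimage_measurable => //; apply: measurable_restriction; exact: measurableC.
have removed0 m cs : P' (Pi' @^-1` removed m cs) = 0%E.
  rewrite sameE//; apply/(nullE set0 (mremoved m cs)).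
  have neg : P.-negligible (\bigcup_n (if unpickle n is Some s
      then (fun w => points_off [set` (s : seq V)] (joint Z w)) @^-1` A else set0)).
    apply: negligible_bigcup => n; apply/(nullE _ mA).
    have fs : finite_set [set` pmap unpickle (CodeSeq.decode n) : seq V].
      by apply/finite_seqP; eexists.
    exact: (iffRL (null_points_off fs mA)).
  apply: negligibleS (negligibleU sitefin neg) => w wA.
  have [wfin|wfin] := pselect (site_finite (joint Z w)); last by left.
  right; have [N hN] := window_of m cs.
  have [s sE] := points_off_remove_bounded wfin hN.
  exists (pickle s) => //; rewrite pickleK /= -sE.
  exact: wA.
have neg' : P'.-negligible (\bigcup_n (if @unpickle (nat * k.-tuple V)%type n is Some mc
      then Pi' @^-1` removed mc.1 mc.2 else set0)).
  apply: negligible_bigcup => n; case: (unpickle n) => [[m cs]|]; last exact: negligible_set0.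
  apply/negligibleP; last exact: removed0.
  by apply: preimage_measurable => //; exact: measurable_funPT.
have lf' : P'.-negligible (Pi' @^-1` ~` [set S : config | locally_finite (S : set E)]).
  have mlf : measurable (~` [set S : config | locally_finite (S : set E)]).
    by apply: measurableC; exact: measurable_locally_finite.
  apply/negligibleP; first by apply: preimage_measurable => //; exact: measurable_funPT.
  apply: (etrans (sameE _ mlf)); apply/(nullE set0 mlf); apply: negligibleS sitefin => w wlf wfin.
  by apply: wlf; exact: points_off_locally_finite.
apply: negligibleS (negligibleU lf' neg') => w wA.
have [wlf|wlf] := pselect (locally_finite (Pi' w)); last by left.
right; have [m mE] := locally_finite_deletion (U ^~ w) wlf.
pose cs := [tuple dyadic_index m (U i w) | i < k].
have E1 : delete_points (Pi' w) (U ^~ w) = ((Pi' w : set E) `&` ~` cells m cs).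
  rewrite mE setDE /cells; congr (_ `&` ~` _).
  by apply: eq_bigcupr => i _; rewrite tnth_mktuple.
exists (pickle (m, cs)) => //; rewrite pickleK /=.
exact: (eq_ind _ A wA _ E1).
Qed.

Let with_point (A : set config) (u : E) : set config :=
  [set S | A (insert_point (S, u))].

Let measurable_with_point A u : measurable A -> measurable (with_point A u).
Proof.
move=> mA.
have mi : measurable_fun setT (fun S : config => insert_point (S, u)).
  exact: (measurableT_comp measurable_insert_point (pair2_measurable u)).
exact: (preimage_measurable mi mA).
Qed.

(** Resample the point of the origin: a null event remains null when this
    point is at [u], for almost all [u], because its density is positive. That
    the configuration has lost the original point of the origin is immaterial
    by [null_points_off]. *)
Let null_with_point A : measurable A -> null set0 A ->
  exists N : set E, [/\ measurable N, lam N = 0%E & forall u, ~ N u ->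
    null set0 (with_point A u)].
Proof.
move=> mA A0; pose S1 : set V := [set o].
have mS1 := measurable_points_off (R := R) (d := d) S1.
pose h (p : labelled V E * E) : \bar R :=
  ((\1_A (insert_point (points_off S1 p.1, p.2)) : R)%:E).
have mh : measurable_fun setT h.
  have mp : measurable_fun setT (fun p : labelled V E * E => (points_off S1 p.1, p.2)).
    apply: measurable_fun_pair; last exact: measurable_snd.
    exact: (measurableT_comp mS1 measurable_fst).
  have mi : measurable_fun setT (\1_A : config -> R) by exact: measurable_indic.
  apply/measurable_EFinP.
  exact: (measurableT_comp mi (measurableT_comp measurable_insert_point mp)).
have h0 p : (0 <= h p)%E by rewrite lee_fin.
pose f u := (\int[mu]_y h (y, u))%E.
have mf : measurable_fun setT f.
  exact: (@measurable_fun_fubini_tonelli_G _ _ _ _ _ mu h mh h0).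
have f0 u : (0 <= f u)%E by apply: integral_ge0.
have fE u : f u = mu (points_off S1 @^-1` with_point A u).
  transitivity (\int[mu]_y (\1_(points_off S1 @^-1` with_point A u) y)%:E)%E; last first.
    apply: (integral_indicT mu); apply: preimage_measurable => //.
    exact: measurable_with_point.
  apply: eq_integral => y _; by congr (_%:E); exact: eq_indic.
have int0 : (\int[lam]_z (f z * (g (displacement o z))%:E) = 0)%E.
  rewrite -(integral_density (mgd o) (fun z => g0 _) (@Gg o) mf f0).
  rewrite -(@fubini_tonelli _ _ _ _ _ mu (G o) h mh h0) -[RHS]A0.
  transitivity (\int[mu]_y (\1_(points_off set0 @^-1` A) y)%:E)%E; last first.
    by apply: (integral_indicT mu); apply: preimage_measurable => //;
      exact: measurable_points_off.
  have mA' : measurable (points_off set0 @^-1` A : set (labelled V E)).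
    by apply: preimage_measurable => //; exact: measurable_points_off.
  have mi : measurable_fun setT (fun y : labelled V E =>
      (\1_(points_off set0 @^-1` A) y : R)%:E).
    by apply/measurable_EFinP; exact: measurable_indic.
  have i0 (y : labelled V E) : (0 <= (\1_(points_off set0 @^-1` A) y : R)%:E)%E.
    by rewrite lee_fin.
  rewrite (integral_update muG o mi i0).
  apply: eq_integral => y _; apply: eq_integral => z _; rewrite /h.
  have -> : insert_point (points_off S1 y, z) = points_off set0 (update o z y).
    rewrite /insert_point /points_off /=; apply/seteqP; split => x.
      case=> [[v vo <-]|->]; last by exists o => //; rewrite /update eqxx.
      by exists v => //; rewrite /update; case: eqVneq.
    move=> [v _ <-]; rewrite /update; case: eqVneq => [_|vo]; first by right.
    by left; exists v => //; exact/eqP.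
  by congr (_%:E); exact: eq_indic.
have mfg : measurable_fun setT (fun z => f z * (g (displacement o z))%:E)%E.
  by apply: emeasurable_funM => //; apply/measurable_EFinP; exact: mgd.
have : ae_eq lam setT (fun z => f z * (g (displacement o z))%:E)%E (cst 0%E).
  apply/ae_eq_integral_abs => //; rewrite -[RHS]int0.
  by apply: eq_integral => z _; rewrite gee0_abs// mule_ge0// lee_fin.
move=> [N [mN N0 hN]]; exists N; split => // u nNu.
apply/(null_points_off (finite_set1 o) (measurable_with_point u mA)).
rewrite /null -fE; apply: contrapT => fu; apply: nNu; apply: hN => /(_ I)/eqP.
rewrite mule_eq0 => /orP[/eqP//|]; rewrite eqe gt_eqF//.
by rewrite (lt_le_trans _ (g_ge _))// mulr_gt0// power_tail_gt0.
Qed.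

(** By Fubini: almost every position of the point gives a null section. *)
Lemma insert_independent_point {disp' : measure_display}
    {Omega' : measurableType disp'} (P' : probability Omega' R)
    (Q : {RV P' >-> config}) (U : {RV P' >-> E}) (A : set config) :
  (forall B, measurable B -> null set0 B -> P' (Q @^-1` B) = 0%E) ->
  (forall B, measurable B -> lam B = 0%E -> P' (U @^-1` B) = 0%E) ->
  (forall B C, measurable B -> measurable C ->
    P' (Q @^-1` B `&` U @^-1` C) = (P' (Q @^-1` B) * P' (U @^-1` C))%E) ->
  measurable A -> null set0 A ->
  P' ((fun w => insert_point (Q w, U w)) @^-1` A) = 0%E.
Proof.
move=> Qnull Unull QU mA A0.
have [N [mN N0 hN]] := null_with_point mA A0.
have mQU : measurable_fun setT (fun w => (Q w, U w)) by exact: measurable_fun_pair.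
have mI : measurable (insert_point @^-1` A : set (config * E)).
  by apply: preimage_measurable => //; exact: measurable_insert_point.
pose m1 : probability config R := distribution P' Q.
pose m2 : probability E R := distribution P' U.
transitivity (image_measure P' mQU (insert_point @^-1` A)) => //.
rewrite -(@product_measure_unique _ _ _ _ _ m1 m2)//.
transitivity (\int[(m1 \x m2)%E]_p (\1_(insert_point @^-1` A) p)%:E)%E.
  by apply/esym; exact: (integral_indicT (m1 \x m2)%E).
have mi : measurable_fun setT (fun p : config * E =>
    (\1_(insert_point @^-1` A) p : R)%:E).
  by apply/measurable_EFinP; exact: measurable_indic.
have i0 p : (0 <= (\1_(insert_point @^-1` A) p : R)%:E)%E by rewrite lee_fin.
have mG := @measurable_fun_fubini_tonelli_G _ _ _ _ _ m1 _ mi i0.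
rewrite (@fubini_tonelli2 _ _ _ _ _ m1 m2 _ mi i0).
have GE u : fubini_G m1 (fun p => (\1_(insert_point @^-1` A) p : R)%:E) u =
    m1 (with_point A u).
  transitivity (\int[m1]_y (\1_(with_point A u) y)%:E)%E; last first.
    by apply: (integral_indicT m1); exact: measurable_with_point.
  by apply: eq_integral => y _; congr (_%:E); exact: eq_indic.
apply/eqP; rewrite eq_le; apply/andP; split; last first.
  by apply: integral_ge0 => u _; rewrite GE.
have m2N : m2 N = 0%E by exact: Unull.
rewrite -m2N -(integral_indicT m2)//; apply: ge0_le_integral => //.
- by move=> u _; rewrite GE.
- by apply/measurable_EFinP; exact: measurable_indic.
move=> u _; rewrite GE; have [Nu|Nu] := pselect (N u).
  by rewrite indicE mem_set//=; exact: probability_le1 (measurable_with_point u mA).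
rewrite indicE memNset//= le_eqVlt; apply/orP; left; apply/eqP.
exact: Qnull (measurable_with_point u mA) (hN u Nu).
Qed.

(** Insert the points one at a time. The configuration with the first point
    inserted has no mass on null events, by [insert_independent_point], and
    remains independent of the other points. *)
Lemma insert_points_null {disp' : measure_display}
    {Omega' : measurableType disp'} (P' : probability Omega' R) k
    (Q : {RV P' >-> config}) (U : 'I_k -> {RV P' >-> E}) (A : set config) :
  (forall B, measurable B -> null set0 B -> P' (Q @^-1` B) = 0%E) ->
  (forall i B, measurable B -> lam B = 0%E -> P' (U i @^-1` B) = 0%E) ->
  independent_with Q U -> measurable A -> null set0 A ->
  P'.-negligible ((fun w => insert_points (Q w) (U ^~ w)) @^-1` A).
Proof.
elim: k Q U => [|k IH] Q U Qnull Unull indep mA A0.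
  rewrite (_ : _ @^-1` A = Q @^-1` A).
    apply/negligibleP; last exact: Qnull.
    by apply: preimage_measurable => //; exact: measurable_funPT.
  congr (_ @^-1` A); apply/funext => w; apply/seteqP; split => x; last by left.
  by case=> // -[[]].
have mQU : measurable_fun setT (fun w => (Q w, U ord0 w)) by exact: measurable_fun_pair.
pose Q1f w := insert_point (Q w, U ord0 w).
have mQ1 : measurable_fun setT Q1f.
  exact: (measurableT_comp measurable_insert_point mQU).
pose Q1 : {RV P' >-> config} := HB.pack Q1f (isMeasurableFun.Build _ _ _ _ Q1f mQ1).
pose U1 i := U (lift ord0 i).
(* the product rule, with the first point separated from the others *)
have rule (B : set config) (C : set E) (D : 'I_k -> set E) : measurable B ->
    measurable C -> (forall i, measurable (D i)) ->
    P' ((Q @^-1` B `&` U ord0 @^-1` C) `&` \bigcap_(i in [set: 'I_k]) (U1 i @^-1` D i)) =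
    (P' (Q @^-1` B) * P' (U ord0 @^-1` C) * \prod_(i < k) P' (U1 i @^-1` D i))%E.
  move=> mB mC mD.
  have := indep B (fun i => if unlift ord0 i is Some j then D j else C) mB.
  rewrite big_ord_recl unlift_none muleA.
  under eq_bigr do rewrite liftK.
  move=> <-; last by move=> i; case: unliftP.
  congr (P' _); rewrite -setIA; congr (_ `&` _); apply/seteqP; split => w.
    move=> [Cw Dw] i _; case: unliftP => [j ->|->] //; exact: Dw.
  move=> h; split; first by have := h ord0 I; rewrite /= unlift_none.
  by move=> i _; have := h (lift ord0 i) I; rewrite /= liftK.
have ruleQU B C : measurable B -> measurable C ->
    P' (Q @^-1` B `&` U ord0 @^-1` C) = (P' (Q @^-1` B) * P' (U ord0 @^-1` C))%E.
  move=> mB mC; have := rule B C (fun=> setT) mB mC (fun=> measurableT).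
  rewrite (_ : \bigcap_(i in _) _ = setT) ?setIT; last by apply/seteqP; split.
  by rewrite big1 ?mule1// => i _; rewrite preimage_setT; exact: probability_setT.
have Q1null B : measurable B -> null set0 B -> P' (Q1 @^-1` B) = 0%E.
  by move=> mB B0; exact: insert_independent_point (Unull ord0) ruleQU mB B0.
have mpre (X : {RV P' >-> E}) C : measurable C -> measurable (X @^-1` C).
  by move=> mC; apply: preimage_measurable.
have indep1 : independent_with Q1 U1.
  move=> B D mB mD.
  pose GD := \bigcap_(i in [set: 'I_k]) (U1 i @^-1` D i).
  have mGD : measurable GD.
    by apply: fin_bigcap_measurable => // i _; exact: mpre.
  pose cD : R := fine (\prod_(i < k) P' (U1 i @^-1` D i))%E.
  have cDE : (\prod_(i < k) P' (U1 i @^-1` D i))%E = cD%:E.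
    rewrite fineK//; apply: (big_ind (fun x => x \is a fin_num)) => //.
      exact: fin_numM.
    by move=> i _; rewrite fin_num_measure//; exact: mpre.
  have cD0 : 0 <= cD.
    by rewrite -lee_fin -cDE; apply: prode_ge0 => i _.
  rewrite cDE muleC.
  pose m1 := image_measure (mrestr P' mGD) mQU.
  pose m2 := image_measure (mscale (NngNum cD0) P') mQU.
  have H X : measurable X -> m1 X = m2 X.
    apply: (@measure_unique _ R _ [set C `*` D' | C in measurable & D' in measurable]
      (fun=> setT)).
    - exact: measurable_prod_measurableType.
    - move=> _ _ [C1 mC1 [D1 mD1 <-]] [C2 mC2 [D2 mD2 <-]].
      rewrite -setXI; exists (C1 `&` C2); first exact: measurableI.
      by exists (D1 `&` D2) => //; exact: measurableI.
    - by move=> _; exists setT => //; exists setT => //; rewrite setXTT.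
    - by rewrite bigcup_const.
    - move=> _ [C mC [D' mD' <-]].
      transitivity (P' ((Q @^-1` C `&` U ord0 @^-1` D') `&` GD)) => //.
      rewrite rule// cDE muleC; transitivity (cD%:E * P' (Q @^-1` C `&` U ord0 @^-1` D'))%E => //.
      by rewrite ruleQU.
    - move=> _; rewrite (@le_lt_trans _ _ 1%E) ?ltry//.
      by apply: probability_le1; apply: measurableI => //; exact: preimage_measurable.
  apply: (H (insert_point @^-1` B)).
  by apply: preimage_measurable => //; exact: measurable_insert_point.
have := IH Q1 U1 Q1null (fun i => Unull _) indep1 mA A0.
congr (P'.-negligible _); congr (_ @^-1` A); apply/funext => w.
rewrite /insert_points /Q1 /= /Q1f /insert_point /= -setUA; congr (_ `|` _).
apply/seteqP; split => z.
  by case=> [->|[i _ <-]]; [exists ord0|exists (lift ord0 i)].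
move=> [i _ <-]; case: (unliftP ord0 i) => [j ->|->]; last by left.
by right; exists j.
Qed.

Lemma heavy_tail_insertion_tolerant k : insertion_tolerant P k (perturbed_lattice Y).
Proof.
move=> W mW /andP[W0 Woo] disp' Omega' P' Pi' U same unif indep A mA.
have -> : perturbed_lattice Y = fun w => points_off set0 (joint Z w).
  by apply/funext => w; exact: lattice_points0.
move=> /(nullE _ mA) A0.
apply: insert_points_null => // [B mB B0|i B mB B0].
  transitivity (pushforward P (perturbed_lattice Y) B); first exact: same.
  rewrite -[RHS]B0; congr (P _); apply/seteqP; split => w /=;
    by rewrite lattice_points0.
transitivity (distribution P' (U i) B) => //; rewrite (unif i)//.
have -> : lam (B `&` W) = 0%E.
  apply/eqP; rewrite eq_le measure_ge0 andbT -B0; apply: le_measure; rewrite ?inE//.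
  exact: measurableI.
by rewrite mul0r.
Qed.

End heavy_tail.

Section tail_conditions.
Context {R : realType} {d : nat}.
Local Notation E := (d.-tuple R).

Lemma ereal_inf_gt0_lower_bound (alpha : R) (g : E -> R) :
  (0 < ereal_inf (range (fun y => (g y / power_tail alpha y)%:E)))%E ->
  exists2 c, 0 < c & forall y, c * power_tail alpha y <= g y.
Proof.
set r := range _; move=> r0.
have rle y : (ereal_inf r <= (g y / power_tail alpha y)%:E)%E.
  by apply: ereal_inf_lbound; exists y.
have rfin : ereal_inf r \is a fin_num.
  rewrite ge0_fin_numE ?(ltW r0)//.
  exact: le_lt_trans (rle [tuple 0 | i < d]) (ltry _).
exists (fine (ereal_inf r)) => [|y].
  by rewrite -lte_fin fineK.
by rewrite -ler_pdivlMr ?power_tail_gt0// -lee_fin fineK.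
Qed.

(** For negative [alpha] the lower bound is a positive constant far from the
    origin, which no integrable function satisfies. *)
Lemma heavy_tail_exponent_ge0 {disp : measure_display}
    {Omega : measurableType disp} (P : probability Omega R)
    (X : {RV P >-> E}) (g : E -> R) (alpha c : R) : (0 < d)%N ->
  has_density X g -> 0 < c -> (forall y, c * power_tail alpha y <= g y) ->
  0 <= alpha.
Proof.
move=> d0 [mg g0 Xg] c0 g_ge; rewrite leNgt; apply/negP => alpha0.
have [N cN] : exists N : nat, 1 < c * N.+1%:R.
  exists (Num.bound c^-1); rewrite -ltr_pdivrMl// mulr1.
  rewrite (lt_le_trans (archi_boundP _)) ?invr_ge0 ?(ltW c0)//.
  by rewrite ler_nat.
pose B : set E := tuple_box (fun=> `[1, 1 + N.+1%:R[%classic).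
have mB : measurable B by apply: measurable_tuple_box => i; exact: measurable_itv.
have gB y : B y -> c <= g y.
  move=> By; apply: le_trans (g_ge y); rewrite ler_peMr ?(ltW c0)//.
  have y1 : 1 <= euclidean_norm y.
    apply: le_trans (coordinate_le_euclidean_norm y (Ordinal d0)).
    have := By (Ordinal d0); rewrite /= in_itv/= => /andP[y1 _].
    exact: le_trans (ler_norm _).
  rewrite /power_tail gt_eqF ?(lt_le_trans ltr01)// le_min lexx/=.
  rewrite -(powRr0 (euclidean_norm y)) ler_powR// oppr_ge0; exact: ltW.
have : (distribution P X B <= 1)%E by exact: probability_le1.
rewrite (Xg _ mB) leNgt => /negP; apply.
apply: (@lt_le_trans _ _ (\int[lebesgue_tuple d]_(y in B) c%:E)%E); last first.
  apply: ge0_le_integral => //.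
  - by move=> y _; rewrite lee_fin ltW.
  - by apply/measurable_EFinP; exact: measurable_funTS.
have -> : (\int[lebesgue_tuple d]_(y in B) c%:E = c%:E * lebesgue_tuple d B)%E.
  exact: integral_cst.
have -> : lebesgue_tuple d B = ((1 + N.+1%:R - 1) ^+ d : R)%:E.
  by apply: lebesgue_tuple_cube; rewrite lerDl.
rewrite (_ : 1 + N.+1%:R - 1 = N.+1%:R :> R) -?EFinM ?lte_fin; last by ring.
apply: lt_le_trans cN _; rewrite ler_pM2l// ler_eXnr ?ler1n//.
Qed.

End tail_conditions.

(** * Paths in the lattice and matchings of points to sites *)

Section lattice_paths.
Context {d : nat}.
Local Notation V := (d.-tuple int).

Definition lattice_distance (x y : V) : nat :=
  \sum_(i < d) `|tnth x i - tnth y i|%N.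

Fixpoint path_length (x : V) (s : seq V) : nat :=
  if s is y :: s' then (lattice_distance x y + path_length y s')%N else 0.

Lemma lattice_distance_triangle y x z :
  (lattice_distance x z <= lattice_distance x y + lattice_distance y z)%N.
Proof. by rewrite -big_split/=; apply: leq_sum => i _; exact: leqD_dist. Qed.

Lemma lattice_distance_gt0 x y : x != y -> (0 < lattice_distance x y)%N.
Proof.
apply: contraNltn; rewrite leqn0 sum_nat_eq0 => /forallP xy.
apply/eqP/eq_from_tnth => i; apply/eqP.
by rewrite -subr_eq0 -absz_eq0; exact: xy.
Qed.

Lemma path_length_start y x s :
  (path_length x s <= lattice_distance x y + path_length y s)%N.
Proof.
case: s => //= z s; rewrite addnA leq_add2r; exact: lattice_distance_triangle.
Qed.

Lemma path_length_subseq x s1 s2 :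
  subseq s1 s2 -> (path_length x s1 <= path_length x s2)%N.
Proof.
elim: s2 x s1 => [|v s2 IH] x [|u s1] //=; case: eqP => [-> s12|_ s12].
  by rewrite leq_add2l; exact: IH.
by apply: leq_trans (path_length_start v x s2); exact: (IH x (u :: s1)).
Qed.

Lemma lattice_distance_le_path_length x s v :
  v \in s -> (lattice_distance x v <= path_length x s)%N.
Proof.
by rewrite -sub1seq => /(path_length_subseq x); rewrite /= addn0.
Qed.

Lemma size_le_path_length x s : uniq s -> (size s <= (path_length x s).+1)%N.
Proof.
case: s => // v s us; rewrite ltnS /= -[X in (X <= _)%N]add0n leq_add//.
elim: s v us => //= u s IH v /andP[]; rewrite inE negb_or => /andP[vu _] us.
by rewrite -add1n leq_add//; [exact: lattice_distance_gt0|exact: IH].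
Qed.

(** An injective map that misses the starting point of an orbit cannot return
    to a point that was visited before. *)
Lemma uniq_injective_orbit (F : seq V) (f : V -> V) x n :
  {in F &, injective f} -> {in F, forall v, f v != x} ->
  {subset traject f x n <= F} -> uniq (traject f x n.+1).
Proof.
move=> f_inj fx orbF.
have itF k : (k < n)%N -> iter k f x \in F.
  by move=> kn; apply: orbF; apply/trajectP; exists k.
have it_neq i j : (i < j)%N -> (j <= n)%N -> iter i f x <> iter j f x.
  elim: i j => [|i IH] [|j] //= ij jn ijE.
    by have /eqP := fx _ (itF _ jn); rewrite -ijE.
  have := f_inj _ _ (itF i (ltn_trans (ij : (i < j)%N) jn)) (itF _ jn) ijE.
  by apply: IH => //; exact: ltnW.
apply/(uniqP x) => i j; rewrite !inE size_traject => ilt jlt.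
rewrite !nth_traject// => ijE; case: (ltngtP i j) => // ij.
  by case: (it_neq i j).
by case: (it_neq j i).
Qed.

Lemma mem_box_distance L v :
  (lattice_distance [tuple (0 : int) | i < d] v <= L)%N -> v \in box L.
Proof.
move=> vL; apply: mem_box => i; apply: leq_trans vL.
rewrite /lattice_distance (bigD1 i)//= tnth_mktuple; lia.
Qed.

End lattice_paths.

Section matching.
Context {R : realType} {d : nat}.
Local Notation E := (d.-tuple R).
Local Notation V := (d.-tuple int).
Let o : V := [tuple (0 : int) | i < d].

Definition offset (v : V) (z : E) : R :=
  \sum_(i < d) `|tnth z i - (tnth v i)%:~R|.

(** A point that is used by two sites bounds their distance. *)
Lemma lattice_distance_le_offset x y z :
  (lattice_distance x y)%:R <= offset x z + offset y z.
Proof.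
rewrite natr_sum -big_split/=; apply: ler_sum => i _.
have -> : `|tnth x i - tnth y i|%N%:R = `|(tnth x i)%:~R - (tnth y i)%:~R| :> R.
  by rewrite -rmorphB/= -intr_norm -abszE.
rewrite [`|tnth z i - (tnth x i)%:~R|]distrC; exact: ler_distD.
Qed.

(** The displacements along a path grow at a rate smaller than its length;
    [1/4] leaves room for two such families to be combined. *)
Definition short_offsets (C : R) (F : seq V) (p : V -> E) : Prop :=
  forall s, uniq s -> {subset s <= F} ->
  \sum_(v <- s) offset v (p v) <= (path_length o s)%:R / 4 + C.

Lemma path_length_traject (F : seq V) (f : V -> V) (p q : V -> E) x n :
  {in F, forall v, q (f v) = p v} -> {subset traject f x n <= F} ->
  (path_length x (traject f (f x) n))%:R <=
  \sum_(v <- traject f x n) offset v (p v) +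
  \sum_(v <- traject f (f x) n) offset v (q v).
Proof.
move=> qf; elim: n x => [|n IH] x xF /=; first by rewrite !big_nil addr0.
have Fx : x \in F by apply: xF; rewrite /= mem_head.
have H : (path_length (f x) (traject f (f (f x)) n))%:R <=
    \sum_(v <- traject f (f x) n) offset v (p v) +
    \sum_(v <- traject f (f (f x)) n) offset v (q v).
  by apply: IH => v vF; apply: xF; rewrite /= inE vF orbT.
rewrite natrD !big_cons addrACA lerD// qf//; exact: lattice_distance_le_offset.
Qed.

(** From the lattice site of the deleted point [z], jump from a site to the
    site whose [q]-point is its [p]-point. The jumps never repeat a site, so the
    path leaves every finite box; but its length is at most the sum of the
    offsets of [p] and [q] along it, which is about half its length. *)
Lemma no_matching_after_deletion (q : V -> E) (C1 C2 : R) (z : E) :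
  (forall F, short_offsets C1 F q) -> range q z ->
  ~ (forall F, exists p : V -> E, [/\ {in F &, injective p},
      {in F, forall v, (range q `\ z) (p v)} & short_offsets C2 F p]).
Proof.
move=> q_short [x0 _ qx0] match_all.
have [N hN] : exists N : nat,
    (lattice_distance o x0)%:R *+ 2 + (C1 + C2) *+ 2 < N%:R :> R.
  eexists; apply: le_lt_trans (ler_norm _) _; exact: archi_boundP.
have [p [p_inj p_range p_short]] := match_all (box N).
pose f v := if pselect (exists x, q x = p v) is left e then projT1 (cid e) else o.
have qf : {in box N, forall v, q (f v) = p v}.
  move=> v /p_range[[x _ xv] _]; rewrite /f; case: pselect => [e|].
    exact: (projT2 (cid e)).
  by case; exists x.
have f_inj : {in box N &, injective f}.
  by move=> u v uF vF /(congr1 q); rewrite !qf//; exact: p_inj.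
have fx0 : {in box N, forall v, f v != x0}.
  move=> v vF; apply/eqP => /(congr1 q); rewrite qf// qx0 => pz.
  by have [_] := p_range _ vF; rewrite pz; apply.
have [n [orbF outF]] : exists n, {subset traject f x0 n <= box N} /\
    iter n f x0 \notin box N.
  have [n nF nmin] : exists2 n, iter n f x0 \notin box N &
      forall k, (k < n)%N -> iter k f x0 \in box N.
    have ex : exists n, iter n f x0 \notin box N.
      apply: contrapT => all_in.
      have sub : {subset traject f x0 (size (box N : seq V)).+1 <= box N}.
        move=> v vt; have [k _ ->] := elimT trajectP vt; apply: contrapT => /negP kF.
        by apply: all_in; exists k.
      have := uniq_leq_size (uniq_injective_orbit f_inj fx0 (n := size (box N : seq V)) _) sub.
      rewrite size_traject ltnn => H; suff : false by []; apply: H.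
      by move=> v vt; apply: sub; rewrite trajectSr mem_rcons inE vt orbT.
    exists (ex_minn ex); case: ex_minnP => // n nF nmin k.
    by apply: contraTT => kF; rewrite -leqNgt; exact: nmin.
  by exists n; split => // v vt; have [k kn ->] := elimT trajectP vt; exact: nmin.
have uorb := uniq_injective_orbit f_inj fx0 orbF.
set L := path_length x0 (traject f (f x0) n).
have L_le : L%:R <= (path_length o (traject f x0 n))%:R / 4 + C2 +
    ((path_length o (traject f (f x0) n))%:R / 4 + C1) :> R.
  apply: le_trans (path_length_traject qf orbF) _; apply: lerD.
    by apply: p_short => //; have := uorb; rewrite trajectSr rcons_uniq => /andP[].
  apply: (q_short (traject f (f x0) n)) => //.
  by have := uorb; rewrite /= => /andP[].
have len1 : (path_length o (traject f x0 n) <= lattice_distance o x0 + L)%N.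
  apply: (@leq_trans (path_length o (traject f x0 n.+1))) => //.
  by apply: path_length_subseq; rewrite trajectSr subseq_rcons.
have len2 : (path_length o (traject f (f x0) n) <= lattice_distance o x0 + L)%N.
  exact: path_length_start.
have far : (N < lattice_distance o x0 + L)%N.
  rewrite ltnNge; apply: contra outF => leN; apply: mem_box_distance.
  apply: leq_trans leN; apply: leq_trans (_ : path_length o (traject f x0 n.+1) <= _)%N => //.
  apply: lattice_distance_le_path_length.
  by apply/trajectP; exists n.
move: far len1 len2; rewrite -(ltr_nat R) -!(ler_nat R) !natrD.
lra.
Qed.

End matching.

(** * Sums of independent variables along paths *)

Section path_weights.
Context {R : realType}.
Variable x : R.
Hypothesis x01 : 0 <= x < 1.

Lemma sum_distinct_powers_nat (s : seq nat) :
  uniq s -> \sum_(n <- s) x ^+ n <= (1 - x)^-1.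
Proof.
move=> us; have /andP[x0 x1] := x01.
pose M := (\max_(n <- s) n).+1.
have sE : perm_eq s [seq n <- iota 0 M | n \in s].
  apply: uniq_perm => // [|n]; first by rewrite filter_uniq// iota_uniq.
  rewrite mem_filter mem_iota /= add0n andb_idr// => ns.
  by rewrite ltnS; exact: leq_bigmax_seq.
rewrite (perm_big _ sE) big_filter /=.
apply: (@le_trans _ _ (\sum_(i < M) 1 * x ^+ (0 + i))); last first.
  by apply: le_trans (geometric_sum_le M 0 ler01 x01) _; rewrite expr0 !mul1r.
rewrite -(big_mkord xpredT (fun i => 1 * x ^+ (0 + i))) big_mkcond /index_iota subn0.
by apply: ler_sum => n _; rewrite mul1r; case: ifP => // _; exact: exprn_ge0.
Qed.

Lemma sum_distinct_powers_int (s : seq int) :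
  uniq s -> \sum_(k <- s) x ^+ `|k|%N <= 2 / (1 - x).
Proof.
move=> us; rewrite (bigID (fun k => 0 <= k))/= mulr_natl mulr2n.
have half (p : pred int) : {in p &, injective absz} ->
    \sum_(k <- s | p k) x ^+ `|k|%N <= (1 - x)^-1.
  move=> p_inj; rewrite -big_filter -(big_map absz xpredT (fun n => x ^+ n)).
  apply: sum_distinct_powers_nat; rewrite map_inj_in_uniq ?filter_uniq// => a b.
  by rewrite !mem_filter => /andP[pa _] /andP[pb _]; exact: p_inj.
apply: lerD; apply: half => -[a|a] [b|b] //= _ _; first by move=> ->.
by case=> ->.
Qed.

Context {d : nat}.
Local Notation V := (d.-tuple int).

Lemma sum_box_weights (o : V) L :
  \sum_(v <- box L) x ^+ lattice_distance o v <= (2 / (1 - x)) ^+ d.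
Proof.
rewrite big_map big_enum /=.
under eq_bigr => k _.
  rewrite -prodrXr (eq_bigr (fun i =>
    x ^+ absz (tnth o i - ((k i)%:Z - L%:Z))%R)); last by move=> i _; rewrite tnth_mktuple.
  over.
rewrite -(bigA_distr_bigA (fun i (j : 'I_L.*2.+1) => x ^+ absz (tnth o i - (j%:Z - L%:Z))%R)).
have -> : (2 / (1 - x)) ^+ d = \prod_(i < d) (2 / (1 - x)) by rewrite prodr_const card_ord.
have /andP[x0 x1] := x01.
apply: ler_prod => i _; apply/andP; split; first by apply: sumr_ge0 => j _; exact: exprn_ge0.
rewrite -(big_map (fun j : 'I_L.*2.+1 => tnth o i - (j%:Z - L%:Z)) xpredT
  (fun k : int => x ^+ `|k|%N)).
apply: sum_distinct_powers_int; rewrite map_inj_uniq ?index_enum_uniq// => j k.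
by move=> jk; apply/val_inj; move: jk => /=; lia.
Qed.

Fixpoint paths (B : seq V) m : seq (seq V) :=
  if m is m'.+1 then [seq v :: s | v <- B, s <- paths B m'] else [:: [::]].

Lemma mem_paths B m s : size s = m -> {subset s <= B} -> s \in paths B m.
Proof.
elim: m s => [|m IH] [|v s]//= [sm] sB; apply/allpairsP; exists (v, s); split => //=.
  by apply: sB; rewrite mem_head.
by apply: IH => // u us; apply: sB; rewrite inE us orbT.
Qed.

(** The bound for the rest of a path is uniform in its starting point, so each
    step contributes a factor. *)
Lemma sum_path_weights (o : V) L m :
  \sum_(s <- paths (box L) m) x ^+ path_length o s <= ((2 / (1 - x)) ^+ d) ^+ m.
Proof.
have /andP[x0 x1] := x01.
have w0 : 0 <= (2 / (1 - x)) ^+ d :> R.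
  by rewrite exprn_ge0// divr_ge0// subr_ge0 ltW.
elim: m o => [|m IH] o /=; first by rewrite big_seq1 /= !expr0.
rewrite big_allpairs_dep/=.
under eq_bigr do under eq_bigr do rewrite exprD.
under eq_bigr do rewrite -mulr_sumr.
apply: (@le_trans _ _ (\sum_(v <- box L) x ^+ lattice_distance o v *
   ((2 / (1 - x)) ^+ d) ^+ m)).
  by apply: ler_sum => v _; rewrite ler_wpM2l// exprn_ge0.
rewrite -mulr_suml exprS; apply: ler_wpM2r; first exact: exprn_ge0.
exact: sum_box_weights.
Qed.

End path_weights.

Lemma bigcup_seq_le {R : realType} {disp : measure_display} {T : measurableType disp}
    (m : {measure set T -> \bar R}) {I : choiceType} (s : seq I) (F : I -> set T) :
  (forall i, measurable (F i)) ->
  (m (\bigcup_(i in [set` s]) F i) <= \sum_(i <- s) m (F i))%E.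
Proof.
move=> mF; elim: s => [|i s IH]; first by rewrite set_nil bigcup_set0 measure0 big_nil.
rewrite bigcup_seq !big_cons -bigcup_seq.
apply: le_trans (measureU2 _ _ _) _ => //.
  by rewrite bigcup_seq; exact: bigsetU_measurable.
exact: leeD2l.
Qed.

Lemma prode_le_expn {R : realType} {I : eqType} (s : seq I) (a : I -> \bar R) (q : R) :
  (forall i, (0 <= a i <= q%:E)%E) -> (\prod_(i <- s) a i <= (q ^+ size s)%:E)%E.
Proof.
move=> aq; elim: s => [|i s IH]; first by rewrite big_nil expr0.
rewrite big_cons exprS EFinM; have /andP[a0 aiq] := aq i.
by apply: lee_pmul => //; apply: prode_ge0 => j _; have /andP[] := aq j.
Qed.

Section long_run.
Context {R : realType} {d : nat}.
Local Notation V := (d.-tuple int).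
Let o : V := [tuple (0 : int) | i < d].
Context {disp : measure_display} {Omega : measurableType disp}.
Variables (P : probability Omega R) (W : V -> {RV P >-> R}).
Hypothesis W_indep : mutually_independent W.

Definition long_run (t lam : R) m : set Omega := [set w | exists s : seq V,
  [/\ uniq s, size s = m, forall v, v \in s -> t < W v w &
    lam * (path_length o s)%:R <= m%:R]].

Let all_above t (s : seq V) : set Omega :=
  \bigcap_(v in [set` s]) (W v @^-1` `]t, +oo[).

Let measurable_all_above t s : measurable (all_above t s).
Proof.
apply: fin_bigcap_measurable; first exact: finite_seq.
by move=> v _; apply: preimage_measurable.
Qed.

Let admissible (lam : R) m : seq (seq V) :=
  [seq s <- paths (box (Num.truncn (m%:R / lam))) m |
    [&& uniq s, size s == m & lam * (path_length o s)%:R <= m%:R]].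

Let long_runE t lam m : 0 < lam ->
  long_run t lam m = \bigcup_(s in [set` admissible lam m]) all_above t s.
Proof.
move=> lam0; apply/seteqP; split => w; last first.
  move=> [s /=]; rewrite mem_filter => /andP[/and3P[us /eqP sm slam] _] sW.
  by exists s; split => // v vs; have := sW v vs; rewrite /= in_itv/= andbT.
move=> [s [us sm sW slam]]; exists s.
  rewrite /= mem_filter us slam sm eqxx/=; apply: mem_paths => // v vs.
  apply: mem_box_distance; apply: leq_trans (lattice_distance_le_path_length o vs) _.
  by rewrite truncn_ge_nat ?divr_ge0 ?(ltW lam0)// ler_pdivlMr// mulrC.
by move=> v vs; rewrite /= in_itv/= andbT; exact: sW.
Qed.

Lemma measurable_long_run t lam m : 0 < lam -> measurable (long_run t lam m).
Proof.
by move=> lam0; rewrite long_runE// bigcup_seq; exact: bigsetU_measurable.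
Qed.

(** Union bound over the paths with [m] sites: the paths of length at most
    [m / lam] are counted with the weights [(1 + lam) ^ - length], which lose at
    most a factor [e ^ m] and sum up to a product over the [m] steps. *)
Lemma long_run_le t lam q m : 0 < lam <= 1 ->
  (forall v, (P (W v @^-1` `]t, +oo[) <= q%:E)%E) ->
  (P (long_run t lam m) <= ((q * expR 1 * (4 / lam) ^+ d) ^+ m)%:E)%E.
Proof.
move=> /andP[lam0 lam1] Wq.
have q0 : 0 <= q by rewrite -lee_fin; exact: le_trans (measure_ge0 _ _) (Wq o).
rewrite long_runE//; apply: le_trans (bigcup_seq_le P _ _) _ => //.
(* [x ^- length <= expR (lam * length) <= expR m] for the paths considered *)
pose x : R := (1 + lam)^-1.
have lamS : 0 < 1 + lam by rewrite addr_gt0.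
have x0 : 0 <= x by rewrite invr_ge0 ltW.
have x1 : x < 1 by rewrite invf_lt1 // ltrDl.
have path_le s : s \in admissible lam m ->
    (P (all_above t s) <= ((q * expR 1) ^+ m * x ^+ path_length o s)%:E)%E.
  rewrite mem_filter => /andP[/and3P[us /eqP sm slam] _].
  rewrite /all_above (W_indep us) => [|v]; last by [].
  apply: (@le_trans _ _ (q ^+ size s)%:E).
    by apply: prode_le_expn => v; rewrite Wq andbT measure_ge0.
  rewrite lee_fin sm exprMn -mulrA ler_peMr ?exprn_ge0//.
  rewrite exprVn ler_pdivlMr ?exprn_gt0// mul1r.
  apply: (@le_trans _ _ (expR lam ^+ path_length o s)).
    by rewrite lerXn2r ?nnegrE ?expR_ge0 ?(ltW lamS)// expR_ge1Dx.
  by rewrite -!expRM_natr ler_expR mul1r.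
rewrite big_seq; apply: (@le_trans _ _
   (\sum_(s <- admissible lam m | s \in admissible lam m)
     ((q * expR 1) ^+ m * x ^+ path_length o s)%:E)%E).
  exact: lee_sum.
rewrite -big_seq sumEFin lee_fin -mulr_sumr [leRHS]exprMn.
apply: ler_wpM2l; first by rewrite exprn_ge0// mulr_ge0// expR_ge0.
rewrite big_filter big_mkcond.
have x01 : 0 <= x < 1 by rewrite x0.
apply: (@le_trans _ _ (\sum_(s <- paths (box (Num.truncn (m%:R / lam))) m)
    x ^+ path_length o s)).
  by apply: ler_sum => s _; case: ifP => // _; exact: exprn_ge0.
apply: le_trans (sum_path_weights x01 o _ _) _.
rewrite lerXn2r// ?nnegrE ?exprn_ge0 ?divr_ge0 ?subr_ge0 ?(ltW x1) ?(ltW lam0)//.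
rewrite lerXn2r// ?nnegrE ?divr_ge0 ?subr_ge0 ?(ltW x1) ?(ltW lam0)//.
rewrite ler_pdivrMr ?subr_gt0// mulrAC ler_pdivlMr//.
have -> : 1 - x = lam * x by rewrite /x; field; rewrite gt_eqF.
have x2 : 2^-1 <= x by rewrite lef_pV2 ?posrE//; lra.
by have := ler_wpM2l (ltW lam0) x2; lra.
Qed.

End long_run.

Section short_sums.
Context {R : realType} {d : nat}.
Local Notation V := (d.-tuple int).
Let o : V := [tuple (0 : int) | i < d].

(** Each value is split into dyadic layers: the layer at height [T * 2 ^ j] is
    used by the sites where [w] exceeds that height. Along a path these are fewer
    than [r ^ j] times the length, or fewer than [n0] when [j < n0]. *)
Lemma sum_along_path_le (w : V -> R) (T r : R) n0 : 0 < T -> 0 < r -> 2 * r < 1 ->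
  (forall j m (s : seq V), (0 < m)%N -> (n0 <= j + m)%N -> uniq s -> size s = m ->
     (forall v, v \in s -> T * 2 ^+ j < w v) ->
     m%:R < r ^+ j * (path_length o s)%:R) ->
  exists C, forall s : seq V, uniq s ->
    \sum_(v <- s) w v <= T * (1 + (1 - 2 * r)^-1) * (path_length o s)%:R + C.
Proof.
move=> T0 r0 r2 few; pose C0 := \sum_(j < n0) T * 2 ^+ j * n0%:R.
exists (T + C0) => s us; set L : R := (path_length o s)%:R.
have L0 : 0 <= L by exact: ler0n.
(* all values of [w] along [s] are below the layer [J]; the summand [n0] is only
   there to have [n0 <= J] *)
pose J := (Num.bound (\sum_(v <- s) (`|w v| / T)) + n0)%N.
have wJ v : v \in s -> w v <= T * 2 ^+ J.
  move=> vs; rewrite -ler_pdivrMl// mulrC.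
  apply: (@le_trans _ _ (\sum_(v <- s) (`|w v| / T))).
    apply: (@le_trans _ _ (`|w v| / T)); first by rewrite ler_pM2r ?invr_gt0// ler_norm.
    rewrite (big_rem v)//= lerDl; apply: sumr_ge0 => u _.
    by rewrite divr_ge0// ltW.
  apply: (@le_trans _ _ J%:R).
    apply/ltW.
    apply: lt_le_trans (archi_boundP _) _ => //.
      by apply: sumr_ge0 => u _; rewrite divr_ge0// ltW.
    by rewrite ler_nat /J leq_addr.
  by rewrite -natrX ler_nat ltnW// ltn_expl.
pose layer v j : R := T * 2 ^+ j * (T * 2 ^+ j < w v)%R%:R.
have split_layers v n : Num.min (w v) (T * 2 ^+ n) <= T + \sum_(j < n) layer v j.
  elim: n => [|n IH]; first by rewrite big_ord0 addr0 expr0 mulr1 ge_min lexx orbT.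
  rewrite big_ord_recr/= addrA; move: IH; set S := T + _ => IH.
  have T2 : 0 < T * 2 ^+ n by rewrite mulr_gt0// exprn_gt0.
  move: IH; rewrite /layer exprS; case: (ltP (T * 2 ^+ n) (w v)) => h.
    by rewrite mulr1 ge_min => IH; apply/orP; right; lra.
  by rewrite mulr0 addr0 ge_min => ->.
have count_le j : \sum_(v <- s) (T * 2 ^+ j < w v)%R%:R <=
    r ^+ j * L + (if (j < n0)%N then n0%:R else 0).
  pose s' := [seq v <- s | T * 2 ^+ j < w v].
  have -> : \sum_(v <- s) (T * 2 ^+ j < w v)%R%:R = (size s')%:R :> R.
    by rewrite size_filter -sum1_count natr_sum [RHS]big_mkcond; apply: eq_bigr => v _; case: ifP.
  have rL : 0 <= r ^+ j * L by rewrite mulr_ge0// exprn_ge0// ltW.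
  have i0 : 0 <= if (j < n0)%N then n0%:R else 0 :> R by case: ifP.
  case: (posnP (size s')) => [->|s'0]; first exact: addr_ge0.
  case: (leqP n0 (j + size s')) => [big_j|small_j].
    rewrite ler_wpDr// ltW//; apply: (@lt_le_trans _ _ (r ^+ j * (path_length o s')%:R)).
      apply: few => //; first exact: filter_uniq.
      by move=> v; rewrite mem_filter => /andP[].
    apply: ler_wpM2l; first by rewrite exprn_ge0// ltW.
    by rewrite ler_nat; apply: path_length_subseq; exact: filter_subseq.
  rewrite ler_wpDl// ifT; last by lia.
  by rewrite ler_nat; lia.
apply: (@le_trans _ _ (\sum_(v <- s) (T + \sum_(j < J) layer v j))).
  rewrite big_seq [leRHS]big_seq; apply: ler_sum => v vs.
  by apply: le_trans (split_layers v J); rewrite le_min lexx wJ.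
rewrite big_split/= exchange_big/=.
have size_le : \sum_(v <- s) T <= T * L + T.
  rewrite big_const_seq count_predT iter_addr_0 -mulr_natr -[in leRHS](mulr1 T).
  rewrite -mulrA mul1r -mulrDr ler_pM2l// natr1 ler_nat.
  exact: size_le_path_length.
have layers_le : \sum_(j < J) \sum_(v <- s) layer v j <= T * (1 - 2 * r)^-1 * L + C0.
  apply: (@le_trans _ _ (\sum_(j < J) (T * L * (2 * r) ^+ (0 + j) +
      (if (j < n0)%N then T * 2 ^+ j * n0%:R else 0)))).
    apply: ler_sum => j _; rewrite -mulr_sumr.
    have T2 : 0 <= T * 2 ^+ j by rewrite mulr_ge0// ?exprn_ge0// ltW.
    apply: le_trans (ler_wpM2l T2 (count_le j)) _.
    rewrite mulrDr exprMn; apply: lerD; last by case: ifP; rewrite ?mulr0.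
    by rewrite le_eqVlt; apply/orP; left; apply/eqP; ring.
  rewrite big_split/=; apply: lerD.
    have r01 : 0 <= 2 * r < 1 by rewrite r2 andbT mulr_ge0// ltW.
    apply: le_trans (geometric_sum_le J 0 _ r01) _; first by rewrite mulr_ge0// ltW.
    by rewrite expr0 mulr1 mulrAC.
  rewrite -big_mkcond/= /C0 (big_ord_widen J (fun j => T * 2 ^+ j * n0%:R))//.
  by rewrite /J leq_addl.
apply: le_trans (lerD size_le layers_le) _.
by rewrite le_eqVlt; apply/orP; left; apply/eqP; ring.
Qed.

End short_sums.

Lemma nneseries_geometric_le {R : realType} (f : nat -> \bar R) (K t : R) :
  0 <= K -> 0 <= t < 1 -> (forall n, (0 <= f n <= (K * t ^+ n)%:E)%E) ->
  (\sum_(0 <= n <oo) f n <= (K / (1 - t))%:E)%E.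
Proof.
move=> K0 t01 fK.
apply: lime_le; first by apply: is_cvg_nneseries => n _ _; case/andP: (fK n).
apply: nearW => n; rewrite big_mkord.
apply: (@le_trans _ _ (\sum_(i < n) (K * t ^+ (0 + i))%:E)%E).
  by apply: lee_sum => i _; case/andP: (fK i).
rewrite sumEFin lee_fin; apply: le_trans (geometric_sum_le n 0 K0 t01) _.
by rewrite expr0 mulr1.
Qed.

Lemma exists_expr_lt {R : realType} (b e : R) : 0 <= b < 1 -> 0 < e ->
  exists n, b ^+ n < e.
Proof.
move=> /andP[b0 b1] e0.
have /cvgrPdist_lt /(_ _ e0)[n _ h] : GRing.exp b @ \oo --> 0.
  by apply: cvg_expr; rewrite ger0_norm.
exists n; have := h n (leqnn n); rewrite /= sub0r normrN; apply: le_lt_trans.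
exact: ler_norm.
Qed.

Section greedy_sums.
Context {R : realType} {d : nat}.
Local Notation V := (d.-tuple int).
Let o : V := [tuple (0 : int) | i < d].
Context {disp : measure_display} {Omega : measurableType disp}.
Variables (P : probability Omega R) (W : V -> {RV P >-> R}).
Hypothesis W_indep : mutually_independent W.
Variables kappa b r : R.
Hypothesis tail : forall j v, (P (W v @^-1` `](2 ^+ j)%R, +oo[) <= (kappa * b ^+ j)%:E)%E.
Hypotheses (kappa_ge0 : 0 <= kappa) (b_ge0 : 0 <= b).
Hypotheses (r_gt0 : 0 < r) (r_lt : 2 * r < 1) (b_lt : b < r ^+ d).

Let r_le1 : r <= 1. Proof. by have := r_gt0; have := r_lt; lra. Qed.

Let b_lt1 : b < 1.
Proof. by apply: lt_le_trans b_lt _; rewrite exprn_ile1// ltW. Qed.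

(** The layer at height [2 ^ (a + j)] is given the density threshold [r ^ j]. As
    [b < r ^ d] and [2 * r < 1], long runs of all layers are summably unlikely
    while the layers contribute a convergent series to the sum along a path. *)
Lemma ae_sum_along_paths : exists2 K, 0 < K &
  P.-negligible (~` [set w | exists C, forall s : seq V, uniq s ->
    \sum_(v <- s) W v w <= K * (path_length o s)%:R + C]).
Proof.
have rd0 : 0 < r ^+ d by rewrite exprn_gt0.
pose c : R := kappa * expR 1 * 4 ^+ d.
have c0 : 0 <= c by rewrite !mulr_ge0 ?expR_ge0 ?exprn_ge0.
have [a ba] : exists a, b ^+ a < (2 * (c + 1))^-1.
  by apply: exists_expr_lt; rewrite ?b_ge0// invr_gt0; lra.
have ca : c * b ^+ a <= 2^-1.
  have b0a : 0 <= b ^+ a by exact: exprn_ge0.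
  move/ltW: ba; rewrite -[leRHS]div1r ler_pdivlMr; last lra.
  by nra.
pose T : R := 2 ^+ a; have T0 : 0 < T by rewrite exprn_gt0.
(* the factor [1 / 2] per run makes the sum over the sizes of the runs converge,
   and [b / r ^ d] the one over the layers *)
pose theta : R := Num.max (b / r ^+ d) 2^-1.
have theta0 : 0 < theta by rewrite lt_max invr_gt0 ltr0n orbT.
have theta1 : theta < 1.
  by rewrite gt_max ltr_pdivrMr// mul1r b_lt invf_lt1// ltr1n.
(* [n * theta ^ n] is at most [tau ^ n / (1 - tau)], a geometric sequence *)
pose tau : R := Num.sqrt theta.
have tau0 : 0 <= tau by exact: sqrtr_ge0.
have tau1 : tau < 1 by rewrite -sqrtr1 ltr_sqrt.
have tau2 n : theta ^+ n = tau ^+ n * tau ^+ n.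
  by rewrite -exprMn -expr2 sqr_sqrtr// ltW.
have run_le j m : (0 < m)%N ->
    (P (long_run W (T * 2 ^+ j) (r ^+ j) m) <= (theta ^+ (j + m))%:E)%E.
  move=> m0; have rj0 : 0 < r ^+ j by rewrite exprn_gt0.
  have rj1 : 0 < r ^+ j <= 1 by rewrite rj0 exprn_ile1// ltW.
  apply: le_trans (long_run_le W_indep m (q := kappa * b ^+ (a + j)) rj1 _) _.
    by move=> v; rewrite -exprD; exact: tail.
  rewrite lee_fin.
  have -> : kappa * b ^+ (a + j) * expR 1 * (4 / r ^+ j) ^+ d =
      c * b ^+ a * (b / r ^+ d) ^+ j.
    rewrite exprMn exprVn -[(r ^+ j) ^+ d]exprM mulnC exprM [(b / _) ^+ j]exprMn exprVn.
    by rewrite exprD /c; ring.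
  have bj : 0 <= b / r ^+ d by rewrite divr_ge0// ltW.
  apply: (@le_trans _ _ ((theta * theta ^+ j) ^+ m)).
    rewrite lerXn2r ?nnegrE ?mulr_ge0 ?exprn_ge0// ?(ltW theta0)//.
    apply: ler_pM; rewrite ?mulr_ge0 ?exprn_ge0//.
      by apply: le_trans ca _; rewrite le_max lexx orbT.
    by rewrite lerXn2r ?nnegrE ?(ltW theta0)// le_max lexx.
  rewrite -exprS -exprM; apply: ler_wiXn2l; rewrite ?(ltW theta0) ?(ltW theta1)//.
  by rewrite mulSn addnC leq_add2l leq_pmulr.
pose F n : set Omega :=
  \bigcup_(j in [set` iota 0 n]) long_run W (T * 2 ^+ j) (r ^+ j) (n - j).
have mF n : measurable (F n).
  rewrite /F bigcup_seq; apply: bigsetU_measurable => j _.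
  by apply: measurable_long_run; rewrite exprn_gt0.
have F_le n : (P (F n) <= ((1 - tau)^-1 * tau ^+ n)%:E)%E.
  apply: le_trans (bigcup_seq_le P _ _) _ => [j|].
    by apply: measurable_long_run; rewrite exprn_gt0.
  apply: (@le_trans _ _ (\sum_(j <- iota 0 n) (theta ^+ n)%:E)%E).
    rewrite big_seq [leRHS]big_seq; apply: lee_sum => j.
    rewrite mem_iota => /andP[_ jn]; apply: le_trans (run_le _ _ _) _; first by rewrite subn_gt0.
    by rewrite subnKC// ltnW.
  rewrite sumEFin lee_fin big_const_seq count_predT size_iota iter_addr_0 tau2.
  rewrite -mulrnAl ler_wpM2r ?exprn_ge0//.
  have tau01 : 0 <= tau < 1 by rewrite tau0.
  have geom := geometric_sum_le n 0 ler01 tau01.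
  rewrite expr0 !mul1r in geom; apply: le_trans geom.
  rewrite -[X in _ *+ X](card_ord n) -sumr_const; apply: ler_sum => i _.
  by rewrite mul1r add0n ler_wiXn2l ?(ltW tau1)// ltnW.
have limF0 : P (lim_sup_set F) = 0%E.
  apply: lim_sup_set_cvg0 => //.
  apply: (le_lt_trans _ (ltry ((1 - tau)^-1 / (1 - tau)))).
  apply: nneseries_geometric_le => [||n].
  - by rewrite invr_ge0 subr_ge0 ltW.
  - by rewrite tau0.
  - by rewrite measure_ge0 F_le.
exists (T * (1 + (1 - 2 * r)^-1)).
  by rewrite mulr_gt0// addr_gt0// invr_gt0 subr_gt0.
exists (lim_sup_set F); split => //.
  by apply: bigcapT_measurable => n; apply: bigcup_measurable => k _; exact: mF.
move=> w /= nsum n _; apply: contrapT => nF; apply: nsum.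
apply: (@sum_along_path_le R d (fun v => W v w) T r n) => // j m s m0 njm us sm sW.
rewrite ltNge; apply/negP => rm; apply: nF; exists (j + m)%N => //.
exists j; first by rewrite /= mem_iota add0n -[X in (X < _)%N]addn0 ltn_add2l.
by rewrite addKn; exists s.
Qed.
End greedy_sums.

(** * The event that the points can be matched to the sites *)

Section matching_event.
Context {R : realType} {d : nat}.
Local Notation E := (d.-tuple R).
Local Notation V := (d.-tuple int).
Local Notation config := (@configuration R d).
Let o : V := [tuple (0 : int) | i < d].

Let assigned (F c : seq V) v : V := nth o c (index v F).

Definition admissible_cells C F (mc : nat * seq V) : Prop :=
  {in F &, injective (assigned F mc.2)} /\
  forall p : V -> E, {in F, forall v, dyadic_cell mc.1 (assigned F mc.2 v) (p v)} ->
    short_offsets C F p.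

(** A countable form of the existence, for every finite [F], of distinct points
    [p v] of [S], [v] in [F], with short offsets: the points are prescribed up to
    dyadic cells. *)
Definition matchable (C : R) : set config := [set S | forall F : seq V,
  exists2 mc, admissible_cells C F mc & {in F, forall v,
    at_least 1 ((S : set E) `&` dyadic_cell mc.1 (assigned F mc.2 v))}].

(** Finite sets [F], scales and cells range over countable sets. *)
Lemma measurable_matchable C : measurable (matchable C).
Proof.
rewrite (_ : matchable C = \bigcap_(F in [set: seq V])
    \bigcup_(mc in [set mc | admissible_cells C F mc])
      \bigcap_(v in [set` F]) [set S : config |
        at_least 1 ((S : set E) `&` dyadic_cell mc.1 (assigned F mc.2 v))]); last first.
  apply/seteqP; split => S h F; last by have [mc adm hit] := h F I; exists mc.
  by move=> _; have [mc adm hit] := h F; exists mc.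
rewrite -[X in measurable X]setCK setC_bigcap; apply: measurableC.
apply: bigcup_measurable_countable => F _; apply: measurableC.
apply: bigcup_measurable_countable => mc _; rewrite bigcap_seq.
apply: bigsetI_measurable => v _; apply: measurable_at_least.
exact: measurable_dyadic_cell.
Qed.

Lemma matchable_sub C (S S' : config) : (S : set E) `<=` S' -> matchable C S -> matchable C S'.
Proof.
move=> SS' h F; have [mc adm hit] := h F; exists mc => // v /hit.
by apply: at_least_sub; exact: setSI.
Qed.

Lemma matchable_points C (S : config) : matchable C S ->
  forall F, exists p : V -> E, [/\ {in F &, injective p},
    {in F, forall v, (S : set E) (p v)} & short_offsets C F p].
Proof.
move=> h F; have [mc [cinj short] hit] := h F.
have pick v : exists z, v \in F ->
    (S : set E) z /\ dyadic_cell mc.1 (assigned F mc.2 v) z.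
  have [vF|vF] := boolP (v \in F); last by exists [tuple (0 : R) | i < d].
  have [s [_ ss sS]] := hit v vF.
  case: s ss sS => [|z [|]]// _ zS.
  by exists z => _; apply: zS; rewrite mem_head.
have /choice[p hp] := pick.
exists p; split => [u v uF vF uv|v vF|].
- apply: cinj => //; have [_ <-] := hp u uF; have [_ <-] := hp v vF.
  by rewrite uv.
- by have [] := hp v vF.
- by apply: short => v vF; have [] := hp v vF.
Qed.

Lemma dyadic_cell_offset m (c v : V) (z z' : E) :
  dyadic_cell m c z -> dyadic_cell m c z' ->
  offset v z <= offset v z' + d%:R / 2 ^+ m.
Proof.
move=> zc z'c; apply: (@le_trans _ _ (\sum_(i < d)
    (`|tnth z' i - (tnth v i)%:~R| + (2 ^+ m)^-1))); last first.
  rewrite big_split/= sumr_const card_ord -[_ *+ d]mulr_natl; exact: lexx.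
apply: ler_sum => i _; rewrite -lerBlDl.
apply: le_trans (lerB_dist _ _) _.
have -> : tnth z i - (tnth v i)%:~R - (tnth z' i - (tnth v i)%:~R) =
    tnth z i - tnth z' i by ring.
rewrite -[leRHS]div1r ler_pdivlMr ?exprn_gt0// mulrC; apply/ltW.
by apply: dyadic_index_close; rewrite zc z'c.
Qed.

Lemma common_scale (F : seq V) (q : V -> E) : {in F &, injective q} ->
  exists m0, forall m, (m0 <= m)%N -> {in F &, injective (fun v => dyadic_index m (q v))}.
Proof.
elim: F => [|v F IH] q_inj; first by exists 0%N => m _ u w; rewrite in_nil.
have [m1 sep1] : exists m1, forall m, (m1 <= m)%N -> {in F &, injective (fun v => dyadic_index m (q v))}.
  by apply: IH => u w uF wF; apply: q_inj; rewrite inE ?uF ?wF orbT.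
have [m2 sep2] : exists m2, forall m, (m2 <= m)%N -> forall x,
    x \in [seq q u | u <- F & u != v] -> ~ dyadic_cell m (dyadic_index m (q v)) x.
  apply: separated_cells; apply/mapP => -[u]; rewrite mem_filter => /andP[/eqP uv uF].
  by move=> /q_inj vu; apply: uv; rewrite vu ?mem_head// inE uF orbT.
have sep m u : (m2 <= m)%N -> u \in v :: F -> dyadic_index m (q u) = dyadic_index m (q v) -> u = v.
  move=> m2m; rewrite inE => /orP[/eqP//|uF] uvE; apply: contrapT => /eqP uv.
  by apply: (sep2 m m2m (q u)) => //; apply: map_f; rewrite mem_filter uv.
exists (maxn m1 m2) => m; rewrite geq_max => /andP[m1m m2m] u w uF wF uw.
have [wv|wv] := eqVneq w v; first by rewrite wv; apply: (sep m) => //; rewrite uw wv.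
have [uv|uv] := eqVneq u v; first by rewrite uv; apply/esym/(sep m) => //; rewrite -uw uv.
apply: (sep1 m m1m) => //.
  by move: uF; rewrite inE (negbTE uv).
by move: wF; rewrite inE (negbTE wv).
Qed.

(** The extra [1] absorbs the error made by replacing points by cells. *)
Lemma points_matchable C (S : config) (q : V -> E) : injective q ->
  (forall v, (S : set E) (q v)) -> (forall F, short_offsets C F q) ->
  matchable (C + 1) S.
Proof.
move=> q_inj qS q_short F.
have [m0 sep] := @common_scale F q (fun u v _ _ => @q_inj u v).
pose m := (m0 + Num.bound ((size F)%:R * d%:R : R))%N.
have F_le : (size F)%:R * d%:R <= 2 ^+ m :> R.
  apply: (@le_trans _ _ m%:R); last by rewrite -natrX ler_nat ltnW// ltn_expl.
  apply/ltW; apply: lt_le_trans (archi_boundP _) _; first by rewrite mulr_ge0.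
  by rewrite ler_nat leq_addl.
pose c := [seq dyadic_index m (q v) | v <- F].
have cE : {in F, forall v, assigned F c v = dyadic_index m (q v)}.
  by move=> v vF; rewrite /assigned (nth_map o) ?index_mem// nth_index.
exists (m, c); last first.
  move=> v vF; exists [:: q v]; split => // z; rewrite inE => /eqP ->.
  by split => //=; rewrite cE.
split => [u v uF vF|p pc s us sF] /=.
  by rewrite !cE//; apply: sep => //; rewrite leq_addr.
apply: (@le_trans _ _ (\sum_(v <- s) (offset v (q v) + d%:R / 2 ^+ m))).
  rewrite big_seq [leRHS]big_seq; apply: ler_sum => v vs.
  by apply: (@dyadic_cell_offset m (dyadic_index m (q v))) => //; rewrite -cE ?sF//; exact/pc/sF.
rewrite big_split/= addrA; apply: lerD; first exact: (q_short F).
rewrite big_const_seq count_predT iter_addr_0 -[_ *+ size s]mulr_natl mulrA ler_pdivrMr ?exprn_gt0//.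
rewrite mul1r; apply: le_trans F_le; rewrite ler_wpM2r// ler_nat.
exact: uniq_leq_size.
Qed.

End matching_event.

(** * Light tails: singularity of deletions *)

Section distinct_points.
Context {R : realType} {d : nat}.
Hypothesis d_gt0 : (0 < d)%N.
Local Notation E := (d.-tuple R).

Lemma measurable_scale_point (e : R) : measurable_fun setT (scale_point e : E -> E).
Proof.
apply/measurable_fun_tnthP => i; rewrite /comp.
have -> : (fun z => tnth (scale_point e z) i) = (fun z : E => e * tnth z i).
  by apply/funext => z; rewrite tnth_mktuple.
exact: (measurable_funM (measurable_cst e) (measurable_tnth i)).
Qed.

Lemma lebesgue_tuple1 (z : E) : lebesgue_tuple d [set z] = 0%E.
Proof.
rewrite (_ : [set z] = tuple_box (fun i => [set tnth z i])); last first.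
  apply/seteqP; split => [_ -> i //|x xz]; apply: eq_from_tnth => i; exact: xz.
rewrite lebesgue_tuple_boxE; last by move=> i; exact: measurable_set1.
by rewrite (bigD1 (Ordinal d_gt0))//= lebesgue_measure_set1 mul0e.
Qed.

Lemma measurable_point (z : E) : measurable [set z].
Proof.
rewrite (_ : [set z] = tuple_box (fun i => [set tnth z i])); last first.
  apply/seteqP; split => [_ -> i //|x xz]; apply: eq_from_tnth => i; exact: xz.
by apply: measurable_tuple_box => i; exact: measurable_set1.
Qed.

Context {disp : measure_display} {Omega : measurableType disp}.
Variable P : probability Omega R.

Lemma density_atomless (X : {RV P >-> E}) (g : E -> R) (z : E) :
  has_density X g -> distribution P X [set z] = 0%E.
Proof.
move=> [mg g0 Xg]; rewrite Xg; last exact: measurable_point.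
by apply: null_set_integral; [exact: measurable_point| |exact: lebesgue_tuple1];
  apply/measurable_EFinP; exact: measurable_funTS.
Qed.

(** Resample the first of two points: it avoids the position of the second one
    almost surely. *)
Lemma ae_distinct {V : countType} (Z : V -> {RV P >-> E}) :
  mutually_independent Z -> (forall v z, distribution P (Z v) [set z] = 0%E) ->
  P.-negligible (~` [set w | injective (fun v => Z v w)]).
Proof.
move=> indep atomless; pose mu := joint_law Z.
have muG : product_law mu (fun v => distribution P (Z v)) by exact: joint_law_product.
pose same (uv : V * V) : set (labelled V E) := [set y | y uv.1 = y uv.2].
have msame uv : measurable (same uv).
  rewrite (_ : same uv = ~` [set y | y uv.1 != y uv.2]).
    by apply: measurableC; exact: measurable_distinct.
  apply/seteqP; split => y /= => [->|]; first by rewrite eqxx.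
  by move=> /negP; rewrite negbK => /eqP.
have same0 uv : uv.1 <> uv.2 -> mu (same uv) = 0%E.
  move=> neq; rewrite -(integral_indicT mu)//.
  rewrite (integral_update muG uv.1) => [||y]; last 2 first.
  - by apply/measurable_EFinP; exact: measurable_indic.
  - by rewrite lee_fin.
  apply: integral0_eq => y _; rewrite -[RHS](atomless uv.1 (y uv.2)).
  transitivity (\int[distribution P (Z uv.1)]_z (\1_[set y uv.2] z)%:E)%E.
    apply: eq_integral => z _; congr (_%:E); apply: eq_indic.
    by rewrite /same/= /update eqxx; case: eqP => // /esym/neq.
  by apply: (integral_indicT (distribution P (Z uv.1))); exact: measurable_point.
have neg : P.-negligible (\bigcup_n (if @unpickle (V * V)%type n is Some uv
    then [set w | uv.1 <> uv.2 /\ Z uv.1 w = Z uv.2 w] else set0)).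
  apply: negligible_bigcup => n; case: unpickle => [uv|]; last exact: negligible_set0.
  have [uv_eq|uv_neq] := pselect (uv.1 = uv.2).
    by apply: negligibleS (negligible_set0 P) => w /= [].
  apply: (@negligibleS _ _ _ P (joint Z @^-1` same uv)); first by move=> w [].
  apply/negligibleP; last exact: same0.
  by apply: preimage_measurable => //; exact: measurable_joint.
apply: negligibleS neg => w ninj; apply: contrapT => h; apply: ninj => u v uv.
apply: contrapT => neq; apply: h; exists (pickle (u, v)) => //.
by rewrite pickleK.
Qed.

End distinct_points.

Section light_tail.
Context {R : realType} {d : nat}.
Hypothesis d_gt0 : (0 < d)%N.
Local Notation E := (d.-tuple R).
Local Notation V := (d.-tuple int).
Local Notation config := (@configuration R d).
Let o : V := [tuple (0 : int) | i < d].
Context {disp : measure_display} {Omega : measurableType disp}.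
Variables (P : probability Omega R) (Y : V -> {RV P >-> E}) (g : E -> R).
Hypotheses (Y_indep : mutually_independent Y).
Hypothesis Y_density : forall x, has_density (Y x) g.
Variable K : R.
Hypothesis sums : P.-negligible (~` [set w | exists C, forall s : seq V, uniq s ->
  \sum_(v <- s) euclidean_norm (Y v w) <= K * (path_length o s)%:R + C]).
Variable e : R.
Hypotheses (e_gt0 : 0 < e) (e_le : e * d%:R * K <= 4^-1).

Let X v w := lattice_shift v (scale_point e (Y v w)).
Let Pi := perturbed_lattice (fun v w => scale_point e (Y v w)).

Let mX v : measurable_fun setT (fun t : E => lattice_shift v (scale_point e t)).
Proof.
exact: (measurableT_comp (measurable_lattice_shift v) (measurable_scale_point e)).
Qed.

Let Z v : {RV P >-> E} := compose_RV (mX v) (Y v).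

Let shift_scale_inj v : injective (fun t : E => lattice_shift v (scale_point e t)).
Proof.
move=> t t' tt'; apply: eq_from_tnth => i.
have := congr1 (fun t => tnth t i) tt'; rewrite !tnth_mktuple => /addrI.
by apply: mulfI; rewrite gt_eqF.
Qed.

Let distinct : P.-negligible (~` [set w | injective (fun v => X v w)]).
Proof.
apply: (@ae_distinct _ _ _ _ P _ Z) => [|v z].
  exact: compose_RV_independent.
transitivity (distribution P (Y v) ((fun t => lattice_shift v (scale_point e t)) @^-1` [set z])) => //.
set B := _ @^-1` _; have [[t Bt]|noB] := pselect (exists t, B t).
  rewrite (_ : B = [set t]); first exact: density_atomless (Y_density v).
  apply/seteqP; split => [t' Bt'|_ -> //]; apply: (@shift_scale_inj v).
  by rewrite /B/= in Bt Bt'; rewrite Bt Bt'.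
rewrite (_ : B = set0) ?measure0//; apply/seteqP; split => // t Bt; apply: noB.
by exists t.
Qed.

Let offsetE v w : offset v (X v w) <= e * d%:R * euclidean_norm (Y v w).
Proof.
apply: (@le_trans _ _ (\sum_(i < d) e * euclidean_norm (Y v w))).
  apply: ler_sum => i _; rewrite !tnth_mktuple addrC addKr normrM gtr0_norm//.
  by rewrite ler_pM2l//; exact: coordinate_le_euclidean_norm.
rewrite sumr_const card_ord -[_ *+ d]mulr_natr mulrAC; exact: lexx.
Qed.

(** Outcomes for which the configuration is matchable but no longer so after a
    deletion; they have probability one. *)
Let good w := injective (fun v => X v w) /\
  exists C, forall F, short_offsets C F (fun v => X v w).

Let ae_good : P.-negligible (~` [set w | good w]).
Proof.
apply: negligibleS (negligibleU distinct sums) => w /= ngood; apply: contrapT.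
move=> /not_orP[/contrapT inj /contrapT[C h]]; apply: ngood; split => //.
exists (e * d%:R * C) => F s us _.
apply: (@le_trans _ _ (e * d%:R * \sum_(v <- s) euclidean_norm (Y v w))).
  by rewrite mulr_sumr; apply: ler_sum => v _; exact: offsetE.
have ed : 0 <= e * d%:R by rewrite mulr_ge0// ltW.
apply: le_trans (ler_wpM2l ed (h s us)) _.
rewrite mulrDr lerD2r mulrA mulrC; apply: ler_wpM2l => //; exact: ler0n.
Qed.

Let matched : set config := \bigcup_(n in [set: nat]) matchable n%:R.

Let measurable_matched : measurable matched.
Proof. by apply: bigcupT_measurable => n; exact: measurable_matchable. Qed.

Let good_matched w : good w -> matched (Pi w).
Proof.
move=> [inj [C h]]; exists (Num.bound `|C + 1|) => //.
have := @points_matchable _ _ C (Pi w) (fun v => X v w) inj _ h.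
move=> H F; have [mc [cinj short] hit] := H (fun v => ex_intro2 _ _ v I erefl) F.
exists mc => //; split => // p pc s us sF; apply: le_trans (short p pc s us sF) _.
rewrite lerD2l; apply: le_trans (ler_norm _) _; apply/ltW; exact: archi_boundP.
Qed.

Let good_unmatched w (S : config) z : good w -> (Pi w : set E) z ->
  (S : set E) `<=` (Pi w : set E) `\ z -> ~ matched S.
Proof.
move=> [inj [C h]] Piz SPi [n _ /matchable_points nS].
apply: (@no_matching_after_deletion _ _ (fun v => X v w) C n%:R z h Piz) => F.
have [p [pinj pS short]] := nS F.
by exists p; split => // v vF; apply: SPi; exact: pS.
Qed.

(** The separating event is that the configuration is not matchable. In the
    copy of the process, the point [U u] is isolated by a dyadic cell; that
    such a removal leaves a matchable configuration is a null event for the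
    perturbed lattice, for each of the countably many cells. *)
Lemma light_tail_deletion_singular k : (0 < k)%N -> deletion_singular P k Pi.
Proof.
move=> k0 disp' Omega' P' Pi' U same [U_in _].
exists (~` matched); split.
- exact: measurableC.
- by apply: negligibleS ae_good => w /= nm /good_matched.
have mPi : measurable_fun setT Pi.
  have := measurableT_comp (measurable_points_off (R := R) (d := d) set0) (measurable_joint Z).
  by congr measurable_fun; apply/funext => w; rewrite /points_off /= setC0.
have null' (A : set config) : measurable A -> P.-negligible (Pi @^-1` A) ->
    P'.-negligible (Pi' @^-1` A).
  move=> mA A0; apply/negligibleP.
    by apply: preimage_measurable => //; exact: measurable_funPT.
  transitivity (pushforward P Pi A); first exact: same.
  by apply/(negligibleP P) => //; exact: preimage_measurable.
have lf' : P'.-negligible (Pi' @^-1` ~` [set S : config | locally_finite (S : set E)]).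
  apply: null'; first by apply: measurableC; exact: measurable_locally_finite.
  have sitefin : P.-negligible (~` [set w | site_finite (joint Z w)]).
    pose T v : {RV P >-> E} := compose_RV (measurable_scale_point e) (Y v).
    apply: (@ae_site_finite _ _ _ _ P T) => v B mB.
    have mB' : measurable (scale_point e @^-1` B).
      by apply: preimage_measurable => //; exact: measurable_scale_point.
    transitivity (distribution P (Y v) (scale_point e @^-1` B)) => //.
    transitivity (distribution P (Y [tuple 0 | i < d]) (scale_point e @^-1` B)) => //.
    by have [_ _ ->] := Y_density v => //; have [_ _ ->] := Y_density [tuple 0 | i < d].
  apply: negligibleS sitefin => w wlf wfin; apply: wlf.
  have := points_off_locally_finite set0 wfin.
  by rewrite /points_off setC0.
pose split_off (mc : nat * V) : set config :=
  [set S : config | at_least 1 ((S : set E) `&` dyadic_cell mc.1 mc.2)] `&`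
  (fun S : config => ((S : set E) `&` ~` dyadic_cell mc.1 mc.2 : config)) @^-1` matched.
have msplit mc : measurable (split_off mc).
  apply: measurableI; first by apply: measurable_at_least; exact: measurable_dyadic_cell.
  apply: (preimage_measurable _ measurable_matched); apply: measurable_restriction.
  by apply: measurableC; exact: measurable_dyadic_cell.
have neg : P'.-negligible (\bigcup_n (if @unpickle (nat * V)%type n is Some mc
    then Pi' @^-1` split_off mc else set0)).
  apply: negligible_bigcup => n; case: unpickle => [mc|]; last exact: negligible_set0.
  apply: null' => //; apply: negligibleS ae_good => w [[s [_ s1 sS]] sm] gw.
  case: s s1 sS => [|z [|]]// _ zS; have [Sz zc] := zS z (mem_head _ _).
  apply: (good_unmatched gw Sz) sm => x [Sx nx]; split => //= xz.
  by apply: nx; rewrite xz.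
pose u := Ordinal k0.
apply: negligibleS (negligibleU (U_in u) (negligibleU lf' neg)) => w /= wm.
have {}wm : matched (delete_points (Pi' w) (U ^~ w)) by exact: contrapT.
have [Uw|nUw] := pselect ((Pi' w : set E) (U u w)); last by left.
right; have [lfw|nlfw] := pselect (locally_finite (Pi' w : set E)); last by left.
right; have [m mE] := locally_finite_deletion (fun _ : 'I_1 => U u w) lfw.
exists (pickle (m, dyadic_index m (U u w))) => //; rewrite pickleK /=; split.
  by exists [:: U u w]; split => // z; rewrite inE => /eqP ->.
case: wm => n _ nm; exists n => //; apply: matchable_sub nm => z [Sz Uz].
have : delete_points (Pi' w) (fun _ : 'I_1 => U u w) z.
  by split => // -[i _ uz]; apply: Uz; exists u.
rewrite mE => -[_ h]; split => // zc; apply: h; exists ord0 => //.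
Qed.

End light_tail.

Lemma ltr_powR2 {R : realType} (x y : R) : x < y -> 2 `^ x < 2 `^ y.
Proof.
move=> xy; rewrite /powR gt_eqF// ltr_expR ltr_pM2r//.
by rewrite ln_gt0// ltr1n.
Qed.

(** The [d]-th power of the witness is midway between [2 ^ (- p)] and
    [2 ^ (- d)] on the logarithmic scale. *)
Lemma exists_layer_ratio {R : realType} (d : nat) (p : R) : (0 < d)%N -> d%:R < p ->
  exists r : R, [/\ 0 < r, 2 * r < 1 & 2 `^ (- p) < r ^+ d].
Proof.
move=> d0 dp; have dR : 0 < d%:R :> R by rewrite ltr0n.
exists (2 `^ (- ((p + d%:R) / (2 * d%:R)))); split.
- by rewrite powR_gt0.
- rewrite -[X in X * _]powRr1// -powRD; last by rewrite pnatr_eq0 implybT.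
  rewrite -[ltRHS](powRr0 2); apply: ltr_powR2.
  by rewrite subr_lt0 ltr_pdivlMr ?mulr_gt0// mul1r; lra.
rewrite -powR_mulrn ?powR_ge0// -powRrM; apply: ltr_powR2.
rewrite mulNr ltrN2 [_ / _ * _](_ : _ = (p + d%:R) / 2); first lra.
by field; rewrite gt_eqF.
Qed.

Section tails.
Context {R : realType} {d : nat}.
Local Notation E := (d.-tuple R).

Lemma euclidean_norm_ge0 (y : E) : 0 <= euclidean_norm y.
Proof. exact: sqrtr_ge0. Qed.

Lemma measurable_euclidean_norm : measurable_fun setT (euclidean_norm : E -> R).
Proof.
have msum : measurable_fun setT (fun y : E => \sum_(i < d) tnth y i ^+ 2).
  apply: measurable_sum => i; apply: measurable_funX; exact: measurable_tnth.
have msqrt : measurable_fun setT (Num.sqrt : R -> R).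
  by apply: continuous_measurable_fun; exact: sqrt_continuous.
exact: (measurableT_comp msqrt msum).
Qed.

Lemma measurable_far (t : R) : measurable [set y : E | t < euclidean_norm y].
Proof.
rewrite (_ : [set _ | _] = euclidean_norm @^-1` `]t, +oo[).
  by apply: preimage_measurable => //; exact: measurable_euclidean_norm.
by apply/seteqP; split => y /=; rewrite in_itv/= andbT.
Qed.

Context {disp : measure_display} {Omega : measurableType disp}.
Variable P : probability Omega R.

(** By Markov's inequality for the power [p]. *)
Lemma moment_tail (X : {RV P >-> E}) (p : R) : 0 <= p ->
  ('E_P[fun w => (euclidean_norm (X w) `^ p)%R] < +oo)%E ->
  exists2 kappa, 0 <= kappa & forall j,
    (distribution P X [set y | 2 ^+ j < euclidean_norm y]%R <=
     (kappa * (2 `^ (- p)) ^+ j)%:E)%E.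
Proof.
move=> p0 moment; pose Xn := compose_RV measurable_euclidean_norm X.
have moment0 : (0 <= 'E_P[fun w => (euclidean_norm (X w) `^ p)%R])%E.
  by apply: expectation_ge0 => w; exact: powR_ge0.
exists (fine 'E_P[fun w => (euclidean_norm (X w) `^ p)%R]); first exact: fine_ge0.
move=> j; have t0 : 0 < 2 ^+ j :> R by rewrite exprn_gt0.
have := @markov _ _ _ P Xn (fun x => x `^ p) (2 ^+ j) t0 (measurable_powR p) _ _.
have -> : (fun x : R => x `^ p) \o (fun x => `|x|%R) \o Xn =
    fun w => euclidean_norm (X w) `^ p.
  by apply/funext => w /=; rewrite ger0_norm ?euclidean_norm_ge0.
move=> /(_ (fun x _ => powR_ge0 x p)) /(_ (fun x y x0 y0 xy => ge0_ler_powR p0 x0 y0 xy)) Mk.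
have farE : [set w | ((2 ^+ j)%:E <= `|(Xn w)%:E|)%E] = Xn @^-1` `[2 ^+ j, +oo[.
  by apply/seteqP; split => w /=; rewrite in_itv/= andbT lee_fin ger0_norm//;
    exact: euclidean_norm_ge0.
rewrite {}farE in Mk; set A := _ @^-1` _ in Mk.
have mA : measurable A.
  exact: (preimage_measurable (measurable_funPT Xn) (measurable_itv _)).
have mX : measurable (X @^-1` [set y | 2 ^+ j < euclidean_norm y]).
  exact: (preimage_measurable (measurable_funPT X) (measurable_far _)).
apply: (@le_trans _ _ (P A)).
  apply: (@le_measure _ _ _ P _ _ (mem_set mX) (mem_set mA)) => w /= /ltW h.
  by rewrite /A/= in_itv/= andbT.
move: Mk; rewrite powR_expn//.
have finA : P A \is a fin_num by exact: fin_num_measure.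
rewrite -(fineK finA) -[X in (_ <= X)%E -> _]fineK ?ge0_fin_numE//.
rewrite -EFinM !lee_fin powRN exprVn ler_pdivlMr ?exprn_gt0 ?powR_gt0//.
by rewrite mulrC.
Qed.

(** The shell between the radii [2 ^ i] and [2 ^ i.+1] has volume of order
    [2 ^ (i * d)] and density of order [2 ^ (- i * alpha)], hence probability
    of order [2 ^ (- i * p)]; the shells beyond [2 ^ j] form a geometric
    series. *)
Lemma density_tail (X : {RV P >-> E}) (g : E -> R) (M alpha p : R) :
  has_density X g -> 0 <= M -> (forall y, g y <= M * power_tail alpha y) ->
  0 < p -> alpha = p + d%:R ->
  exists2 kappa, 0 <= kappa & forall j,
    (distribution P X [set y | 2 ^+ j < euclidean_norm y]%R <=
     (kappa * (2 `^ (- p)) ^+ j)%:E)%E.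
Proof.
move=> [mg g0 Xg] M0 g_le p0 alphaE.
set b := 2 `^ (- p); have b0 : 0 < b by rewrite powR_gt0.
have b1 : b < 1 by rewrite -[ltRHS](powRr0 2); apply: ltr_powR2; rewrite oppr_lt0.
have alpha0 : 0 <= alpha by rewrite alphaE addr_ge0// ltW.
pose kappa := M * 6 ^+ d.
have kappa0 : 0 <= kappa by rewrite mulr_ge0// exprn_ge0.
pose shell i : set E := [set y | 2 ^+ i < euclidean_norm y] `&`
  ~` [set y | 2 ^+ i.+1 < euclidean_norm y].
have mshell i : measurable (shell i).
  by apply: measurableI; [|apply: measurableC]; exact: measurable_far.
have shell_le i : (distribution P X (shell i) <= (kappa * b ^+ i)%:E)%E.
  have t0 : 0 < 2 ^+ i :> R by rewrite exprn_gt0.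
  have t1 : 1 <= 2 ^+ i :> R by rewrite exprn_ege1// ler1n.
  rewrite Xg//.
  pose cube : set E := tuple_box (fun=> `[- (2 ^+ i.+1), 2 ^+ i.+2[%classic).
  have mcube : measurable cube by apply: measurable_tuple_box => l; exact: measurable_itv.
  have side : - (2 ^+ i.+1) <= 2 ^+ i.+2 :> R.
    by rewrite (@le_trans _ _ 0)// ?oppr_le0 ?exprn_ge0.
  have H0 : 0 <= M * (2 ^+ i) `^ (- alpha) by rewrite mulr_ge0// powR_ge0.
  apply: (@le_trans _ _ (\int[lebesgue_tuple d]_(y in shell i)
      (M * (2 ^+ i) `^ (- alpha))%:E)%E).
    apply: ge0_le_integral => //.
    - by move=> y _; rewrite lee_fin.
    - by apply/measurable_EFinP; exact: measurable_funTS.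
    move=> y [/= yi _]; rewrite lee_fin; apply: le_trans (g_le y) _.
    apply: ler_wpM2l => //; have y0 : 0 < euclidean_norm y by exact: lt_trans yi.
    rewrite /power_tail gt_eqF//; apply: (@le_trans _ _ (euclidean_norm y `^ (- alpha))).
      by rewrite ge_min lexx orbT.
    rewrite !powRN lef_pV2 ?posrE ?powR_gt0//.
    by apply: (ge0_ler_powR alpha0); rewrite ?nnegrE; apply: ltW.
  have -> : (\int[lebesgue_tuple d]_(y in shell i) (M * (2 ^+ i) `^ (- alpha))%:E =
      (M * (2 ^+ i) `^ (- alpha))%:E * lebesgue_tuple d (shell i))%E.
    exact: integral_cst.
  apply: (@le_trans _ _ ((M * (2 ^+ i) `^ (- alpha))%:E * lebesgue_tuple d cube)%E).
    apply: lee_wpmul2l; first by rewrite lee_fin.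
    apply: le_measure; rewrite ?inE// => y [_ /negP]; rewrite -leNgt => yi l /=.
    have := coordinate_le_euclidean_norm y l; rewrite in_itv/= => yl.
    have {yl} : `|tnth y l| <= 2 ^+ i.+1 by exact: le_trans yi.
    have t2 : 0 < 2 ^+ i.+1 :> R by rewrite exprn_gt0.
    rewrite ler_norml => /andP[-> h] /=; apply: le_lt_trans h _.
    by rewrite [ltRHS]exprS; lra.
  rewrite /cube lebesgue_tuple_cube//.
  rewrite -EFinM lee_fin le_eqVlt; apply/orP; left; apply/eqP.
  have -> : 2 ^+ i.+2 - - 2 ^+ i.+1 = 6 * 2 ^+ i :> R by rewrite !exprS; ring.
  have -> : b = 2 `^ (- alpha) * 2 ^+ d.
    rewrite -powR_mulrn// -powRD; last by rewrite pnatr_eq0 implybT.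
    by rewrite alphaE /b; congr (_ `^ _); ring.
  rewrite powR_expn// exprMn [(_ * _) ^+ i]exprMn /kappa -!exprM [(d * i)%N]mulnC.
  by ring.
exists (kappa / (1 - b)) => [|j]; first by rewrite divr_ge0// subr_ge0 ltW.
apply: (@le_trans _ _ (\sum_(0 <= i <oo) distribution P X (shell (j + i)%N))%E).
  apply: measure_sigma_subadditive => [//||y /= yj]; first exact: measurable_far.
  have [N yN] : exists N, euclidean_norm y <= 2 ^+ N.
    exists (Num.bound (euclidean_norm y)); apply/ltW.
    apply: lt_le_trans (archi_boundP (euclidean_norm_ge0 y)) _.
    by rewrite -natrX ler_nat ltnW// ltn_expl.
  case: (ex_minnP (ex_intro (fun N => euclidean_norm y <= 2 ^+ N) N yN)) => n yn nmin.
  have jn : (j < n)%N.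
    by rewrite ltnNge; apply/negP => /(@ler_weXn2l _ (2 : R)); lra.
  exists (n - j.+1)%N => //; split => /=.
    rewrite ltNge; apply/negP => /nmin; lia.
  by apply/negP; rewrite -leNgt (_ : (j + (n - j.+1)).+1 = n)//; lia.
rewrite [leRHS](_ : _ = (kappa * b ^+ j / (1 - b))%:E); last by congr (_%:E); ring.
apply: nneseries_geometric_le => [||i].
- by rewrite mulr_ge0// exprn_ge0// ltW.
- by rewrite b1 ltW.
- by rewrite measure_ge0 -mulrA -exprD; exact: shell_le.
Qed.

End tails.

Lemma ereal_sup_lty_upper_bound {R : realType} {d : nat} (alpha : R)
    (g : d.-tuple R -> R) : (forall y, 0 <= g y) ->
  (ereal_sup (range (fun y => (g y / power_tail alpha y)%:E)) < +oo)%E ->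
  exists2 M, 0 <= M & forall y, g y <= M * power_tail alpha y.
Proof.
move=> g0; set r := range _; move=> roo.
have ler y : ((g y / power_tail alpha y)%:E <= ereal_sup r)%E.
  by apply: ereal_sup_ubound; exists y.
have r0 : (0 <= ereal_sup r)%E.
  apply: le_trans (ler [tuple 0 | i < d]); rewrite lee_fin.
  by rewrite divr_ge0// ltW// power_tail_gt0.
have rfin : ereal_sup r \is a fin_num by rewrite ge0_fin_numE.
exists (fine (ereal_sup r)) => [|y]; first exact: fine_ge0.
by rewrite -ler_pdivrMr ?power_tail_gt0// -lee_fin fineK.
Qed.

Lemma small_perturbation_deletion_singular {R : realType} {d : nat}
    {disp : measure_display} {Omega : measurableType disp}
    (P : probability Omega R) (Y : d.-tuple int -> {RV P >-> d.-tuple R})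
    (g : d.-tuple R -> R) (kappa p : R) : (0 < d)%N ->
  mutually_independent Y -> (forall x, has_density (Y x) g) ->
  d%:R < p -> 0 <= kappa ->
  (forall j, (distribution P (Y [tuple (0 : int) | i < d])
     [set y | 2 ^+ j < euclidean_norm y]%R <= (kappa * (2 `^ (- p)) ^+ j)%:E)%E) ->
  exists eps : R, 0 < eps /\
    forall eps' : R, 0 < eps' < eps -> forall k : nat, (1 <= k)%N ->
      deletion_singular P k
        (perturbed_lattice (fun x w => scale_point eps' (Y x w))).
Proof.
move=> d0 indep dens dp kappa0 tail.
have [r [r0 r2 rb]] := exists_layer_ratio d0 dp.
pose W v : {RV P >-> R} := compose_RV measurable_euclidean_norm (Y v).
have W_indep : mutually_independent W by exact: compose_RV_independent.
have [K K0 sums] : exists2 K, 0 < K & P.-negligible (~` [set w | exists C,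
    forall s : seq (d.-tuple int), uniq s -> \sum_(v <- s) W v w <=
      K * (path_length [tuple (0 : int) | i < d] s)%:R + C]).
  apply: (ae_sum_along_paths W_indep _ kappa0 (powR_ge0 _ _) r0 r2 rb) => j v.
  apply: le_trans (tail j).
  have far : W v @^-1` `](2 ^+ j)%R, +oo[ =
      Y v @^-1` [set y | 2 ^+ j < euclidean_norm y].
    by apply/seteqP; split => w /=; rewrite in_itv/= andbT.
  have mfar : measurable [set y : d.-tuple R | 2 ^+ j < euclidean_norm y].
    exact: measurable_far.
  rewrite far; have [_ _ yv] := dens v; have [_ _ yo] := dens [tuple (0 : int) | i < d].
  by rewrite le_eqVlt; apply/orP; left; apply/eqP; exact: etrans (yv _ mfar) (esym (yo _ mfar)).
have dR : 0 < d%:R :> R by rewrite ltr0n.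
exists (4 * (d%:R * K))^-1; split; first by rewrite invr_gt0 !mulr_gt0.
move=> e /andP[e0 e_lt] k k0.
apply: (light_tail_deletion_singular d0 indep dens sums e0) => //.
rewrite -mulrA -ler_pdivlMr ?mulr_gt0// -invfM; exact: ltW.
Qed.

Theorem theorem3p1 (R : realType) (d : nat) (d_gt0 : (0 < d)%N)
    (disp : measure_display) (Omega : measurableType disp)
    (P : probability Omega R)
    (Y : d.-tuple int -> {RV P >-> d.-tuple R}) (g : d.-tuple R -> R)
    (Y_indep : mutually_independent Y)
    (Y_density : forall x, has_density (Y x) g) (alpha : R) :
  (alpha < 2 * d%:R ->
   (0 < ereal_inf (range (fun y => (g y / power_tail alpha y)%:E)))%E ->
     (forall k : nat, (1 <= k)%N ->
        deletion_tolerant P k (perturbed_lattice Y) /\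
        insertion_tolerant P k (perturbed_lattice Y)) /\
     (forall S : set (d.-tuple int), finite_set S ->
        law_dominated P (perturbed_lattice Y) P (perturbed_lattice_off S Y) /\
        law_dominated P (perturbed_lattice_off S Y) P (perturbed_lattice Y)))
  /\
  (2 * d%:R < alpha ->
   (ereal_sup (range (fun y => (g y / power_tail alpha y)%:E)) < +oo)%E \/
   (forall x,
      ('E_P[fun w => (euclidean_norm (Y x w) `^ (alpha - d%:R))%R] < +oo)%E) ->
     exists eps : R, 0 < eps /\
       forall eps' : R, 0 < eps' < eps -> forall k : nat, (1 <= k)%N ->
         deletion_singular P k
           (perturbed_lattice (fun x w => scale_point eps' (Y x w)))).
Proof.
pose o : d.-tuple int := [tuple (0 : int) | i < d].
split=> [alpha_lt /ereal_inf_gt0_lower_bound[c c0 g_ge]|alpha_gt light].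
  have alpha0 := heavy_tail_exponent_ge0 d_gt0 (Y_density o) c0 g_ge.
  split => [k _|S fS]; last first.
    exact: (finite_deletion_equivalence d_gt0 Y_indep Y_density c0 alpha0 alpha_lt g_ge).
  split.
    exact: (heavy_tail_deletion_tolerant d_gt0 Y_indep Y_density c0 alpha0 alpha_lt g_ge).
  exact: (heavy_tail_insertion_tolerant d_gt0 Y_indep Y_density c0 alpha0 alpha_lt g_ge).
pose p := alpha - d%:R; have dp : d%:R < p by rewrite /p; lra.
have p0 : 0 < p by apply: lt_trans dp; rewrite ltr0n.
have [kappa kappa0 tail] : exists2 kappa, 0 <= kappa & forall j,
    (distribution P (Y o) [set y | 2 ^+ j < euclidean_norm y]%R <=
     (kappa * (2 `^ (- p)) ^+ j)%:E)%E.
  case: light => [sup_lt|moment]; last by apply: moment_tail (moment o); exact: ltW.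
  have [_ g0 _] := Y_density o.
  have [M M0 g_le] := ereal_sup_lty_upper_bound g0 sup_lt.
  by apply: (density_tail (Y_density o) M0 g_le p0); rewrite subrK.
exact: (small_perturbation_deletion_singular d_gt0 Y_indep Y_density dp kappa0 tail).
Qed.
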